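(* Let $s>1$ and let $\Delta_{0,s}$ be the ultra-hyperbolic operator on the pseudo $H$-type group $G_{0,s}\cong\mathbb R^{2n+s}$. For $\xi\in\mathbb R^{2n}$ and $\vartheta\in\mathbb R^s\setminus\{0\}$ put $$q(\xi,\vartheta)=\frac{i}{(2\pi)^{n+\frac s2}}\int_0^\infty \frac{1}{|\vartheta|\cosh^n t}\exp\Big\{ i\,\frac{\tanh t}{|\vartheta|}\,P(\xi)\Big\}\,dt ,\qquad P(\xi)=\sum_{j=1}^n(\xi_j^2-\xi_{n+j}^2),$$ and let $K_{0,s}\in\mathcal S'(\mathbb R^{2n+s})$ be the tempered distribution $$K_{0,s}(\varphi)=\int_{\mathbb R^{2n+s}} q(\xi,\vartheta)\,[\mathcal F\varphi](\xi,\vartheta)\,d\xi\,d\vartheta,\qquad \varphi\in\mathcal S(\mathbb R^{2n+s}).$$ Then $K_{0,s}$ is a fundamental solution of $\Delta_{0,s}$, i.e. $\Delta_{0,s}K_{0,s}=\delta_0$, or equivalently $$K_{0,s}(\Delta_{0,s}\varphi)=\varphi(0)\quad\text{for all }\varphi\in\mathcal S(\mathbb R^{2n+s}).$$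
   Context: Setting. Let $s>1$ be an integer and equip $\mathbb R^{0,s}=\mathbb R^{s}$ with $\langle z,w\rangle_{0,s}=-\sum_{j=1}^s z_{j}w_{j}$. Let $V\neq 0$ be an admissible Clifford module: a finite-dimensional real vector space with a non-degenerate symmetric bilinear form $\langle\cdot,\cdot\rangle_V$ and a linear map $z\mapsto J_z\in \mathrm{End}(V)$, $z\in\mathbb R^{0,s}$, with $J_z^2=-\langle z,z\rangle_{0,s}I$ and $\langle J_zX,Y\rangle_V=-\langle X,J_zY\rangle_V$. The form on $V$ then has signature $(n,n)$ and $\dim V=2n$. Define $[X,Y]\in\mathbb R^{0,s}$ for $X,Y\in V$ by $\langle J_zX,Y\rangle_V=\langle z,[X,Y]\rangle_{0,s}$ for all $z$; $\mathcal N_{0,s}=V\oplus\mathbb R^{0,s}$ with center $\mathbb R^{0,s}$ is a 2-step nilpotent Lie algebra and $G_{0,s}\cong\mathbb R^{2n+s}$ is the corresponding connected simply connected Lie group (identified with its Lie algebra via exp). Fix a basis $X_1,\dots,X_{2n}$ of $V$ with $\langle X_i,X_j\rangle_V=\delta_{ij}$ for $i,j\le n$, $=-\delta_{ij}$ for $i,j>n$, and $=0$ for $i\le n<j$, and let $Z_1,\dots,Z_{s}$ be the standard basis of $\mathbb R^{0,s}$. Write $[X_i,X_j]=2\sum_k a_{ij}^kZ_k$. In coordinates $(x,z)\in\mathbb R^{2n}\times\mathbb R^{s}$ the left-invariant vector fields are $X_j=\partial_{x_j}+\sum_{m=1}^{2n}\sum_{k=1}^{s}a_{mj}^kx_m\partial_{z_k}$,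 and the ultra-hyperbolic operator is $\Delta_{0,s}=\sum_{j=1}^n X_j^2-\sum_{j=n+1}^{2n}X_j^2$. Fourier transform on $\mathbb R^d$: $[\mathcal F\varphi](\xi)=(2\pi)^{-d/2}\int\varphi(x)e^{-ix\cdot\xi}dx$. For $s>1$ the function $q$ (defined a.e.) is integrable against $(1+|\xi|^2+|\vartheta|^2)^{-N}$ for $N$ large, so $K_{0,s}$ is a tempered distribution. $\Delta_{0,s}$ equals its own transpose, so $(\Delta_{0,s}K)(\varphi)=K(\Delta_{0,s}\varphi)$. *)

(* Defs.v *)
From HB Require Import structures.
From mathcomp Require Import all_boot all_order all_algebra.
From mathcomp Require Import sesquilinear.
From mathcomp Require Import all_classical all_reals all_analysis.
From mathcomp Require Import complex.

Set Implicit Arguments.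
Unset Strict Implicit.
Unset Printing Implicit Defensive.

Import Order.TTheory GRing.Theory Num.Theory.
Import numFieldNormedType.Exports.

Local Open Scope classical_set_scope.
Local Open Scope ring_scope.
Local Open Scope complex_scope.


Definition rV_display : measure_display.
Proof. exact: default_measure_display. Qed.

Section measurable_rV.
Context {R : realType} {d : nat}.

Let coord (i : 'I_d) (x : 'rV[R]_d) : measurableTypeR R := x ord0 i.

Let rV_set0 : g_sigma_preimage coord set0.
Proof. exact: sigma_algebra0. Qed.

Let rV_setC A : g_sigma_preimage coord A -> g_sigma_preimage coord (~` A).
Proof. exact: sigma_algebraC. Qed.

Let rV_bigcup (F : _^nat) : (forall i, g_sigma_preimage coord (F i)) ->
  g_sigma_preimage coord (\bigcup_i (F i)).
Proof. exact: sigma_algebra_bigcup. Qed.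

(* The product sigma-algebra, generated by the coordinates, which on R^d is
   the Borel sigma-algebra. *)
HB.instance Definition _ := @isMeasurable.Build rV_display 'rV[R]_d
  (g_sigma_preimage coord) rV_set0 rV_setC rV_bigcup.

Lemma measurable_coord (i : 'I_d) :
  measurable_fun [set: 'rV[R]_d] (fun x => x ord0 i : measurableTypeR R).
Proof.
move=> _ Y mY; rewrite setTI; apply: sub_sigma_algebra => /=.
rewrite -bigcup_seq/=; exists i => /=; first by rewrite mem_index_enum.
by exists Y => //; rewrite setTI.
Qed.

Lemma measurable_fun_rVP d1 (T1 : measurableType d1) (f : T1 -> 'rV[R]_d) :
  measurable_fun [set: T1] f <->
  forall i, measurable_fun [set: T1] (fun t => f t ord0 i : measurableTypeR R).
Proof.
split=> [mf i|mf].
  exact: (measurableT_comp (measurable_coord i) mf).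
have sub : g_sigma_preimage (fun i => coord i \o f) `<=` measurable.
  apply: smallest_sub; first exact: sigma_algebra_measurable.
  rewrite -bigcup_seq => A [i _ [B mB <-]].
  exact: mf.
move=> _ A mA; apply: sub; rewrite g_sigma_preimage_comp.
by exists A.
Qed.

End measurable_rV.

Section lebesgue_rV.
Context {R : realType}.

Definition rV_cons d (p : measurableTypeR R * 'rV[R]_d) : 'rV[R]_d.+1 :=
  row_mx (p.1)%:M p.2 : 'rV_(1 + d).

Definition rV_uncons d (v : 'rV[R]_d.+1) : measurableTypeR R * 'rV[R]_d :=
  (v ord0 ord0, rsubmx (v : 'rV_(1 + d))).

Lemma rV_consK d : cancel (@rV_cons d) (@rV_uncons d).
Proof.
case=> x v; rewrite /rV_cons /rV_uncons/=; congr pair; last exact: row_mxKr.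
transitivity (row_mx x%:M v ord0 (lshift d (ord0 : 'I_1))).
  by congr (row_mx _ _ _ _); exact/val_inj.
by rewrite row_mxEl mxE eqxx mulr1n.
Qed.

Lemma rV_unconsK d : cancel (@rV_uncons d) (@rV_cons d).
Proof.
move=> v; rewrite /rV_cons /rV_uncons/=.
have -> : (v ord0 ord0)%:M = lsubmx (v : 'rV_(1 + d)).
  apply/rowP => i; rewrite (ord1 i) !mxE eqxx mulr1n.
  by congr (fun_of_matrix v _ _); exact/val_inj.
exact: (@hsubmxK _ 1 1 d v).
Qed.

Lemma measurable_rV_cons d : measurable_fun setT (@rV_cons d).
Proof.
apply/measurable_fun_rVP => i.
have [->|[j ->]] : i = ord0 \/ exists j : 'I_d, i = rshift 1 j.
  case: (@split_ordP 1 d i) => j ->; [left|by right; exists j].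
  by rewrite ord1; exact/val_inj.
- rewrite (_ : (fun t => _) = fst)//; apply/funext => t.
  exact: (congr1 fst (rV_consK t)).
- rewrite (_ : (fun t => _) = (fun t : _ * 'rV[R]_d => t.2 ord0 j)).
    exact: (measurableT_comp (measurable_coord j) measurable_snd).
  by apply/funext => t; exact: (@row_mxEr _ 1 1 d _ _ ord0 j).
Qed.

Lemma measurable_rV_uncons d : measurable_fun setT (@rV_uncons d).
Proof.
apply/measurable_fun_pair; first exact: measurable_coord.
apply/measurable_fun_rVP => i.
rewrite (_ : (fun t => _) = (fun t : 'rV[R]_d.+1 => t ord0 (rshift 1 i))).
  exact: measurable_coord.
by apply/funext => t; rewrite /= mxE.
Qed.

Section step.
Context {d : nat} (m : {sigma_finite_measure set 'rV[R]_d -> \bar R}).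

Definition lebesgue_rV_step : set 'rV[R]_d.+1 -> \bar R :=
  pushforward ((@lebesgue_measure R) \x m)%E (@rV_cons d).

Let map0 : lebesgue_rV_step set0 = 0%E.
Proof. by rewrite /lebesgue_rV_step /pushforward preimage_set0 measure0. Qed.

Let map_ge0 A : (0 <= lebesgue_rV_step A)%E.
Proof. by rewrite /lebesgue_rV_step /pushforward measure_ge0. Qed.

Let map_sigma_additive : semi_sigma_additive lebesgue_rV_step.
Proof.
move=> F mF tF mUF; rewrite /lebesgue_rV_step /pushforward preimage_bigcup.
have mc k : measurable (@rV_cons d @^-1` F k).
  by rewrite -[X in measurable X]setTI; exact: measurable_rV_cons.
apply: measure_semi_sigma_additive => //; last exact: bigcupT_measurable.
apply/trivIsetP => /= i j _ _ ij; rewrite -preimage_setI.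
by move/trivIsetP : tF => /(_ _ _ _ _ ij) ->//; rewrite preimage_set0.
Qed.

HB.instance Definition _ := isMeasure.Build _ _ _ lebesgue_rV_step
  map0 map_ge0 map_sigma_additive.

Let map_sigma_finite : sigma_finite setT lebesgue_rV_step.
Proof.
have /sigma_finiteP[F [TF ndF Foo]] := sigma_finiteT (@lebesgue_measure R).
have /sigma_finiteP[G [TG ndG Goo]] := sigma_finiteT m.
exists (fun k => @rV_uncons d @^-1` (F k `*` G k)).
  rewrite -preimage_bigcup -[LHS](preimage_setT (@rV_uncons d)).
  congr (_ @^-1` _); rewrite -setXTT TF TG predeqE => -[x y]; split.
    move=> [/= [i _ Fix] [k _ Gky]]; exists (maxn i k) => //; split.
    - by move: x Fix; exact/subsetPset/ndF/leq_maxl.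
    - by move: y Gky; exact/subsetPset/ndG/leq_maxr.
  by move=> [i _ []/= ? ?]; split; exists i.
move=> k; have [mF Fk] := Foo k; have [mG Gk] := Goo k.
have mFG : measurable (F k `*` G k) by exact: measurableX.
split.
  by rewrite -[X in measurable X]setTI; exact: measurable_rV_uncons.
rewrite /lebesgue_rV_step /pushforward -comp_preimage.
rewrite (_ : _ \o _ = id); last by apply/funext => p /=; rewrite rV_consK.
by rewrite preimage_id product_measure1E// lte_mul_pinfty// ge0_fin_numE.
Qed.

HB.instance Definition _ := Measure_isSigmaFinite.Build _ _ _ lebesgue_rV_step
  map_sigma_finite.

End step.

(* R^0 is a point, and R^{d+1} carries the product measure transported along
   R * R^d -> R^{d+1}. *)
Fixpoint lebesgue_rV (d : nat) : {sigma_finite_measure set 'rV[R]_d -> \bar R} :=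
  match d with
  | 0 => dirac (0 : 'rV[R]_0)
  | d'.+1 => lebesgue_rV_step (lebesgue_rV d')
  end.

Lemma lebesgue_rV_box d (A : 'I_d -> set (measurableTypeR R)) :
  (forall i, measurable (A i)) ->
  lebesgue_rV d [set x | forall i, A i (x ord0 i)] =
  (\prod_(i < d) @lebesgue_measure R (A i))%E.
Proof.
elim: d A => [|d IH] A mA.
  by rewrite big_ord0 /= diracE mem_set//= => -[].
set B := [set y : 'rV[R]_d | forall i, A (lift ord0 i) (y ord0 i)].
have mB : measurable B.
  have -> : B = \bigcap_(i in [set: 'I_d])
      ((fun x : 'rV[R]_d => x ord0 i) @^-1` A (lift ord0 i)).
    by apply/seteqP; split=> x /= h i; [move=> _|]; exact: h.
  apply: fin_bigcap_measurable => // i _; rewrite -[X in measurable X]setTI.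
  exact: measurable_coord.
rewrite big_ord_recl -IH// -/B -product_measure1E//=.
rewrite /lebesgue_rV_step /pushforward; congr (_ \x _)%E.
have cons0 x v : rV_cons (x, v) ord0 (ord0 : 'I_d.+1) = x.
  exact: (congr1 fst (rV_consK (x, v))).
have consS x v i : rV_cons (x, v) ord0 (lift ord0 i : 'I_d.+1) = v ord0 i.
  rewrite (_ : lift ord0 i = rshift 1 i); last exact/val_inj.
  exact: (@row_mxEr _ 1 1 d _ _ ord0 i).
apply/seteqP; split=> -[x v] /=.
  move=> h; split=> [|i] /=; first by have := h ord0; rewrite cons0.
  by have := h (lift ord0 i); rewrite consS.
move=> [/= xA vB] i; have [->|[j ->]] : i = ord0 \/ exists j, i = lift ord0 j.
- by case: (unliftP ord0 i) => [j ->|->]; [right; exists j|left].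
- by rewrite cons0.
- by rewrite consS; exact: vB.
Qed.

End lebesgue_rV.


Local Notation Re := complex.Re.
Local Notation Im := complex.Im.
Local Notation normc := ComplexField.Normc.normc.

Section complex_integral.
Context {R : realType} {dT : measure_display} {T : measurableType dT}.
Variable mu : {measure set T -> \bar R}.

Definition cintegrable (D : set T) (f : T -> R[i]) : Prop :=
  mu.-integrable D (EFin \o (fun x => Re (f x))) /\
  mu.-integrable D (EFin \o (fun x => Im (f x))).

Definition cintegral (D : set T) (f : T -> R[i]) : R[i] :=
  (\int[mu]_(x in D) Re (f x)) +i* (\int[mu]_(x in D) Im (f x)).

End complex_integral.

Section elementary_functions.
Context {R : realType}.

(* e^{i t} for real t *)
Definition expi (t : R) : R[i] := cos t +i* sin t.

Definition cosh (t : R) : R := (expR t + expR (- t)) / 2.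
Definition sinh (t : R) : R := (expR t - expR (- t)) / 2.
Definition tanh (t : R) : R := sinh t / cosh t.

Definition dotv d (v w : 'rV[R]_d) : R := \sum_(i < d) v 0 i * w 0 i.

(* The library norm of 'rV[R]_d is the sup norm. *)
Definition enorm d (v : 'rV[R]_d) : R := Num.sqrt (dotv v v).

End elementary_functions.


Section schwartz.
Context {R : realType} {d : nat}.
Implicit Types (f : 'rV[R]_d -> R[i]) (al be : seq 'I_d).

Definition cpartial (i : 'I_d) f : 'rV[R]_d -> R[i] := fun x =>
  ('D_('e_i) (fun y => Re (f y)) x) +i* ('D_('e_i) (fun y => Im (f y)) x).

Definition cderivable (i : 'I_d) f (x : 'rV[R]_d) : Prop :=
  derivable (fun y => Re (f y)) x 'e_i /\ derivable (fun y => Im (f y)) x 'e_i.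

Definition ccontinuous f : Prop :=
  continuous (fun y => Re (f y)) /\ continuous (fun y => Im (f y)).

(* Multi-indices are words in the coordinates 'I_d: the order of the
   multi-index is the size of the word, and [:: i_1; ...; i_k] stands for
   x_{i_1} ... x_{i_k}, respectively for the derivative d_{i_1} ... d_{i_k}. *)
Definition monomial al (x : 'rV[R]_d) : R := \prod_(i <- al) x 0 i.

Definition cpartials be f : 'rV[R]_d -> R[i] := foldr cpartial f be.

Definition csmooth f : Prop := forall be,
  ccontinuous (cpartials be f) /\ forall i x, cderivable i (cpartials be f) x.

Definition schwartz f : Prop :=
  csmooth f /\
  forall al be, exists C : R, forall x,
    `|monomial al x| * normc (cpartials be f x) <= C.

Definition schwartz_norm (N : nat) f : R :=
  sup [set r | exists al be x, [/\ (size al <= N)%N, (size be <= N)%N &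
                 r = `|monomial al x| * normc (cpartials be f x)]].

(* A functional is only looked at on Schwartz functions; its values elsewhere
   are irrelevant. *)
Definition tempered_distribution (K : ('rV[R]_d -> R[i]) -> R[i]) : Prop :=
  (forall (c : R[i]) f g, schwartz f -> schwartz g ->
     K (fun x => c * f x + g x) = c * K f + K g) /\
  exists (N : nat) (C : R), forall f, schwartz f ->
    normc (K f) <= C * schwartz_norm N f.

(* For an operator [L] that equals its own transpose: the distribution L K is
   then f |-> K (L f), and L K = delta_0 is the second conjunct. *)
Definition fundamental_solution
    (L : ('rV[R]_d -> R[i]) -> 'rV[R]_d -> R[i])
    (K : ('rV[R]_d -> R[i]) -> R[i]) : Prop :=
  tempered_distribution K /\ forall f, schwartz f -> K (L f) = f 0.

Definition fourier f (xi : 'rV[R]_d) : R[i] :=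
  ((2 * pi) `^ (- (d%:R / 2)))%:C *
  cintegral (lebesgue_rV d) setT (fun x => f x * expi (- dotv x xi)).

End schwartz.


Section clifford_module.
Context {R : realType} {s : nat} {V : vectType R}.

Definition form0 (z w : 'rV[R]_s) : R := - dotv z w.

Definition admissible (B : {symmetric V}) (J : {linear 'rV[R]_s -> 'End(V)}) :
    Prop :=
  [/\ nondegenerate B,
      forall z x, J z (J z x) = - form0 z z *: x
    & forall z x y, B (J z x) y = - B x (J z y)].

(* Determines [br] uniquely, as [form0] is non-degenerate. *)
Definition is_bracket (B : {symmetric V}) (J : {linear 'rV[R]_s -> 'End(V)})
    (br : V -> V -> 'rV[R]_s) : Prop :=
  forall z x y, B (J z x) y = form0 z (br x y).

Definition neutral_basis (B : {symmetric V}) n (X : (n + n).-tuple V) : Prop :=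
  [/\ basis_of fullv X,
      forall i j : 'I_n,
        B (tnth X (lshift n i)) (tnth X (lshift n j)) = (i == j)%:R,
      forall i j : 'I_n,
        B (tnth X (rshift n i)) (tnth X (rshift n j)) = - (i == j)%:R
    & forall i j : 'I_n, B (tnth X (lshift n i)) (tnth X (rshift n j)) = 0].

(* [X_i, X_j] = 2 sum_k a_ij^k Z_k, with a_ij^k written [a i j k]. *)
Definition structure_constants (br : V -> V -> 'rV[R]_s) m (X : m.-tuple V)
    (a : 'I_m -> 'I_m -> 'I_s -> R) : Prop :=
  forall i j, br (tnth X i) (tnth X j) = 2 *: \sum_(k < s) a i j k *: 'e_k.

End clifford_module.

(* A point (x, z) of R^{2n+s}, in exponential coordinates on the group, is a row
   vector of width n + n + s; [left_field a j] is the left-invariant field X_j. *)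

Section ultra_hyperbolic.
Context {R : realType} {n s : nat}.

Definition left_field (a : 'I_(n + n) -> 'I_(n + n) -> 'I_s -> R)
    (j : 'I_(n + n)) (f : 'rV[R]_(n + n + s) -> R[i]) :
    'rV[R]_(n + n + s) -> R[i] := fun p =>
  cpartial (lshift s j) f p +
  \sum_(m < n + n) \sum_(k < s)
     (a m j k * p 0 (lshift s m))%:C * cpartial (rshift (n + n) k) f p.

Definition ultra_hyperbolic (a : 'I_(n + n) -> 'I_(n + n) -> 'I_s -> R)
    (f : 'rV[R]_(n + n + s) -> R[i]) : 'rV[R]_(n + n + s) -> R[i] := fun p =>
  \sum_(j < n) left_field a (lshift n j) (left_field a (lshift n j) f) p -
  \sum_(j < n) left_field a (rshift n j) (left_field a (rshift n j) f) p.

Definition quadP (xi : 'rV[R]_(n + n)) : R :=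
  \sum_(j < n) (xi 0 (lshift n j) ^+ 2 - xi 0 (rshift n j) ^+ 2).

(* The value at th = 0 is irrelevant. *)
Definition q0s (xi : 'rV[R]_(n + n)) (th : 'rV[R]_s) : R[i] :=
  (0 +i* ((2 * pi) `^ (n%:R + s%:R / 2))^-1) *
  cintegral (@lebesgue_measure R) `[0, +oo[
    (fun t => ((enorm th * cosh t ^+ n)^-1)%:C *
              expi (tanh t / enorm th * quadP xi)).

Definition K0s_integrand (f : 'rV[R]_(n + n + s) -> R[i])
    (p : 'rV[R]_(n + n + s)) : R[i] :=
  q0s (lsubmx p) (rsubmx p) * fourier f p.

Definition K0s (f : 'rV[R]_(n + n + s) -> R[i]) : R[i] :=
  cintegral (lebesgue_rV (n + n + s)) setT (K0s_integrand f).

End ultra_hyperbolic.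

(* Main.v *)
From Pilot Require Import Defs.
From HB Require Import structures.
From mathcomp Require Import all_boot all_order all_algebra.
From mathcomp Require Import sesquilinear.
From mathcomp Require Import all_classical all_reals all_analysis.
From mathcomp Require Import complex.
From mathcomp Require Import measurable_realfun.
From mathcomp Require Import ring lra.

Set Implicit Arguments.
Unset Strict Implicit.
Unset Printing Implicit Defensive.

Import Order.TTheory GRing.Theory Num.Theory.
Import numFieldNormedType.Exports.

Local Open Scope classical_set_scope.
Local Open Scope ring_scope.
Local Open Scope complex_scope.

Local Notation Re := complex.Re.
Local Notation Im := complex.Im.
Local Notation normc := ComplexField.Normc.normc.

(* On the Fourier side the field X_j becomes the first-order operator
   i xi_j + sum_m A_mj(theta) d/dxi_m, where A(theta) = sum_k theta_k a^k. The
   Clifford relations say that A is skew and that A E A = (|theta|^2 / 4) E for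
   E = diag(1, .., 1, -1, .., -1). Hence the ultra-hyperbolic operator maps
   |theta|^-1 exp(i c P / |theta|) with c = tanh t to a function which, after
   multiplication by cosh^-n t, is i times the t-derivative of
   cosh^-n t exp(i tanh t P / |theta|). The integral over t > 0 is therefore the
   constant -i, and K(Delta phi) is the Fourier inversion formula at the origin.
   Fubini and the integrations by parts are legitimate because |theta|^-1 is
   locally integrable for s > 1; since every d/dxi_m brings out another
   |theta|^-1, it is only used in the combination A_mj d/dxi_m, where A
   compensates for it. *)

(** * Complex-valued functions and integrals *)

(** The function tanh and the exponent [n] are forced by a differential equation. On |theta|^-1
    exp(i c P / |theta|), the squares of the first-order symbols produce the factor -(1 - c^2) P:
    there is no term linear in c because A is skew, and -c^2 comes from A E A. Differentiating those
    symbols once more adds a trace, -i n c |theta|. With a weight h(t), the result is i times a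
    total derivative as soon as c' = 1 - c^2 and h' = -n c h; the initial values c(0) = 0 and h(0) =
    1 give tanh and cosh^-n. The singularity at theta = 0 shapes the analysis. Integration by parts
    takes place in the xi variables only, along lines on which theta is constant, so its bounds may
    depend on theta. Majorants are products of functions of one variable, [weight] and |theta|^-1 <=
    |theta_1 theta_2|^(-1/2), which leaves only one-dimensional integrals to compute. Fourier
    inversion is proved at the origin alone, by inserting Gaussians; second moments of their
    transforms replace an estimate of tails. The constants fit because n + s/2 is half the dimension
    of the group. *)

Section complex_modulus.
Context {R : realType}.
Implicit Types (x y : R) (z w : R[i]).

Lemma ReD z w : Re (z + w) = Re z + Re w. Proof. by case: z w => ? ? []. Qed.
Lemma ImD z w : Im (z + w) = Im z + Im w. Proof. by case: z w => ? ? []. Qed.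
Lemma ReN z : Re (- z) = - Re z. Proof. by case: z. Qed.
Lemma ImN z : Im (- z) = - Im z. Proof. by case: z. Qed.
Lemma ReM z w : Re (z * w) = Re z * Re w - Im z * Im w.
Proof. by case: z w => ? ? []. Qed.
Lemma ImM z w : Im (z * w) = Re z * Im w + Im z * Re w.
Proof. by case: z w => ? ? []. Qed.
Lemma complexE2 z : z = Re z +i* Im z. Proof. by case: z. Qed.
Lemma complexP z w : Re z = Re w -> Im z = Im w -> z = w.
Proof. by case: z w => ? ? [? ?] /= -> ->. Qed.

Lemma normcE2 z : normc z = Num.sqrt (Re z ^+ 2 + Im z ^+ 2).
Proof. by case: z. Qed.

Lemma normc_ge0 z : 0 <= normc z.
Proof. by rewrite normcE2 sqrtr_ge0. Qed.

Lemma normc_real x : normc x%:C = `|x|.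
Proof. by rewrite normcE2 /= expr0n /= addr0 sqrtr_sqr. Qed.

Lemma normc_imag x : normc (0 +i* x) = `|x|.
Proof. by rewrite normcE2 /= expr0n /= add0r sqrtr_sqr. Qed.

Lemma normc_expi x : normc (expi x) = 1.
Proof. by rewrite normcE2 /= cos2Dsin2 sqrtr1. Qed.

Lemma Re_le_normc z : `|Re z| <= normc z.
Proof. by rewrite normcE2 -sqrtr_sqr ler_wsqrtr// lerDl sqr_ge0. Qed.

Lemma Im_le_normc z : `|Im z| <= normc z.
Proof. by rewrite normcE2 -sqrtr_sqr ler_wsqrtr// lerDr sqr_ge0. Qed.

Lemma normc_le_ReIm z : normc z <= `|Re z| + `|Im z|.
Proof.
rewrite normcE2 -[leRHS]ger0_norm ?addr_ge0// -sqrtr_sqr ler_wsqrtr//.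
rewrite sqrrD !real_normK ?num_real//.
by rewrite lerD2r lerDl mulrn_wge0// mulr_ge0.
Qed.

Lemma normcD z w : normc (z + w) <= normc z + normc w.
Proof. exact: le_normcD. Qed.

Lemma normcN z : normc (- z) = normc z.
Proof. by rewrite !normcE2 ReN ImN !sqrrN. Qed.

Lemma normcM z w : normc (z * w) = normc z * normc w.
Proof. exact: ComplexField.Normc.normcM. Qed.

Lemma normc0 : normc (0 : R[i]) = 0.
Proof. by rewrite (_ : 0 = 0%:C)// normc_real normr0. Qed.

Lemma expiD x y : expi (x + y) = expi x * expi y.
Proof. by apply: complexP; rewrite ?ReM ?ImM /= ?cosD ?sinD//; ring. Qed.

Lemma expi0 : expi (0 : R) = 1.
Proof. by rewrite /expi cos0 sin0. Qed.

End complex_modulus.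

Section cmeas.
Context {R : realType} {dT : measure_display} {T : measurableType dT}.
Implicit Types f g : T -> R[i].

Definition cmeas f := measurable_fun setT (fun x => Re (f x)) /\
  measurable_fun setT (fun x => Im (f x)).

Lemma cmeas_cst z : cmeas (fun=> z).
Proof. by split; exact: measurable_cst. Qed.

Lemma cmeasC (h : T -> R) : measurable_fun setT h -> cmeas (fun x => (h x)%:C).
Proof. by move=> mh; split => //=; exact: measurable_cst. Qed.

Lemma cmeasI (h : T -> R) : measurable_fun setT h -> cmeas (fun x => 0 +i* (h x)).
Proof. by move=> mh; split => //=; exact: measurable_cst. Qed.

Lemma cmeas_expi (h : T -> R) : measurable_fun setT h ->
  cmeas (fun x => expi (h x)).
Proof.
move=> mh; split => /=; apply: (measurableT_comp _ mh).
  by apply: continuous_measurable_fun; exact: continuous_cos.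
by apply: continuous_measurable_fun; exact: continuous_sin.
Qed.

Lemma cmeasD f g : cmeas f -> cmeas g -> cmeas (fun x => f x + g x).
Proof.
move=> [f1 f2] [g1 g2]; split.
  by under eq_fun do rewrite ReD; exact: measurable_funD.
by under eq_fun do rewrite ImD; exact: measurable_funD.
Qed.

Lemma cmeasM f g : cmeas f -> cmeas g -> cmeas (fun x => f x * g x).
Proof.
move=> [f1 f2] [g1 g2]; split.
  under eq_fun do rewrite ReM.
  by apply: measurable_funB; exact: measurable_funM.
under eq_fun do rewrite ImM.
by apply: measurable_funD; exact: measurable_funM.
Qed.

Lemma cmeas_prod I (r : seq I) (F : I -> T -> R[i]) :
  (forall i, cmeas (F i)) -> cmeas (fun x => \prod_(i <- r) F i x).
Proof.
move=> mF; elim: r => [|i r IH].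
  by under eq_fun do rewrite big_nil; exact: cmeas_cst.
by under eq_fun do rewrite big_cons; exact: cmeasM.
Qed.

Lemma measurable_normc f : cmeas f -> measurable_fun setT (fun x => normc (f x)).
Proof.
move=> [f1 f2]; under eq_fun do rewrite normcE2.
have ms : measurable_fun setT (@Num.sqrt R).
  by apply: continuous_measurable_fun; exact: sqrt_continuous.
by apply: (measurableT_comp ms); apply: measurable_funD; exact: measurable_funX.
Qed.

End cmeas.

Lemma cmeas_comp {R : realType} d1 d2 (T1 : measurableType d1)
    (T2 : measurableType d2) (f : T2 -> R[i]) (h : T1 -> T2) :
  cmeas f -> measurable_fun setT h -> cmeas (f \o h).
Proof. by move=> [f1 f2] mh; split; [exact: (measurableT_comp f1 mh)|exact: (measurableT_comp f2 mh)]. Qed.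

Section cintegral_theory.
Context {R : realType} {dT : measure_display} {T : measurableType dT}.
Variable mu : {measure set T -> \bar R}.
Implicit Types f g : T -> R[i].
Local Notation cint f := (cintegral mu setT f).
Local Notation cintble f := (cintegrable mu setT f).

Lemma cintegrable_cmeas f : cintble f -> cmeas f.
Proof.
by move=> [/measurable_int/measurable_EFinP ? /measurable_int/measurable_EFinP].
Qed.

Lemma cintegrable_le f (g : T -> R) : cmeas f ->
  mu.-integrable setT (EFin \o g) -> (forall x, normc (f x) <= g x) -> cintble f.
Proof.
move=> [f1 f2] ig fg; split; apply: (le_integrable _ _ _ ig) => //.
- exact/measurable_EFinP.
- move=> x _ /=; rewrite lee_fin (le_trans (Re_le_normc _))//.
  by rewrite (le_trans (fg x))// ler_norm.
- exact/measurable_EFinP.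
- move=> x _ /=; rewrite lee_fin (le_trans (Im_le_normc _))//.
  by rewrite (le_trans (fg x))// ler_norm.
Qed.

Lemma cintegrable_normc f : cintble f ->
  mu.-integrable setT (EFin \o (fun x => normc (f x))).
Proof.
move=> fi; have mf := cintegrable_cmeas fi; case: fi => f1 f2.
apply: (@le_integrable _ _ _ mu setT _ _
    ((EFin \o (fun x => `|Re (f x)|%R)) \+ (EFin \o (fun x => `|Im (f x)|%R)))%E) => //.
- by apply/measurable_EFinP; exact: measurable_normc.
- move=> x _ /=; rewrite lee_fin ger0_norm ?normc_ge0//.
  by rewrite ger0_norm ?addr_ge0// normc_le_ReIm.
- by apply: integrableD => //; [exact: (integrable_norm f1)|exact: (integrable_norm f2)].
Qed.

Lemma cintegrable_leC f g : cmeas f -> cintble g ->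
  (forall x, normc (f x) <= normc (g x)) -> cintble f.
Proof. by move=> mf /cintegrable_normc ig; exact: cintegrable_le. Qed.

Lemma cintegrableD f g : cintble f -> cintble g -> cintble (fun x => f x + g x).
Proof.
move=> [f1 f2] [g1 g2]; split.
  rewrite (_ : _ \o _ = (EFin \o (fun x => Re (f x))) \+ (EFin \o (fun x => Re (g x))))%E.
    exact: integrableD.
  by apply/funext => x /=; rewrite ReD.
rewrite (_ : _ \o _ = (EFin \o (fun x => Im (f x))) \+ (EFin \o (fun x => Im (g x))))%E.
  exact: integrableD.
by apply/funext => x /=; rewrite ImD.
Qed.

Lemma cintegrableZ c f : cintble f -> cintble (fun x => c * f x).
Proof.
move=> fi; apply: (@cintegrable_le _ (fun x => normc c * normc (f x))).
- by apply: cmeasM; [exact: cmeas_cst|exact: cintegrable_cmeas].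
- rewrite (_ : _ \o _ = (fun x => (normc c)%:E * (EFin \o (fun x => normc (f x))) x)%E)//.
  by apply: integrableZl => //; exact: cintegrable_normc.
- by move=> x; rewrite normcM.
Qed.

Lemma cintegrable_sum I (r : seq I) (F : I -> T -> R[i]) :
  (forall i, cintble (F i)) -> cintble (fun x => \sum_(i <- r) F i x).
Proof.
move=> iF; elim: r => [|i r IH].
  under eq_fun do rewrite big_nil.
  by split; rewrite (_ : _ \o _ = cst 0%E)//; exact: integrable0.
by under eq_fun do rewrite big_cons; exact: cintegrableD.
Qed.

Lemma eq_cintegral f g : f =1 g -> cint f = cint g.
Proof. by move=> /funext ->. Qed.

Lemma cintegralD f g : cintble f -> cintble g ->
  cint (fun x => f x + g x) = cint f + cint g.
Proof.
move=> [f1 f2] [g1 g2]; rewrite /cintegral; congr (_ +i* _).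
  by under eq_fun do rewrite ReD; rewrite RintegralD.
by under eq_fun do rewrite ImD; rewrite RintegralD.
Qed.

Lemma cintegralZ c f : cintble f -> cint (fun x => c * f x) = c * cint f.
Proof.
move=> [f1 f2]; have h (r : R) (h : T -> R) : mu.-integrable setT (EFin \o h) ->
    mu.-integrable setT (EFin \o (fun x => r * h x)).
  move=> ih; rewrite (_ : _ \o _ = (fun x => r%:E * (EFin \o h) x)%E)//.
  exact: integrableZl.
apply: complexP; rewrite ?ReM ?ImM /=.
  under eq_Rintegral do rewrite ReM.
  by rewrite RintegralB ?RintegralZl//; exact: h.
under eq_Rintegral do rewrite ImM.
by rewrite RintegralD ?RintegralZl//; exact: h.
Qed.

Lemma cintegralZr c f : cintble f -> cint (fun x => f x * c) = cint f * c.
Proof.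
by move=> fi; rewrite mulrC -cintegralZ//; apply: eq_cintegral => x; rewrite mulrC.
Qed.

Lemma cintegral0 : cint (fun=> 0) = 0.
Proof. by rewrite /cintegral/= /Rintegral integral0. Qed.

Lemma cintegral_sum I (r : seq I) (F : I -> T -> R[i]) :
  (forall i, cintble (F i)) ->
  cint (fun x => \sum_(i <- r) F i x) = \sum_(i <- r) cint (F i).
Proof.
move=> iF; elim: r => [|i r IH].
  rewrite big_nil (eq_cintegral (g := fun=> 0)) ?cintegral0// => x.
  by rewrite big_nil.
rewrite big_cons -IH -cintegralD//; last exact: cintegrable_sum.
by apply: eq_cintegral => x; rewrite big_cons.
Qed.

(** The factor 2 is the price of bounding real and imaginary part separately; later only the
    finiteness of such constants matters. *)
Lemma normc_cintegral_le f (g : T -> R) :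
  cintble f -> mu.-integrable setT (EFin \o g) ->
  (forall x, normc (f x) <= g x) ->
  normc (cint f) <= 2 * \int[mu]_x g x.
Proof.
move=> [f1 f2] ig fg; apply: le_trans (normc_le_ReIm _) _.
rewrite mulrDl mul1r lerD//= (le_trans (le_normr_Rintegral _ _))//.
  apply: le_Rintegral => //; first exact: (integrable_norm f1).
  by move=> x _; exact: le_trans (Re_le_normc _) (fg x).
apply: le_Rintegral => //; first exact: (integrable_norm f2).
by move=> x _; exact: le_trans (Im_le_normc _) (fg x).
Qed.

Lemma ae_eq_cintegral f g : cmeas f -> cmeas g ->
  {ae mu, forall x, f x = g x} -> cint f = cint g.
Proof.
move=> [f1 f2] [g1 g2] fg; apply: complexP => /=; rewrite /Rintegral; congr fine.
  apply: ae_eq_integral => //; try exact/measurable_EFinP.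
  by apply: filterS fg => x -> _.
apply: ae_eq_integral => //; try exact/measurable_EFinP.
by apply: filterS fg => x -> _.
Qed.

Lemma dominated_Rintegral (F : nat -> T -> R) (f g : T -> R) :
  (forall k, measurable_fun setT (F k)) -> measurable_fun setT f ->
  mu.-integrable setT (EFin \o g) -> (forall k x, `|F k x| <= g x) ->
  (forall x, (fun k => F k x) @ \oo --> f x) ->
  (fun k => \int[mu]_x F k x) @ \oo --> \int[mu]_x f x.
Proof.
move=> mF mf ig Fg cF.
have [||||| i1 _ h] := @dominated_convergence _ _ _ mu setT measurableT
  (fun k x => (F k x)%:E) (fun x => (f x)%:E) (EFin \o g).
- by move=> k; apply/measurable_EFinP; exact: mF.
- exact/measurable_EFinP.
- by apply: aeW => x _; apply: cvg_EFin; [exact: nearW|exact: cF].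
- exact: ig.
- by apply: aeW => x k _ /=; rewrite lee_fin.
- by apply: fine_cvg; rewrite fineK//; exact: integrable_fin_num.
Qed.

Lemma dominated_cintegral (F : nat -> T -> R[i]) f (g : T -> R) :
  (forall k, cmeas (F k)) -> cmeas f -> mu.-integrable setT (EFin \o g) ->
  (forall k x, normc (F k x) <= g x) ->
  (forall x, (fun k => Re (F k x)) @ \oo --> Re (f x)) ->
  (forall x, (fun k => Im (F k x)) @ \oo --> Im (f x)) ->
  ((fun k => Re (cint (F k))) @ \oo --> Re (cint f)) /\
  ((fun k => Im (cint (F k))) @ \oo --> Im (cint f)).
Proof.
move=> mF [mf1 mf2] ig Fg F1 F2; split; apply: dominated_Rintegral ig _ _ => //.
- by move=> k; case: (mF k).
- by move=> k x; exact: le_trans (Re_le_normc _) (Fg k x).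
- by move=> k; case: (mF k).
- by move=> k x; exact: le_trans (Im_le_normc _) (Fg k x).
Qed.

End cintegral_theory.

(** * Fubini for complex-valued functions *)

Section cFubini.
Context {R : realType} {d1 d2 : measure_display}.
Context {T1 : measurableType d1} {T2 : measurableType d2}.
Variable m1 : {sigma_finite_measure set T1 -> \bar R}.
Variable m2 : {sigma_finite_measure set T2 -> \bar R}.
(** The real-valued inner integral is [fine] of the extended one, and the two agree only where the
    section is integrable, that is almost everywhere. *)
Lemma Rintegral12 (h : T1 * T2 -> R) : (m1 \x m2)%E.-integrable setT (EFin \o h) ->
  m1.-integrable setT (EFin \o (fun x => \int[m2]_y h (x, y))) /\
  \int[m1]_x \int[m2]_y h (x, y) = \int[(m1 \x m2)%E]_z h z.
Proof.
move=> ih; have aeF := ae_integrable1 ih.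
have ae : ae_eq m1 setT (EFin \o (fun x => \int[m2]_y h (x, y)))
    (fun x => \int[m2]_y (h (x, y))%:E)%E.
  apply: filterS aeF => x /= ix _; rewrite /Rintegral fineK//.
  exact: integrable_fin_num.
have mF : measurable_fun setT (fun x => \int[m2]_y (h (x, y))%:E)%E.
  exact: (measurable_fubini_F (m1:=m1) ih).
have mf : measurable_fun setT (EFin \o (fun x => \int[m2]_y h (x, y))).
  by apply/measurable_EFinP; rewrite /Rintegral; exact: measurableT_comp.
have iF := @integrable_fubini_F _ _ _ _ _ m1 m2 _ ih.
split.
  apply/integrableP; split => //.
  move/integrableP : iF => [_]; apply: le_lt_trans.
  apply: ae_ge0_le_integral => //; try exact: measurableT_comp.
  by apply: filterS ae => x e _; rewrite (e I).
rewrite /Rintegral; congr fine.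
rewrite -(integral12_prod_meas1 ih).
exact: ae_eq_integral.
Qed.

Lemma Rintegral21 (h : T1 * T2 -> R) : (m1 \x m2)%E.-integrable setT (EFin \o h) ->
  m2.-integrable setT (EFin \o (fun y => \int[m1]_x h (x, y))) /\
  \int[m2]_y \int[m1]_x h (x, y) = \int[(m1 \x m2)%E]_z h z.
Proof.
move=> ih; have aeF := ae_integrable2 ih.
have ae : ae_eq m2 setT (EFin \o (fun y => \int[m1]_x h (x, y)))
    (fun y => \int[m1]_x (h (x, y))%:E)%E.
  apply: filterS aeF => x /= ix _; rewrite /Rintegral fineK//.
  exact: integrable_fin_num.
have mF : measurable_fun setT (fun y => \int[m1]_x (h (x, y))%:E)%E.
  exact: (measurable_fubini_G (m2:=m2) ih).
have mf : measurable_fun setT (EFin \o (fun y => \int[m1]_x h (x, y))).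
  by apply/measurable_EFinP; rewrite /Rintegral; exact: measurableT_comp.
have mh := measurable_int _ ih.
split.
  apply/integrableP; split => //.
  (* The modulus of the inner integral is at most the inner integral of |h|, whose outer integral is
     finite by Tonelli. *)
  apply: le_lt_trans ((integrable21ltyP m1 m2 mh).1 ih).
  apply: ae_ge0_le_integral => //; first exact: measurableT_comp.
  - by move=> y _; exact: integral_ge0.
  - by apply: (measurable_fun_fubini_tonelli_G (abse \o (EFin \o h))) => //=; exact: measurableT_comp.
  - apply: filterS ae => y e _; rewrite (e I).
    by apply: le_abse_integral => //; exact: (measurableT_comp mh (pair2_measurable _)).
rewrite /Rintegral; congr fine.
rewrite -(integral21_prod_meas1 ih).
exact: ae_eq_integral.
Qed.

Variable f : T1 * T2 -> R[i].
Hypothesis fi : cintegrable (m1 \x m2)%E setT f.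

Lemma cintegral12 :
  cintegral m1 setT (fun x => cintegral m2 setT (fun y => f (x, y))) =
  cintegral (m1 \x m2)%E setT f.
Proof. by case: fi => f1 f2; rewrite /cintegral; congr (_ +i* _); [exact: (Rintegral12 f1).2|exact: (Rintegral12 f2).2]. Qed.

Lemma cintegral21 :
  cintegral m2 setT (fun y => cintegral m1 setT (fun x => f (x, y))) =
  cintegral (m1 \x m2)%E setT f.
Proof. by case: fi => f1 f2; rewrite /cintegral; congr (_ +i* _); [exact: (Rintegral21 f1).2|exact: (Rintegral21 f2).2]. Qed.

Lemma cFubini :
  cintegral m1 setT (fun x => cintegral m2 setT (fun y => f (x, y))) =
  cintegral m2 setT (fun y => cintegral m1 setT (fun x => f (x, y))).
Proof. by rewrite cintegral12 cintegral21. Qed.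

Lemma cintegrable_cintegral1 :
  cintegrable m1 setT (fun x => cintegral m2 setT (fun y => f (x, y))).
Proof.
by case: fi => f1 f2; split; [have := (Rintegral12 f1).1|have := (Rintegral12 f2).1].
Qed.

Lemma cintegrable_cintegral2 :
  cintegrable m2 setT (fun y => cintegral m1 setT (fun x => f (x, y))).
Proof.
by case: fi => f1 f2; split; [have := (Rintegral21 f1).1|have := (Rintegral21 f2).1].
Qed.

End cFubini.

(** By Tonelli the integral of the modulus splits into a product of two finite integrals. *)
Lemma integrable_prodM {R : realType} d1 d2 (T1 : measurableType d1)
    (T2 : measurableType d2) (m1 : {sigma_finite_measure set T1 -> \bar R})
    (m2 : {sigma_finite_measure set T2 -> \bar R}) (g : T1 -> R) (h : T2 -> R) :
  m1.-integrable setT (EFin \o g) -> m2.-integrable setT (EFin \o h) ->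
  (m1 \x m2)%E.-integrable setT (EFin \o (fun z => g z.1 * h z.2)).
Proof.
move=> ig ih.
have mg : measurable_fun setT g by exact/measurable_EFinP/(measurable_int _ ig).
have mh : measurable_fun setT h by exact/measurable_EFinP/(measurable_int _ ih).
apply/integrable12ltyP.
  apply/measurable_EFinP; apply: measurable_funM.
    exact: (measurableT_comp mg measurable_fst).
  exact: (measurableT_comp mh measurable_snd).
have intg_abs := (integrableP _ _ _ ih).2.
have -> : (\int[m1]_x \int[m2]_y `|(EFin \o (fun z => (g z.1 * h z.2)%R)) (x, y)| =
   \int[m1]_x (`|(g x)%:E| * \int[m2]_y `|(h y)%:E|))%E.
  apply: eq_integral => x _; rewrite -ge0_integralZl//.
    by apply: eq_integral => y _; rewrite -abseM.
  by apply: measurableT_comp => //; exact/measurable_EFinP.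
rewrite ge0_integralZr//; last first.
- exact: integral_ge0.
- by apply: measurableT_comp => //; exact/measurable_EFinP.
apply: lte_mul_pinfty => //; first exact: integral_ge0.
- rewrite ge0_fin_numE; first exact: (integrableP _ _ _ ig).2.
  exact: integral_ge0.
Qed.

Lemma integrable_measurable {R : realType} d (T : measurableType d)
    (mu : {measure set T -> \bar R}) (f : T -> R) :
  mu.-integrable setT (EFin \o f) -> measurable_fun setT f.
Proof. by move=> fi; exact/measurable_EFinP/(measurable_int _ fi). Qed.

(** * Lebesgue measure on R^d *)

Section measurable_rV_topology.
Context {R : realType} {d : nat}.

(** The sigma-algebra is generated by the coordinates, so an open set has to be exhausted by
    countably many boxes; those with rational centre and radius 1/(k+1) suffice. *)
Lemma open_measurable_rV (A : set 'rV[R]_d) : open A -> measurable A.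
Proof.
move=> oA.
pose box (p : 'rV[rat]_d * nat) : set 'rV[R]_d :=
  [set x | forall i, `|ratr (p.1 0 i) - x 0 i| < p.2.+1%:R^-1].
have -> : A = \bigcup_(p in [set p | box p `<=` A]) box p.
  apply/seteqP; split; last by move=> x [p /= pA]; exact: pA.
  move=> x Ax; have /nbhs_ballP[e /= e0 eA] : nbhs x A by exact: open_nbhs_nbhs.
  (* Half of [e]: a point of the box and the point [x] are each within 1/(k+1) of the rational
     centre. *)
  have [k ke] : exists k : nat, k.+1%:R^-1 < e / 2.
    have e20 : 0 < e / 2 by rewrite divr_gt0.
    have [k _ /(_ k (leqnn k)) hk] := near_infty_natSinv_lt (PosNum e20).
    by exists k.
  have k0 : 0 < (k.+1%:R^-1 : R) by rewrite invr_gt0.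
  have /choice[q qx] : forall i, exists q, ratr q \in `]x 0 i, x 0 i + k.+1%:R^-1[.
    by move=> i; apply: rat_in_itvoo; rewrite ltrDl.
  exists (\row_i q i, k) => /=.
    move=> y yb; apply: eA; split=> // i j; rewrite ord1 /ball/=.
    have := yb j; have := qx j; rewrite in_itv/= mxE => /andP[h1 h2] h3.
    move: h3; rewrite ltr_norml => /andP[h3 h4]; rewrite ltr_norml.
    set c := k.+1%:R^-1 in ke k0 h1 h2 h3 h4 *; lra.
  move=> i; have := qx i; rewrite mxE in_itv/= => /andP[h1 h2].
  rewrite ltr_norml; set c := k.+1%:R^-1 in ke k0 h1 h2 *; lra.
rewrite bigcup_mkcond; apply: countable_bigcupT_measurable => // p.
case: ifP => // _.
have -> : box p = \bigcap_(i in [set: 'I_d])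
    ((fun x : 'rV[R]_d => x ord0 i) @^-1` [set r | `|ratr (p.1 0 i) - r| < p.2.+1%:R^-1]).
  by apply/seteqP; split=> x /= h i; [move=> _|]; exact: h.
apply: fin_bigcap_measurable => // i _; rewrite -[X in measurable X]setTI.
apply: measurable_coord => //.
have -> : [set r : R | `|ratr (p.1 0 i) - r| < p.2.+1%:R^-1] =
    ball (ratr (p.1 0 i) : R) p.2.+1%:R^-1 by [].
exact: measurable_ball.
Qed.

Lemma continuous_measurable_rV (f : 'rV[R]_d -> R) :
  continuous f -> measurable_fun setT f.
Proof.
move=> /continuousP cf; apply: (measurability _ (RGenOpens.measurableE R)).
move=> _ [_ [a [b ->] <-]]; rewrite setTI; apply: open_measurable_rV.
by apply: cf; exact: interval_open.
Qed.

Lemma ccontinuous_cmeas (f : 'rV[R]_d -> R[i]) : ccontinuous f -> cmeas f.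
Proof. by move=> [? ?]; split; exact: continuous_measurable_rV. Qed.

End measurable_rV_topology.

Section lebesgue_rV_integral.
Context {R : realType}.
Local Notation leb := (@lebesgue_measure R).

Lemma rV_cons0 d (p : measurableTypeR R * 'rV[R]_d) :
  rV_cons p ord0 (ord0 : 'I_d.+1) = p.1.
Proof. by rewrite -[in RHS](rV_consK p). Qed.

Lemma rV_consS d (p : measurableTypeR R * 'rV[R]_d) (i : 'I_d) :
  rV_cons p ord0 (lift ord0 i : 'I_d.+1) = p.2 ord0 i.
Proof.
rewrite (_ : lift ord0 i = rshift 1 i); last exact/val_inj.
exact: (@row_mxEr _ 1 1 d _ _ ord0 i).
Qed.

Lemma rV_consD d (p : measurableTypeR R * 'rV[R]_d) (t : R) :
  rV_cons (p.1 + t, p.2) = rV_cons p + t *: 'e_ord0.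
Proof.
apply/rowP => i; rewrite [in RHS]mxE [X in _ = _ + X]mxE [X in _ = _ + _ * X]mxE.
rewrite eqxx /=.
case: (unliftP ord0 i) => [j ->|->].
  by rewrite !rV_consS (_ : _ == _ = false)// mulr0 addr0.
by rewrite !rV_cons0 mulr1.
Qed.

Lemma rV_consDr d (p : measurableTypeR R * 'rV[R]_d) (t : R) (j : 'I_d) :
  rV_cons (p.1, p.2 + t *: 'e_j) = rV_cons p + t *: 'e_(lift ord0 j).
Proof.
apply/rowP => i; rewrite [in RHS]mxE [X in _ = _ + X]mxE [X in _ = _ + _ * X]mxE.
rewrite eqxx /=.
case: (unliftP ord0 i) => [k ->|->].
  by rewrite !rV_consS /= !mxE eqxx /= (inj_eq lift_inj).
by rewrite !rV_cons0 (_ : _ == _ = false)// mulr0 addr0.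
Qed.

Lemma integrable_cons d (f : 'rV[R]_d.+1 -> R) : measurable_fun setT f ->
  (lebesgue_rV d.+1).-integrable setT (EFin \o f) <->
  (leb \x lebesgue_rV d)%E.-integrable setT (EFin \o (f \o @rV_cons R d)).
Proof.
move=> mf; have mc := @measurable_rV_cons R d.
have mfc : measurable_fun setT (f \o @rV_cons R d) by exact: measurableT_comp.
have e : (\int[lebesgue_rV d.+1]_x `|(f x)%:E| =
          \int[leb \x lebesgue_rV d]_x `|(f (rV_cons x))%:E|)%E.
  rewrite [LHS](@ge0_integral_pushforward _ _ _ _ R _ mc (leb \x lebesgue_rV d)%E setT
    (fun x => `|(f x)%:E|%E)) ?preimage_setT//.
  by apply: measurableT_comp => //; exact/measurable_EFinP.
split => /integrableP[_ h]; apply/integrableP; split.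
- exact/measurable_EFinP.
- by rewrite -e.
- exact/measurable_EFinP.
- by rewrite e.
Qed.

Lemma integral_cons d (f : 'rV[R]_d.+1 -> R) :
  (lebesgue_rV d.+1).-integrable setT (EFin \o f) ->
  \int[lebesgue_rV d.+1]_x f x = \int[(leb \x lebesgue_rV d)%E]_p f (rV_cons p).
Proof.
move=> fi; rewrite /Rintegral; congr fine.
have mf : measurable_fun setT (EFin \o f) := measurable_int _ fi.
rewrite [LHS](@integral_pushforward _ _ _ _ R _ (@measurable_rV_cons R d)
  (leb \x lebesgue_rV d)%E setT _ mf) ?preimage_setT//.
by apply/integrable_cons => //; exact/measurable_EFinP.
Qed.

Lemma cintegrable_cons d (f : 'rV[R]_d.+1 -> R[i]) : cmeas f ->
  cintegrable (lebesgue_rV d.+1) setT f <->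
  cintegrable (leb \x lebesgue_rV d)%E setT (fun p => f (rV_cons p)).
Proof.
move=> [mf1 mf2]; split => -[f1 f2]; split.
- exact: (integrable_cons mf1).1.
- exact: (integrable_cons mf2).1.
- exact: (integrable_cons mf1).2.
- exact: (integrable_cons mf2).2.
Qed.

Lemma cintegral_cons d (f : 'rV[R]_d.+1 -> R[i]) :
  cintegrable (lebesgue_rV d.+1) setT f ->
  cintegral (lebesgue_rV d.+1) setT f =
  cintegral (leb \x lebesgue_rV d)%E setT (fun p => f (rV_cons p)).
Proof. by move=> [f1 f2]; rewrite /cintegral; congr (_ +i* _); exact: integral_cons. Qed.

Lemma measurable_rV0 (f : 'rV[R]_0 -> \bar R) : measurable_fun setT f.
Proof.
rewrite (_ : f = cst (f 0)); first exact: measurable_cst.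
by apply/funext => x /=; rewrite (thinmx0 x).
Qed.

Lemma integrable_rV0 (f : 'rV[R]_0 -> R) :
  (lebesgue_rV 0).-integrable setT (EFin \o f).
Proof.
apply/integrableP; split; first exact: measurable_rV0.
rewrite /= integral_dirac//; last exact: measurable_rV0.
by rewrite diracT mul1e/= ltry.
Qed.

Lemma cintegral_rV0 (f : 'rV[R]_0 -> R[i]) : cintegral (lebesgue_rV 0) setT f = f 0.
Proof.
rewrite /cintegral/= /Rintegral !integral_dirac//; try exact: measurable_rV0.
by rewrite diracT !mul1e/= -complexE2.
Qed.

Lemma integrable_prod d (g : 'I_d -> R -> R) :
  (forall i, leb.-integrable setT (EFin \o g i)) ->
  (lebesgue_rV d).-integrable setT (EFin \o (fun x : 'rV[R]_d => \prod_(i < d) g i (x 0 i))).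
Proof.
elim: d g => [|d IH] g ig; first exact: integrable_rV0.
have mg i : measurable_fun setT (g i) by exact: integrable_measurable (ig i).
apply/integrable_cons.
  apply: measurable_prod => i _; apply: (measurableT_comp (mg i)).
  exact: measurable_coord.
have := integrable_prodM (ig ord0) (IH (fun i => g (lift ord0 i)) (fun i => ig _)).
apply: eq_integrable => // p _ /=; rewrite big_ord_recl rV_cons0; congr (_ * _)%:E.
by apply: eq_bigr => i _; rewrite rV_consS.
Qed.

(** Integrability is carried along with the value because Fubini asks for it at each step of the
    induction. *)
Lemma cintegral_prod d (g : 'I_d -> R -> R[i]) :
  (forall i, cintegrable leb setT (g i)) ->
  cintegrable (lebesgue_rV d) setT (fun x : 'rV[R]_d => \prod_(i < d) g i (x 0 i)) /\
  cintegral (lebesgue_rV d) setT (fun x : 'rV[R]_d => \prod_(i < d) g i (x 0 i)) =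
  \prod_(i < d) cintegral leb setT (g i).
Proof.
elim: d g => [|d IH] g ig.
  split; first by split; exact: integrable_rV0.
  by rewrite cintegral_rV0 !big_ord0.
have mg i := cintegrable_cmeas (ig i).
have [iG eG] := IH (fun i => g (lift ord0 i)) (fun i => ig _).
have mG := cintegrable_cmeas iG.
have mprod : cmeas (fun x : 'rV[R]_d.+1 => \prod_(i < d.+1) g i (x 0 i)).
  by apply: cmeas_prod => i; exact: (cmeas_comp (mg i) (measurable_coord i)).
have E : (fun p : measurableTypeR R * 'rV[R]_d =>
     \prod_(i < d.+1) g i (rV_cons p 0 i)) =
   (fun p => g ord0 p.1 * \prod_(i < d) g (lift ord0 i) (p.2 0 i)).
  apply/funext => p; rewrite big_ord_recl rV_cons0; congr (_ * _).
  by apply: eq_bigr => i _; rewrite rV_consS.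
have iE : cintegrable (leb \x lebesgue_rV d)%E setT
    (fun p => g ord0 p.1 * \prod_(i < d) g (lift ord0 i) (p.2 0 i)).
  apply: (cintegrable_le _ (integrable_prodM (cintegrable_normc (ig ord0)) (cintegrable_normc iG))).
    apply: cmeasM; first exact: (cmeas_comp (mg ord0) measurable_fst).
    exact: (cmeas_comp mG measurable_snd).
  by move=> p /=; rewrite normcM.
have iP : cintegrable (lebesgue_rV d.+1) setT (fun x : 'rV[R]_d.+1 => \prod_(i < d.+1) g i (x 0 i)).
  by apply/cintegrable_cons => //; rewrite E.
split => //; rewrite cintegral_cons// E -(cintegral12 iE) big_ord_recl -eG.
rewrite -cintegralZr//; apply: eq_cintegral => x /=.
by rewrite cintegralZ.
Qed.

(** The hyperplane is a box with one side [{0}] and the whole line as every other side, and 0 times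
    infinity is 0 in the extended reals. *)
Lemma hyperplane_null d (i : 'I_d) :
  {ae lebesgue_rV d, forall x : 'rV[R]_d, x 0 i != 0}.
Proof.
pose A (j : 'I_d) : set (measurableTypeR R) := if j == i then [set 0] else setT.
have mA j : measurable (A j) by rewrite /A; case: ifP.
exists [set x : 'rV[R]_d | forall j, A j (x ord0 j)]; split.
- have -> : [set x : 'rV[R]_d | forall j, A j (x ord0 j)] =
      (fun x : 'rV[R]_d => x ord0 i) @^-1` [set 0].
    apply/seteqP; split=> x /=; first by move=> /(_ i); rewrite /A eqxx.
    by move=> xi j; rewrite /A; case: ifP => [/eqP ->|].
  by rewrite -[X in measurable X]setTI; exact: measurable_coord.
- rewrite lebesgue_rV_box// (bigD1 i)//= {1}/A eqxx lebesgue_measure_set1 mul0e//.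
- move=> x /= /negP; rewrite negbK => /eqP xi j; rewrite /A.
  by case: ifP => [/eqP ->|].
Qed.

End lebesgue_rV_integral.

(** A directional derivative depends only on the values along a line; this passes between functions
    on R^d and their restrictions to a line, in both directions. *)
Lemma is_derive_line {R : realType} {V V' W : normedModType R} (f : V -> W)
    (g : V' -> W) x x' v v' l :
  (forall h : R, f (h *: v + x) = g (h *: v' + x')) ->
  is_derive x v f l -> is_derive x' v' g l.
Proof.
move=> fg [dx ex]; have f0 : f x = g x' by have := fg 0; rewrite !scale0r !add0r.
have E : (fun h : R => h^-1 *: ((f \o shift x) (h *: v) - f x)) =
    (fun h : R => h^-1 *: ((g \o shift x') (h *: v') - g x')).
  by apply/funext => h /=; rewrite fg f0.
by split; [move: dx; rewrite /derivable E|move: ex; rewrite /derive E].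
Qed.

(** * Integrals of derivatives *)

Section integral_derivative.
Context {R : realType}.
Local Notation leb := (@lebesgue_measure R).

(** The fundamental theorem of calculus on growing intervals: the decay of [u] makes the boundary
    terms O(1/k), and dominated convergence handles the integrals. *)
Lemma integral_derive0_R (u v : R -> R) : leb.-integrable setT (EFin \o v) ->
  (forall x : R, is_derive x 1 u (v x)) -> continuous v ->
  (exists C, forall t, `|t| * `|u t| <= C) -> \int[leb]_x v x = 0.
Proof.
move=> vi du cv [C uC].
(* With k+1 in place of k the interval is never degenerate, and the boundary terms are controlled by
   the harmonic sequence. *)
pose F (k : nat) (x : R) := v x * \1_(`[- k.+1%:R, k.+1%:R]%classic : set R) x.
have mv : measurable_fun setT v by exact: integrable_measurable vi.
have mF k : measurable_fun setT (F k).
  by apply: measurable_funM => //; exact: measurable_indic.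
have le1 k x : `|\1_(`[- k.+1%:R, k.+1%:R]%classic : set R) x : R| <= 1.
  by rewrite indicE; case: (_ \in _); rewrite ?normr1 ?normr0.
have cF x : (fun k => F k x) @ \oo --> v x.
  apply: cvg_near_cst; near=> k.
  rewrite /F indicE mem_set ?mulr1//= in_itv/= -ler_norml.
  apply: (@le_trans _ _ k%:R); last by rewrite ler_nat.
  by near: k; exact: nbhs_infty_ger.
have H : (fun k => \int[leb]_x F k x) @ \oo --> \int[leb]_x v x.
  apply: (@dominated_Rintegral _ _ _ leb F v (fun x => `|v x|)) => //.
    exact: (integrable_norm vi).
  move=> k x /=.
  by rewrite normrM -[leRHS]mulr1 ler_wpM2l.
have E k : \int[leb]_x F k x = u k.+1%:R - u (- k.+1%:R).
  have k0 : - k.+1%:R < k.+1%:R :> R by rewrite gtrN.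
  have cu : continuous u.
    move=> x; apply: differentiable_continuous; apply/derivable1_diffP.
    exact: (@ex_derive _ _ _ _ _ _ _ (du x)).
  have : (\int[leb]_(x in `[(- k.+1%:R)%R, (k.+1%:R)%R]) (v x)%:E =
      (u k.+1%:R)%:E - (u (- k.+1%:R))%:E)%E.
    apply: continuous_FTC2 => //.
    - exact: continuous_subspaceT.
    - split => [x _||]; first exact: (@ex_derive _ _ _ _ _ _ _ (du x)).
      + by apply: cvg_at_right_filter; exact: cu.
      + by apply: cvg_at_left_filter; exact: cu.
    - by move=> x _; rewrite derive1E; exact: (@derive_val _ _ _ _ _ _ _ (du x)).
  rewrite -EFinB integral_mkcond => e; rewrite /Rintegral.
  rewrite -[RHS]/(fine (_%:E)) -e; congr fine; apply: eq_integral => x _.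
  by rewrite /F patchE indicE; case: ifPn => _; rewrite ?mulr1 ?mulr0.
suff H0 : (fun k : nat => u k.+1%:R - u (- k.+1%:R)) @ \oo --> (0 : R).
  move: H; under eq_fun do rewrite E.
  by move=> H; apply: (cvg_unique _ H H0).
have C0 : 0 <= C by rewrite (le_trans _ (uC 0))// normr0 mul0r.
apply: (@squeeze_cvgr _ _ _ _ (fun k : nat => - ((C + C) * k.+1%:R^-1))
  (fun k : nat => (C + C) * k.+1%:R^-1)).
- apply: nearW => k; rewrite -ler_norml (le_trans (ler_normB _ _))// mulrDl lerD//.
    by rewrite ler_pdivlMr// mulrC; have := uC k.+1%:R; rewrite (ger0_norm (ler0n _ _)).
  by rewrite ler_pdivlMr// mulrC; have := uC (- k.+1%:R); rewrite normrN (ger0_norm (ler0n _ _)).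
- rewrite -[0 in X in _ --> X]oppr0 -(mulr0 (C + C)).
  by apply: cvgN; apply: cvgMl_tmp; exact: cvg_harmonic.
- by rewrite -(mulr0 (C + C)); apply: cvgMl_tmp; exact: cvg_harmonic.
Unshelve. all: end_near. Qed.

(** Fubini peels off coordinates until the direction [i] is the real line itself. Since each line is
    treated separately, the constant of the decay hypothesis may depend on the line, as it must for
    symbols singular at theta = 0. *)
Lemma integral_derive0 d (i : 'I_d) (u v : 'rV[R]_d -> R) :
  (lebesgue_rV d).-integrable setT (EFin \o v) ->
  (forall x : 'rV[R]_d, is_derive x 'e_i u (v x)) ->
  (forall x : 'rV[R]_d, continuous (fun t : R => v (x + t *: 'e_i))) ->
  (forall x : 'rV[R]_d, exists C, forall t : R, `|t| * `|u (x + t *: 'e_i)| <= C) ->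
  \int[lebesgue_rV d]_x v x = 0.
Proof.
elim: d i u v => [[]//|d IH] i u v vi du cv ub.
have mv : measurable_fun setT v by exact: integrable_measurable vi.
have vic := (integrable_cons mv).1 vi.
rewrite integral_cons//; case: (unliftP ord0 i) => [j|] ei; subst i.
  rewrite -(Rintegral12 vic).2 /Rintegral.
  rewrite (ae_eq_integral (cst 0%E)) ?integral0//.
  - by apply: measurable_int (Rintegral12 vic).1.
  - have := ae_integrable1 vic; apply: filterS => x ix _ /=; congr _%:E.
    have cE w (t : R) : rV_cons (x, w + t *: 'e_j) = rV_cons (x, w) + t *: 'e_(lift ord0 j).
      exact: (rV_consDr (x, w)).
    apply: (IH j (fun w => u (rV_cons (x, w)))) => //.
    + move=> w; apply: is_derive_line (du (rV_cons (x, w))) => h.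
      by rewrite addrC -cE addrC.
    + by move=> w; under eq_fun do rewrite cE; exact: cv.
    + move=> w; have [C uC] := ub (rV_cons (x, w)); exists C => t.
      by rewrite cE.
rewrite -(Rintegral21 vic).2 /Rintegral.
rewrite (ae_eq_integral (cst 0%E)) ?integral0//.
- by apply: measurable_int (Rintegral21 vic).1.
- have := ae_integrable2 vic; apply: filterS => w iw _ /=; congr _%:E.
  have cE (x t : R) : rV_cons (x + t, w) = rV_cons (x, w) + t *: 'e_ord0.
    exact: (rV_consD (x, w)).
  have cE0 (t : R) : rV_cons (t, w) = rV_cons (0, w) + t *: 'e_ord0.
    by rewrite -cE add0r.
  apply: (@integral_derive0_R (fun t => u (rV_cons (t, w)))) => //.
  + move=> x; apply: is_derive_line (du (rV_cons (x, w))) => h.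
    by rewrite addrC -cE addrC [h *: 1]mulr1.
  + rewrite (_ : (fun y => _) = (fun t => v (rV_cons (0, w) + t *: 'e_ord0))); first exact: cv.
    by apply/funext => t; rewrite -cE0.
  + have [C uC] := ub (rV_cons (0, w)); exists C => t.
    by rewrite cE0.
Qed.

End integral_derivative.

(** * Complex derivatives and Schwartz functions *)

Section real_continuity.
Context {R : realType} {T : topologicalType}.
Implicit Types f g h : T -> R.

Lemma continuous_linBD f g h (a b : R) : continuous f -> continuous g ->
  continuous h -> continuous (fun y => a * f y - b * g y + h y).
Proof.
move=> cf cg ch y; apply: cvgD; last exact: ch.
have k1 : a * f z @[z --> y] --> a * f y by apply: cvgMl_tmp; exact: cf.
have k2 : b * g z @[z --> y] --> b * g y by apply: cvgMl_tmp; exact: cg.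
exact: (cvgB k1 k2).
Qed.

Lemma continuous_linDD f g h (a b : R) : continuous f -> continuous g ->
  continuous h -> continuous (fun y => a * f y + b * g y + h y).
Proof.
move=> cf cg ch; have := continuous_linBD (b := - b) cf cg ch (a := a).
by under eq_fun do rewrite mulNr opprK.
Qed.

Lemma continuous_mulR f g : continuous f -> continuous g ->
  continuous (fun y => f y * g y).
Proof. by move=> cf cg y; apply: cvgM; [exact: cf|exact: cg]. Qed.

Lemma continuous_cstR (c : R) : continuous ((fun=> c) : T -> R).
Proof. by move=> y; exact: cvg_cst. Qed.

End real_continuity.

Section is_cderive.
Context {R : realType} {V : normedModType R}.
Implicit Types (x v : V) (f g : V -> R[i]) (h : V -> R).

Definition is_cderive x v f (l : R[i]) : Prop :=
  is_derive x v (fun y => Re (f y)) (Re l) /\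
  is_derive x v (fun y => Im (f y)) (Im l).

Lemma is_cderive_cst x v c : is_cderive x v (fun=> c) 0.
Proof. by split; exact: is_derive_cst. Qed.

Lemma is_cderiveC x v h l : is_derive x v h l ->
  is_cderive x v (fun y => (h y)%:C) l%:C.
Proof. by move=> hl; split => //=; exact: is_derive_cst. Qed.

Lemma is_cderiveD x v f g a b : is_cderive x v f a -> is_cderive x v g b ->
  is_cderive x v (fun y => f y + g y) (a + b).
Proof.
move=> [f1 f2] [g1 g2]; split.
  rewrite ReD (_ : (fun y => _) = (fun y => Re (f y)) + (fun y => Re (g y))).
    exact: is_deriveD.
  by apply/funext => y; rewrite ReD.
rewrite ImD (_ : (fun y => _) = (fun y => Im (f y)) + (fun y => Im (g y))).
  exact: is_deriveD.
by apply/funext => y; rewrite ImD.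
Qed.

Lemma is_cderiveM x v f g a b : is_cderive x v f a -> is_cderive x v g b ->
  is_cderive x v (fun y => f y * g y) (f x * b + a * g x).
Proof.
move=> [f1 f2] [g1 g2]; split.
  rewrite (_ : (fun y => _) = (fun y => Re (f y)) * (fun y => Re (g y)) -
      (fun y => Im (f y)) * (fun y => Im (g y))).
    have h := is_deriveB (is_deriveM f1 g1) (is_deriveM f2 g2).
    apply: (is_derive_eq h).
    by rewrite /GRing.scale /= ReD !ReM; ring.
  by apply/funext => y; rewrite ReM.
rewrite (_ : (fun y => _) = (fun y => Re (f y)) * (fun y => Im (g y)) +
      (fun y => Im (f y)) * (fun y => Re (g y))).
  have h := is_deriveD (is_deriveM f1 g2) (is_deriveM f2 g1).
  apply: (is_derive_eq h).
  by rewrite /GRing.scale /= ImD !ImM; ring.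
by apply/funext => y; rewrite ImM.
Qed.

Lemma is_cderive_eq x v f a b : is_cderive x v f a -> a = b -> is_cderive x v f b.
Proof. by move=> ? <-. Qed.

Lemma is_cderiveZ x v f a c : is_cderive x v f a ->
  is_cderive x v (fun y => c * f y) (c * a).
Proof.
move=> fa; apply: is_cderive_eq (is_cderiveM (is_cderive_cst _ _ c) fa) _.
by rewrite mul0r addr0.
Qed.

Lemma is_cderive_sum I (r : seq I) x v (F : I -> V -> R[i]) (a : I -> R[i]) :
  (forall i, is_cderive x v (F i) (a i)) ->
  is_cderive x v (fun y => \sum_(i <- r) F i y) (\sum_(i <- r) a i).
Proof.
move=> Fa; elim: r => [|i r IH].
  under eq_fun do rewrite big_nil.
  by rewrite big_nil; exact: is_cderive_cst.
by under eq_fun do rewrite big_cons; rewrite big_cons; exact: is_cderiveD.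
Qed.

(** Restriction to the line through [x] in direction [v] reduces this to the chain rule in one
    variable. *)
Lemma is_derive_compR (g : R -> R) x v h l k :
  is_derive x v h l -> is_derive (h x) 1 g k -> is_derive x v (g \o h) (k * l).
Proof.
move=> hl gk; have hl0 : is_derive (0 : R) 1 (fun t : R => h (t *: v + x)) l.
  by apply: is_derive_line hl => t; rewrite addr0 [t *: 1]mulr1.
have gk0 : is_derive (h (0 *: v + x)) 1 g k by rewrite scale0r add0r.
have := is_derive1_comp gk0 hl0.
by apply: is_derive_line => t; rewrite /= addr0 [t *: 1]mulr1.
Qed.

Lemma is_cderive_expi x v h l : is_derive x v h l ->
  is_cderive x v (fun y => expi (h y)) ((0 +i* l) * expi (h x)).
Proof.
move=> hl; split => /=.
  apply: is_derive_eq; first exact: is_derive_compR hl (is_derive_cos _).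
  by rewrite mul0r sub0r mulNr mulrC.
apply: is_derive_eq; first exact: is_derive_compR hl (is_derive_sin _).
by rewrite mul0r add0r mulrC.
Qed.

End is_cderive.

Lemma is_cderive_line {R : realType} {V V' : normedModType R} (f : V -> R[i])
    (g : V' -> R[i]) x x' v v' l :
  (forall h : R, f (h *: v + x) = g (h *: v' + x')) ->
  is_cderive x v f l -> is_cderive x' v' g l.
Proof.
by move=> fg [f1 f2]; split; [move: f1|move: f2]; apply: is_derive_line => h; rewrite fg.
Qed.

Section schwartz_calculus.
Context {R : realType} {d : nat}.
Implicit Types (f g : 'rV[R]_d -> R[i]) (al be : seq 'I_d) (x : 'rV[R]_d).

Lemma is_cderive_cpartial i f x l :
  is_cderive x 'e_i f l -> cderivable i f x /\ cpartial i f x = l.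
Proof.
by move=> [[d1 e1] [d2 e2]]; split => //; apply: complexP; rewrite /= ?e1 ?e2.
Qed.

Lemma cderivableP i f x : cderivable i f x -> is_cderive x 'e_i f (cpartial i f x).
Proof. by move=> [d1 d2]; split; exact: DeriveDef. Qed.

Lemma is_derive_coord (i m : 'I_d) x :
  is_derive x 'e_i (fun y : 'rV[R]_d => y 0 m) (m == i)%:R.
Proof.
apply: (@is_derive_line _ R _ _ (fun t : R => x 0 m + (m == i)%:R * t) _ 0 x 1 'e_i).
  move=> h; rewrite addr0 !mxE eqxx /= addrC mulrC.
  by rewrite [h *: 1]mulr1 mulrC.
have -> : (fun t : R => x 0 m + (m == i)%:R * t) = cst (x 0 m) + (m == i)%:R \*: id.
  by [].
have h := is_deriveD (is_derive_cst (x 0 m) (0 : R) 1)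
  (is_deriveZ (m == i)%:R (is_derive_id (0 : R) 1)).
apply: (is_derive_eq h).
by rewrite add0r /GRing.scale /= mulr1.
Qed.

Lemma csmooth_partials be f : csmooth f -> csmooth (cpartials be f).
Proof.
move=> sf b; rewrite /cpartials -foldr_cat; exact: sf.
Qed.

Lemma csmooth_cderivable i f x : csmooth f -> cderivable i f x.
Proof. by move=> /(_ [::]) [_]; apply. Qed.

Lemma csmooth_cmeas f : csmooth f -> cmeas f.
Proof. by move=> /(_ [::]) [/ccontinuous_cmeas]. Qed.

Lemma csmooth_is_cderive i f x : csmooth f -> is_cderive x 'e_i f (cpartial i f x).
Proof. by move=> sf; exact/cderivableP/csmooth_cderivable. Qed.

Lemma schwartz_partials be f : schwartz f -> schwartz (cpartials be f).
Proof.
move=> [sf bf]; split; first exact: csmooth_partials.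
by move=> al b; have := bf al (b ++ be); rewrite /cpartials foldr_cat.
Qed.

Lemma schwartz_cpartial i f : schwartz f -> schwartz (cpartial i f).
Proof. exact: (schwartz_partials [:: i]). Qed.

Lemma cpartial_lin i f g (c : R[i]) : csmooth f -> csmooth g ->
  cpartial i (fun x => c * f x + g x) = fun x => c * cpartial i f x + cpartial i g x.
Proof.
move=> sf sg; apply/funext => x.
have := is_cderiveD (is_cderiveZ c (csmooth_is_cderive i x sf)) (csmooth_is_cderive i x sg).
by move/is_cderive_cpartial => [].
Qed.

Lemma cpartials_lin be f g (c : R[i]) : csmooth f -> csmooth g ->
  cpartials be (fun x => c * f x + g x) =
  fun x => c * cpartials be f x + cpartials be g x.
Proof.
move=> sf sg; elim: be => [//|i be IH] /=.
by rewrite IH; apply: cpartial_lin; exact: csmooth_partials.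
Qed.

Lemma ccontinuous_lin f g (c : R[i]) : ccontinuous f -> ccontinuous g ->
  ccontinuous (fun x => c * f x + g x).
Proof.
move=> [f1 f2] [g1 g2]; split.
  under eq_fun do rewrite ReD ReM; exact: continuous_linBD.
by under eq_fun do rewrite ImD ImM; exact: continuous_linDD.
Qed.

Lemma csmooth_lin f g (c : R[i]) : csmooth f -> csmooth g ->
  csmooth (fun x => c * f x + g x).
Proof.
move=> sf sg be; rewrite cpartials_lin//; split.
  by apply: ccontinuous_lin; [exact: (sf be).1|exact: (sg be).1].
move=> i x; apply: (is_cderive_cpartial _).1.
apply: is_cderiveD; first apply: is_cderiveZ.
  by apply: csmooth_is_cderive; exact: csmooth_partials.
by apply: csmooth_is_cderive; exact: csmooth_partials.
Qed.

Lemma schwartz_lin f g (c : R[i]) : schwartz f -> schwartz g ->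
  schwartz (fun x => c * f x + g x).
Proof.
move=> [sf bf] [sg bg]; split; first exact: csmooth_lin.
move=> al be; have [C1 h1] := bf al be; have [C2 h2] := bg al be.
exists (normc c * C1 + C2) => x; rewrite cpartials_lin//.
rewrite (le_trans (ler_wpM2l _ (normcD _ _)))// mulrDr lerD//.
by rewrite normcM mulrCA ler_wpM2l// normc_ge0.
Qed.

Lemma cpartials0 be : cpartials be (fun=> 0 : R[i]) = (fun=> 0) :> ('rV[R]_d -> R[i]).
Proof.
elim: be => //= i be ->; apply/funext => x.
by have [_ ->] := is_cderive_cpartial (is_cderive_cst x 'e_i (0 : R[i])).
Qed.

Lemma schwartz0 : schwartz ((fun=> 0) : 'rV[R]_d -> R[i]).
Proof.
split=> [be|al be]; last by exists 0 => x; rewrite cpartials0 normc0 mulr0.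
rewrite cpartials0; split; first by split; exact: continuous_cstR.
by move=> i x; exact: (is_cderive_cpartial (is_cderive_cst _ _ _)).1.
Qed.

Lemma schwartzZ f (c : R[i]) : schwartz f -> schwartz (fun x => c * f x).
Proof.
move=> sf; have := schwartz_lin c sf schwartz0.
by under eq_fun do rewrite addr0.
Qed.

Lemma schwartzD f g : schwartz f -> schwartz g -> schwartz (fun x => f x + g x).
Proof.
move=> sf sg; have := schwartz_lin 1 sf sg.
by under eq_fun do rewrite mul1r.
Qed.

Lemma schwartz_sum I (r : seq I) (F : I -> 'rV[R]_d -> R[i]) :
  (forall i, schwartz (F i)) -> schwartz (fun x => \sum_(i <- r) F i x).
Proof.
move=> sF; elim: r => [|i r IH].
  by under eq_fun do rewrite big_nil; exact: schwartz0.
by under eq_fun do rewrite big_cons; exact: schwartzD.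
Qed.

(** A qualitative Leibniz rule: the words in [L] need not be known, since every derivative of a
    Schwartz function is Schwartz. *)
Lemma cpartials_coordM m f be : csmooth f ->
  exists L : seq (seq 'I_d), cpartials be (fun x => (x 0 m)%:C * f x) =
    fun x => (x 0 m)%:C * cpartials be f x + \sum_(b <- L) cpartials b f x.
Proof.
move=> sf; elim: be => [|i be [L IH]].
  by exists [::]; apply/funext => x; rewrite big_nil addr0.
(* The new derivative either hits the coordinate, which leaves [be] when [m] is [i], or is prefixed
   to the words already present. *)
exists ((if m == i then [:: be] else [::]) ++ [seq i :: b | b <- L]).
rewrite /= IH; apply/funext => x.
have sfb b : csmooth (cpartials b f) by exact: csmooth_partials.
have D := is_cderiveD (is_cderiveM (is_cderiveC (is_derive_coord i m x))
  (csmooth_is_cderive i x (sfb be)))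
  (is_cderive_sum L (fun b => csmooth_is_cderive i x (sfb b))).
have [_ ->] := is_cderive_cpartial D.
rewrite big_cat big_map /= -!addrA; congr (_ + (_ + _)).
by case: eqP => _; rewrite ?big_seq1 ?big_nil ?mul1r ?mul0r.
Qed.

Lemma ccontinuous_coordM m f : ccontinuous f ->
  ccontinuous (fun x => (x 0 m)%:C * f x).
Proof.
have cx : continuous (fun x : 'rV[R]_d => x 0 m) by exact: coord_continuous.
move=> [f1 f2]; split.
  under eq_fun do rewrite ReM /= mul0r subr0; exact: continuous_mulR.
by under eq_fun do rewrite ImM /= mul0r addr0; exact: continuous_mulR.
Qed.

Lemma schwartz_coordM m f : schwartz f -> schwartz (fun x => (x 0 m)%:C * f x).
Proof.
move=> sf; have [cf bf] := sf.
have sb b : schwartz (cpartials b f) by exact: schwartz_partials.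
split=> [be|al be].
  have [L ->] := cpartials_coordM m be cf.
  have sL : schwartz (fun x => \sum_(b <- L) cpartials b f x) by exact: schwartz_sum.
  split.
    have := ccontinuous_lin 1 (ccontinuous_coordM m (cf be).1) (sL.1 [::]).1.
    by under eq_fun do rewrite mul1r.
  move=> i x; apply: (is_cderive_cpartial _).1.
  apply: is_cderiveD; last exact: csmooth_is_cderive sL.1.
  apply: is_cderiveM; first by apply: is_cderiveC; exact: is_derive_coord.
  by apply: csmooth_is_cderive; case: (sb be).
have [L ->] := cpartials_coordM m be cf.
have [_ /(_ al [::])[C2 h2]] : schwartz (fun x => \sum_(b <- L) cpartials b f x) by exact: schwartz_sum.
(* The extra coordinate is absorbed by lengthening the monomial. *)
have [C1 h1] := bf (m :: al) be.
exists (C1 + C2) => x; rewrite (le_trans (ler_wpM2l _ (normcD _ _)))// mulrDr lerD//.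
rewrite normcM normc_real mulrA (le_trans _ (h1 x))// /monomial big_cons normrM.
by rewrite [`|_| * `|x 0 m|]mulrC.
Qed.

End schwartz_calculus.

Section complex_ibp.
Context {R : realType}.

Lemma rV_shiftE d (x : 'rV[R]_d) (t : R) (i j : 'I_d) :
  (x + t *: 'e_i) 0 j = x 0 j + t * (j == i)%:R.
Proof. by rewrite !mxE eqxx. Qed.

Lemma cderive_continuous (u : R -> R[i]) (v : R -> R[i]) :
  (forall t : R, is_cderive t 1 u (v t)) ->
  continuous (fun t => Re (u t)) /\ continuous (fun t => Im (u t)).
Proof.
move=> du; split => t; apply: differentiable_continuous; apply/derivable1_diffP.
  by case: (du t) => -[].
by case: (du t) => _ [].
Qed.

(** The derivative [w] makes [v] continuous along lines, as the fundamental theorem of calculus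
    requires. Decay is stated in the coordinate itself, the form in which Schwartz bounds come. *)
Lemma cintegral_derive0 d (i : 'I_d) (u v w : 'rV[R]_d -> R[i]) :
  cintegrable (lebesgue_rV d) setT v ->
  (forall x : 'rV[R]_d, is_cderive x 'e_i u (v x)) ->
  (forall x : 'rV[R]_d, is_cderive x 'e_i v (w x)) ->
  (forall x : 'rV[R]_d, exists C, forall t : R,
     (1 + `|(x + t *: 'e_i) 0 i|) * normc (u (x + t *: 'e_i)) <= C) ->
  cintegral (lebesgue_rV d) setT v = 0.
Proof.
move=> [v1 v2] du dv bu.
have cv (x : 'rV[R]_d) : continuous (fun t : R => Re (v (x + t *: 'e_i))) /\
    continuous (fun t : R => Im (v (x + t *: 'e_i))).
  apply: (@cderive_continuous _ (fun t => w (x + t *: 'e_i))) => t.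
  apply: is_cderive_line (dv (x + t *: 'e_i)) => h.
  by rewrite [h *: 1]mulr1 scalerDl addrCA.
have b (x : 'rV[R]_d) : exists C, forall t, `|t| * normc (u (x + t *: 'e_i)) <= C.
  (* From |t| <= |x_i| + |x_i + t| <= (1 + |x_i|) (1 + |x_i + t|). *)
  have [C uC] := bu x; exists ((1 + `|x 0 i|) * C) => t.
  have n0 := normc_ge0 (u (x + t *: 'e_i)).
  have C0 : 0 <= C by rewrite (le_trans _ (uC 0))// mulr_ge0 ?normc_ge0// addr_ge0.
  apply: (@le_trans _ _ ((1 + `|x 0 i|) *
      ((1 + `|(x + t *: 'e_i) 0 i|) * normc (u (x + t *: 'e_i))))); last first.
    by rewrite ler_wpM2l// addr_ge0.
  rewrite mulrA ler_wpM2r//.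
  rewrite rV_shiftE eqxx mulr1 mulrDl mul1r mulrDr mulr1.
  have : `|t| <= `|x 0 i| + `|x 0 i + t|.
    by rewrite -[X in `|X|](addKr (x 0 i)) (le_trans (ler_normD _ _))// normrN.
  have : 0 <= `|x 0 i| * `|x 0 i + t| by rewrite mulr_ge0.
  set A := `|x 0 i|; set B := `|x 0 i + t|; set D := A * B; lra.
apply: complexP => /=.
  apply: (@integral_derive0 R d i (fun x => Re (u x))) => //.
  - by move=> x; case: (du x).
  - by move=> x; case: (cv x).
  - move=> x; have [C uC] := b x; exists C => t.
    by rewrite (le_trans _ (uC t))// ler_wpM2l// Re_le_normc.
apply: (@integral_derive0 R d i (fun x => Im (u x))) => //.
- by move=> x; case: (du x).
- by move=> x; case: (cv x).
- move=> x; have [C uC] := b x; exists C => t.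
  by rewrite (le_trans _ (uC t))// ler_wpM2l// Im_le_normc.
Qed.

Lemma is_cderive_under_integral d (T : measurableType d)
    (mu : {measure set T -> \bar R}) (f f' : R -> T -> R[i]) (G : T -> R) :
  (forall t, cintegrable mu setT (f t)) ->
  (forall (t : R) x, is_cderive t 1 (f^~ x) (f' t x)) ->
  mu.-integrable setT (EFin \o G) ->
  (forall t x, normc (f' t x) <= G x) ->
  is_cderive (0 : R) 1 (fun t => cintegral mu setT (f t)) (cintegral mu setT (f' 0)).
Proof.
move=> fi df iG fG.
(* Done once for [P], which is then taken to be the real and the imaginary part. *)
have aux (P : R[i] -> R) : (forall z, `|P z| <= normc z) ->
    (forall t, mu.-integrable setT (EFin \o (fun x => P (f t x)))) ->
    (forall (t : R) x, is_derive t 1 (fun s => P (f s x)) (P (f' t x))) ->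
    is_derive (0 : R) 1 (fun t => \int[mu]_x P (f t x)) (\int[mu]_x P (f' 0 x)).
  move=> Pn Pi dP.
  (* Any open interval around 0 would do, as the domination holds for all t. *)
  have I0 : `]-1, 1[%classic (0 : R) by rewrite /= in_itv /= ltrN10 ltr01.
  have G0 x : 0 <= G x by exact: le_trans (normc_ge0 _) (fG 0 x).
  have bnd (x : R) y : `]-1, 1[%classic x -> [set: T] y ->
      `|partial1of2 (fun s x => P (f s x)) x y| <= G y.
    move=> _ _; rewrite partial1of2E.
    have [_ ->] := dP x y; exact: le_trans (Pn _) (fG _ _).
  have der (x : R) y : `]-1, 1[%classic x -> [set: T] y ->
      derivable (fun s => P (f s y)) x 1 by move=> _ _; case: (dP x y).
  have D := @derivable_under_integral R _ T mu (fun s x => P (f s x)) setT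
    measurableT 0 (-1) 1 I0 (fun t _ => Pi t) der G G0 iG bnd.
  split => //; rewrite -derive1E.
  rewrite (@differentiation_under_integral R _ T mu (fun s x => P (f s x)) setT
    measurableT 0 (-1) 1 I0 (fun t _ => Pi t) der G G0 iG bnd).
  by apply: eq_Rintegral => y _; rewrite partial1of2E; have [_ ->] := dP 0 y.
split.
  apply: (aux (@complex.Re R)).
  - exact: Re_le_normc.
  - by move=> t; case: (fi t).
  - by move=> t x; case: (df t x).
apply: (aux (@complex.Im R)).
- exact: Im_le_normc.
- by move=> t; case: (fi t).
- by move=> t x; case: (df t x).
Qed.

End complex_ibp.

(** * Schwartz bounds through an integrable weight *)

Section weight.
Context {R : realType}.
Local Notation leb := (@lebesgue_measure R).

Lemma integrable_oneDsqrV :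
  leb.-integrable setT (EFin \o (fun x : R => (1 + x ^+ 2)^-1)).
Proof.
have c : continuous (fun x : R => (1 + x ^+ 2)^-1) by exact: continuous_oneDsqrV.
have g0 (x : R) : 0 <= (1 + x ^+ 2)^-1 by rewrite invr_ge0 addr_ge0// sqr_ge0.
apply/integrableP; split.
  by apply/measurable_EFinP; exact: continuous_measurable_fun.
under eq_integral do rewrite gee0_abs ?lee_fin//.
rewrite ge0_symfun_integralT//; last by move=> x /=; rewrite sqrrN.
by rewrite -set_itvcy integral0y_oneDsqr -EFinM ltry.
Qed.

(** A product, so that integrability is a one-dimensional fact and the inverse is a polynomial,
    which Schwartz bounds control monomial by monomial. *)
Definition weight d (x : 'rV[R]_d) : R := \prod_(i < d) (1 + x 0 i ^+ 2)^-1.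

Lemma weight_gt0 d (x : 'rV[R]_d) : 0 < weight x.
Proof. by apply: prodr_gt0 => i _; rewrite invr_gt0 ltr_wpDr// sqr_ge0. Qed.

Lemma weight_ge0 d (x : 'rV[R]_d) : 0 <= weight x.
Proof. exact/ltW/weight_gt0. Qed.

Lemma weightV d (x : 'rV[R]_d) :
  (weight x)^-1 = \prod_(i <- enum 'I_d) (1 + x 0 i ^+ 2).
Proof. by rewrite /weight -prodfV big_enum /=; apply: eq_bigr => i _; rewrite invrK. Qed.

Lemma integrable_weight d :
  (lebesgue_rV d).-integrable setT (EFin \o (@weight d)).
Proof.
apply: (@integrable_prod R d (fun _ x => (1 + x ^+ 2)^-1)) => i.
exact: integrable_oneDsqrV.
Qed.

(** Expanding the product, each factor 1 + x_i^2 either leaves the monomial alone or adds the letter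
    [i] twice; this makes 2^(size l) terms, each at most [S]. *)
Lemma monomial_bound_prod d (x : 'rV[R]_d) (g S : R) N (l : seq 'I_d) :
  (forall al : seq 'I_d, (size al <= N)%N -> `|monomial al x| * g <= S) ->
  forall al : seq 'I_d, (size al + (size l).*2 <= N)%N ->
  \prod_(i <- l) (1 + x 0 i ^+ 2) * (`|monomial al x| * g) <= 2 ^+ size l * S.
Proof.
move=> gS; elim: l => [|i l IH] al sz.
  by rewrite big_nil expr0 !mul1r gS// -[size al]addn0.
have e : `|monomial [:: i, i & al] x| = x 0 i ^+ 2 * `|monomial al x|.
  rewrite /monomial !big_cons mulrA normrM -expr2 ger0_norm ?sqr_ge0//.
have -> : \prod_(j <- i :: l) (1 + x 0 j ^+ 2) * (`|monomial al x| * g) =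
   \prod_(j <- l) (1 + x 0 j ^+ 2) * (`|monomial al x| * g) +
   \prod_(j <- l) (1 + x 0 j ^+ 2) * (`|monomial [:: i, i & al] x| * g).
  by rewrite e big_cons; ring.
rewrite /= exprS -mulrA mulrDl mul1r lerD//; apply: IH.
  by rewrite (leq_trans _ sz)// leq_add2l leq_double /=.
by rewrite (leq_trans _ sz)//= doubleS !addnS !addSn.
Qed.

(** The inverse of the weight has degree 2d and expands into 2^d monomials, whence the words of size
    up to [d.*2] and the constant. *)
Lemma le_weight d (x : 'rV[R]_d) (g S : R) :
  (forall al : seq 'I_d, (size al <= d.*2)%N -> `|monomial al x| * g <= S) ->
  g <= 2 ^+ d * S * weight x.
Proof.
move=> gS; rewrite -ler_pdivrMr ?weight_gt0// weightV mulrC.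
have := monomial_bound_prod (l := enum 'I_d) gS (al := [::]).
rewrite size_enum_ord /= add0n => /(_ (leqnn _)).
by rewrite /monomial big_nil normr1 mul1r.
Qed.

End weight.

Section schwartz_norm.
Context {R : realType} {d : nat}.
Implicit Types (f : 'rV[R]_d -> R[i]).

Lemma schwartz_norm_ge N f al be x : schwartz f ->
  (size al <= N)%N -> (size be <= N)%N ->
  `|monomial al x| * normc (cpartials be f x) <= schwartz_norm N f.
Proof.
move=> [sf bf] sal sbe; apply: ub_le_sup; last by exists al, be, x.
have /choice[C hC] : forall p : seq 'I_d * seq 'I_d, exists C, forall x,
    `|monomial p.1 x| * normc (cpartials p.2 f x) <= C.
  by move=> [a b]; have [C h] := bf a b; exists C.
(* The supremum is meaningful only for a bounded set. There are finitely many words of size at most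
   N, enumerated here as tuples, so the sum of all their constants is a common bound. *)
exists (\sum_(k < N.+1) \sum_(t : k.-tuple 'I_d)
   \sum_(l < N.+1) \sum_(t' : l.-tuple 'I_d) `|C (tval t, tval t')|).
move=> _ [a [b [y [sa sb ->]]]].
apply: le_trans (hC (a, b) y) _; apply: le_trans (ler_norm _) _.
have sa' : (size a < N.+1)%N by [].
have sb' : (size b < N.+1)%N by [].
rewrite (bigD1 (Ordinal sa')) //= (bigD1 (in_tuple a)) //=.
rewrite (bigD1 (Ordinal sb')) //= (bigD1 (in_tuple b)) //=.
rewrite -!addrA lerDl !addr_ge0 ?sumr_ge0// => *; rewrite ?sumr_ge0// => *;
  rewrite ?sumr_ge0// => *; rewrite ?sumr_ge0//.
Qed.

Lemma schwartz_norm_weight f be x : schwartz f -> (size be <= d.*2)%N ->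
  normc (cpartials be f x) <= 2 ^+ d * schwartz_norm d.*2 f * weight x.
Proof. by move=> sf sbe; apply: le_weight => al sal; exact: schwartz_norm_ge. Qed.

Lemma schwartz_weight f : schwartz f ->
  exists C, forall x, normc (f x) <= C * weight x.
Proof.
move=> sf; exists (2 ^+ d * schwartz_norm d.*2 f) => x.
exact: (@schwartz_norm_weight f [::]).
Qed.

Lemma schwartz_norm_ge0 N f : schwartz f -> 0 <= schwartz_norm N f.
Proof.
move=> sf; apply: le_trans (@schwartz_norm_ge N f [::] [::] 0 sf _ _) => //.
by rewrite mulr_ge0// normc_ge0.
Qed.

Lemma integrable_weightZ (C : R) :
  (lebesgue_rV d).-integrable setT (EFin \o (fun x => C * weight x)).
Proof.
rewrite (_ : _ \o _ = fun x => (C%:E * (EFin \o (@weight R d)) x)%E)//.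
by apply: integrableZl => //; exact: integrable_weight.
Qed.

Lemma schwartz_cintegrable f : schwartz f -> cintegrable (lebesgue_rV d) setT f.
Proof.
move=> sf; have [C hC] := schwartz_weight sf.
apply: cintegrable_le (integrable_weightZ C) hC; apply: csmooth_cmeas; exact: sf.1.
Qed.

End schwartz_norm.

(** * The Fourier transform *)

Section fourier_transform.
Context {R : realType} {d : nat}.
Implicit Types (f g : 'rV[R]_d -> R[i]) (x p : 'rV[R]_d).
Local Notation lebd := (@lebesgue_rV R d).
Local Notation wave x p := (expi (- dotv x p)).

Lemma dotvC x p : dotv x p = dotv p x.
Proof. by apply: eq_bigr => i _; rewrite mulrC. Qed.

Lemma is_derive_dotv x p (i : 'I_d) :
  is_derive x 'e_i (fun y : 'rV[R]_d => dotv y p) (p 0 i).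
Proof.
apply: (@is_derive_line _ R _ _ (fun t : R => dotv x p + p 0 i * t) _ 0 x 1 'e_i).
  move=> h; rewrite addr0 [h *: 1]mulr1 /dotv [in RHS](bigD1 i) //= (bigD1 i) //=.
  rewrite addrC [h *: _ + x]addrC rV_shiftE eqxx mulr1 mulrDl [h * _]mulrC.
  rewrite [in RHS]addrAC addrC; congr (_ + _ + _).
  by apply: eq_bigr => j ji; rewrite rV_shiftE (negbTE ji) mulr0 addr0.
have h := is_deriveD (is_derive_cst (dotv x p) (0 : R) 1)
  (is_deriveZ (p 0 i) (is_derive_id (0 : R) 1)).
apply: (is_derive_eq h).
by rewrite add0r /GRing.scale /= mulr1.
Qed.

Lemma is_cderive_wave x p (i : 'I_d) :
  is_cderive x 'e_i (fun y => wave y p) ((0 +i* (- p 0 i)) * wave x p).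
Proof. by apply: is_cderive_expi; apply: is_deriveN; exact: is_derive_dotv. Qed.

Lemma measurable_dotv2 :
  measurable_fun setT (fun z : 'rV[R]_d * 'rV[R]_d => dotv z.1 z.2).
Proof.
apply: measurable_sum => i; apply: measurable_funM.
  exact: (measurableT_comp (measurable_coord i) measurable_fst).
exact: (measurableT_comp (measurable_coord i) measurable_snd).
Qed.

Lemma measurable_dotv p : measurable_fun setT (fun x : 'rV[R]_d => dotv x p).
Proof.
apply: measurable_sum => i; apply: measurable_funM; last exact: measurable_cst.
exact: measurable_coord.
Qed.

Lemma cmeas_wave p : cmeas (fun x : 'rV[R]_d => wave x p).
Proof. by apply: cmeas_expi; apply: measurableT_comp => //; exact: measurable_dotv. Qed.

Lemma normc_wave z x p : normc (z * wave x p) = normc z.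
Proof. by rewrite normcM normc_expi mulr1. Qed.

Lemma cintegrable_wave f p : schwartz f -> cintegrable lebd setT (fun x => f x * wave x p).
Proof.
move=> sf; apply: cintegrable_leC (schwartz_cintegrable sf) _.
  by apply: cmeasM; [exact: csmooth_cmeas sf.1|exact: cmeas_wave].
by move=> x; rewrite normc_wave.
Qed.

Lemma fourier_lin f g c p : schwartz f -> schwartz g ->
  fourier (fun x => c * f x + g x) p = c * fourier f p + fourier g p.
Proof.
move=> sf sg; rewrite /fourier mulrCA -mulrDr; congr (_ * _).
rewrite -cintegralZ; last exact: cintegrable_wave.
rewrite -cintegralD; [|exact: cintegrableZ (cintegrable_wave _ _)|exact: cintegrable_wave].
by apply: eq_cintegral => x; rewrite mulrDl mulrA.
Qed.

Lemma fourier0 p : fourier (fun=> 0) p = 0 :> R[i].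
Proof.
rewrite /fourier (eq_cintegral _ (g := fun=> 0)) ?cintegral0 ?mulr0// => x.
by rewrite mul0r.
Qed.

Lemma fourierZ f c p : schwartz f -> fourier (fun x => c * f x) p = c * fourier f p.
Proof.
move=> sf; have := fourier_lin c p sf schwartz0.
by rewrite fourier0 addr0; under eq_fun do rewrite addr0.
Qed.

Lemma fourierD f g p : schwartz f -> schwartz g ->
  fourier (fun x => f x + g x) p = fourier f p + fourier g p.
Proof.
move=> sf sg; have := fourier_lin 1 p sf sg.
by rewrite mul1r; under eq_fun do rewrite mul1r.
Qed.

Lemma fourier_sum I (r : seq I) (F : I -> 'rV[R]_d -> R[i]) p :
  (forall i, schwartz (F i)) ->
  fourier (fun x => \sum_(i <- r) F i x) p = \sum_(i <- r) fourier (F i) p.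
Proof.
move=> sF; elim: r => [|i r IH].
  by rewrite big_nil -[RHS](fourier0 p); congr (fourier _ p); apply/funext => x; rewrite big_nil.
rewrite big_cons -IH -fourierD//; last exact: schwartz_sum.
by congr (fourier _ p); apply/funext => x; rewrite big_cons.
Qed.

Lemma fourier_cpartial i f p : schwartz f ->
  fourier (cpartial i f) p = (0 +i* p 0 i) * fourier f p.
Proof.
move=> sf; have sfi := schwartz_cpartial i sf.
pose u x := f x * wave x p.
pose v x := f x * ((0 +i* (- p 0 i)) * wave x p) + cpartial i f x * wave x p.
have du x : is_cderive x 'e_i u (v x).
  apply: is_cderiveM; first exact: csmooth_is_cderive sf.1.
  exact: is_cderive_wave.
have i1 : cintegrable lebd setT (fun x => f x * wave x p) by exact: cintegrable_wave.
have i2 : cintegrable lebd setT (fun x => cpartial i f x * wave x p).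
  exact: cintegrable_wave.
have vE x : v x = (0 +i* (- p 0 i)) * (f x * wave x p) + cpartial i f x * wave x p.
  by rewrite /v mulrCA.
have iv : cintegrable lebd setT v.
  by rewrite (funext vE); apply: cintegrableD => //; exact: cintegrableZ.
have := @cintegral_derive0 R d i u v _ iv du.
pose c := 0 +i* (- p 0 i) : R[i].
have dv x : is_cderive x 'e_i v
    ((f x * (c * (c * wave x p)) + cpartial i f x * (c * wave x p)) +
     (cpartial i f x * (c * wave x p) + cpartial i (cpartial i f) x * wave x p)).
  apply: is_cderiveD.
    apply: is_cderiveM; first exact: csmooth_is_cderive sf.1.
    by apply: is_cderiveZ; exact: is_cderive_wave.
  apply: is_cderiveM; first exact: csmooth_is_cderive sfi.1.
  exact: is_cderive_wave.
move=> /(_ _ dv) H.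
have {H} : cintegral lebd setT v = 0.
  apply: H => x; have [_ bf] := sf.
  have [C0 h0] := bf [::] [::]; have [C1 h1] := bf [:: i] [::].
  (* The seminorms for the monomials 1 and x_i match the two terms of 1 + |x_i|; the wave has
     modulus 1. *)
  exists (C0 + C1) => t; rewrite /u normc_wave mulrDl mul1r; apply: lerD.
    by have := h0 (x + t *: 'e_i); rewrite /monomial big_nil normr1 mul1r.
  by have := h1 (x + t *: 'e_i); rewrite /monomial big_seq1.
rewrite (funext vE) cintegralD ?cintegralZ//; last exact: cintegrableZ.
move/eqP; rewrite addrC addr_eq0 => /eqP e.
rewrite /fourier e [RHS]mulrCA; congr (_ * _); rewrite -mulNr; congr (_ * _).
by apply: complexP; rewrite /= ?oppr0 ?opprK.
Qed.

Lemma is_cderive_fourier i f p : schwartz f ->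
  is_cderive p 'e_i (fourier f)
    ((0 +i* (-1)) * fourier (fun x => (x 0 i)%:C * f x) p).
Proof.
move=> sf; have sxf := schwartz_coordM i sf.
pose F (t : R) x := f x * wave x (p + t *: 'e_i).
pose F' (t : R) x := f x * ((0 +i* (- x 0 i)) * wave x (p + t *: 'e_i)).
have D : is_cderive (0 : R) 1 (fun t => cintegral lebd setT (F t))
    (cintegral lebd setT (F' 0)).
  apply: (@is_cderive_under_integral _ _ _ _ F F' (fun x => normc ((x 0 i)%:C * f x))).
  - by move=> t; exact: cintegrable_wave.
  - move=> t x; have := is_cderiveM (is_cderive_cst t 1 (f x))
      (is_cderive_expi (h := fun s : R => - dotv x (p + s *: 'e_i)) (l := - x 0 i) _).
    move=> H; apply: (is_cderive_eq (H _)); last by rewrite mul0r addr0.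
    apply: is_deriveN; have := is_derive_dotv (p + t *: 'e_i) x i.
    apply: is_derive_line => h.
    by rewrite dotvC [h *: 1]mulr1 scalerDl addrCA.
  - exact: cintegrable_normc (schwartz_cintegrable sxf).
  - move=> t x; rewrite /F' mulrA normc_wave !normcM normc_real normc_imag normrN.
    by rewrite mulrC.
have := is_cderiveZ (((2 * pi) `^ (- (d%:R / 2)))%:C) D.
have -> : cintegral lebd setT (F' 0) =
    (0 +i* (-1)) * cintegral lebd setT (fun x => (x 0 i)%:C * f x * wave x p).
  rewrite -cintegralZ; last exact: cintegrable_wave.
  apply: eq_cintegral => x; rewrite /F' scale0r addr0 mulrA.
  rewrite [RHS]mulrA; congr (_ * _).
  by apply: complexP; rewrite !(ReM, ImM) /=; ring.
rewrite mulrCA; apply: is_cderive_line => h; rewrite /fourier; congr (_ * _).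
by apply: eq_cintegral => x; rewrite /F addr0 [h *: 1]mulr1 [p + _]addrC.
Qed.

Lemma normc_fourier_cpartials al f p : schwartz f ->
  normc (fourier (cpartials al f) p) = `|monomial al p| * normc (fourier f p).
Proof.
move=> sf; elim: al => [|i al IH].
  by rewrite /monomial big_nil normr1 mul1r.
rewrite [cpartials _ _]/= -/(cpartials al f) fourier_cpartial; last exact: schwartz_partials.
by rewrite normcM IH normc_imag /monomial big_cons normrM mulrA.
Qed.

(** The outer 2^d comes from [le_weight], the 2 from [normc_cintegral_le], and the inner 2^d with
    the integral from [schwartz_norm_weight]. *)
Definition fourier_cst : R :=
  2 ^+ d * (`|(2 * pi) `^ (- (d%:R / 2))| * (2 * (2 ^+ d * \int[lebd]_x weight x))).

Lemma fourier_cst_ge0 : 0 <= fourier_cst.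
Proof.
rewrite /fourier_cst !mulr_ge0 ?exprn_ge0//.
by apply: Rintegral_ge0 => x _; exact: weight_ge0.
Qed.

(** A monomial times the transform has the modulus of the transform of a derivative of [f], which is
    bounded by an integral of the weight; [le_weight] converts these bounds into decay. *)
Lemma fourier_weight f p : schwartz f ->
  normc (fourier f p) <= fourier_cst * schwartz_norm d.*2 f * weight p.
Proof.
move=> sf.
pose S := `|(2 * pi) `^ (- (d%:R / 2))| *
  (2 * ((2 ^+ d * schwartz_norm d.*2 f) * \int[lebd]_x weight x)).
have -> : fourier_cst * schwartz_norm d.*2 f = 2 ^+ d * S.
  by rewrite /fourier_cst /S; ring.
apply: le_weight => al sal; rewrite -normc_fourier_cpartials//.
have sfa := schwartz_partials al sf.
rewrite /fourier normcM normc_real ler_wpM2l//.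
rewrite -RintegralZl//; last exact: integrable_weight.
apply: normc_cintegral_le; first exact: cintegrable_wave.
  exact: integrable_weightZ.
by move=> x; rewrite normc_wave; exact: schwartz_norm_weight.
Qed.

Lemma measurable_weight : measurable_fun setT (@weight R d).
Proof. exact: integrable_measurable (integrable_weight d). Qed.

(** Fubini gives measurability of marginals of jointly integrable functions. The factor [weight p]
    creates joint integrability and is divided out afterwards. *)
Lemma cmeas_fourier f : schwartz f -> cmeas (fourier f).
Proof.
move=> sf; pose h (z : 'rV[R]_d * 'rV[R]_d) := f z.1 * wave z.1 z.2 * (weight z.2)%:C.
have ih : cintegrable (lebd \x lebd)%E setT h.
  apply: (cintegrable_le _ (integrable_prodM
      (cintegrable_normc (schwartz_cintegrable sf)) (integrable_weight d))).
    apply: cmeasM; first apply: cmeasM.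
    - exact: (cmeas_comp (csmooth_cmeas sf.1) measurable_fst).
    - by apply: cmeas_expi; apply: measurableT_comp => //; exact: measurable_dotv2.
    - apply: cmeasC; exact: (measurableT_comp measurable_weight measurable_snd).
  by move=> z; rewrite /h normcM normc_wave normc_real ger0_norm// weight_ge0.
have mh := cintegrable_cmeas (cintegrable_cintegral2 ih).
pose K := ((2 * pi) `^ (- (d%:R / 2)))%:C : R[i].
have -> : fourier f = fun p => (K * ((weight p)^-1)%:C) *
    cintegral lebd setT (fun x => h (x, p)).
  apply/funext => p; rewrite /fourier -mulrA; congr (_ * _).
  have -> : cintegral lebd setT (fun x => h (x, p)) =
      cintegral lebd setT (fun x => f x * wave x p) * (weight p)%:C.
    by rewrite -cintegralZr//; exact: cintegrable_wave.
  rewrite [X in _ = _ * X]mulrC mulrA -rmorphM /= mulVf ?mul1r//.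
  by rewrite gt_eqF// weight_gt0.
apply: cmeasM => //; apply: cmeasM; first exact: cmeas_cst.
apply: cmeasC.
rewrite (_ : (fun x => _) = fun x : 'rV[R]_d => \prod_(i <- enum 'I_d) (1 + x 0 i ^+ 2)).
  apply: measurable_prod => i _; apply: measurable_funD => //.
  by apply: measurable_funX; exact: measurable_coord.
by apply/funext => x; exact: weightV.
Qed.

End fourier_transform.

(** * The one-dimensional Gaussian and its Fourier transform *)

Section gaussian.
Context {R : realType}.
Local Notation leb := (@lebesgue_measure R).

Definition gauss (s x : R) : R := expR (- (x ^+ 2 / (2 * s ^+ 2))).

Definition gauss_mass (s : R) : R := Num.sqrt (s ^+ 2 * pi *+ 2).

Lemma gauss_ge0 s x : 0 <= gauss s x. Proof. exact: expR_ge0. Qed.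

Lemma gauss_le1 s x : gauss s x <= 1.
Proof. by rewrite /gauss -expR0 ler_expR oppr_le0; apply: divr_ge0; [exact: sqr_ge0|apply: mulr_ge0 => //; exact: sqr_ge0]. Qed.

Lemma gauss_mass_gt0 s : 0 < s -> 0 < gauss_mass s.
Proof. by move=> s0; rewrite sqrtr_gt0 pmulrn_lgt0// mulr_gt0 ?pi_gt0// exprn_gt0. Qed.

(** The widths s and 1/s are dual under the Fourier transform; this is why [gauss_kernel] has mass 2
    pi for every s. *)
Lemma gauss_massM s : 0 < s -> gauss_mass s * gauss_mass s^-1 = 2 * pi.
Proof.
move=> s0; rewrite /gauss_mass -sqrtrM; last first.
  by rewrite mulrn_wge0// mulr_ge0 ?pi_ge0// sqr_ge0.
rewrite (_ : s ^+ 2 * pi *+ 2 * (s^-1 ^+ 2 * pi *+ 2) = (2 * pi) ^+ 2); last first.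
  by rewrite exprVn; field; rewrite gt_eqF.
by rewrite sqrtr_sqr ger0_norm// mulr_ge0// pi_ge0.
Qed.

Lemma normal_pdf_gauss s : 0 < s ->
  normal_pdf 0 s = (fun x => (gauss_mass s)^-1 * gauss s x).
Proof.
move=> s0; rewrite normal_pdfE ?gt_eqF//; apply/funext => x.
by rewrite /normal_fun /gauss subr0 mulNr mulr_natl.
Qed.

Lemma gaussE s : 0 < s -> gauss s = (fun x => gauss_mass s * normal_pdf 0 s x).
Proof.
move=> s0; rewrite normal_pdf_gauss//; apply/funext => x.
by rewrite mulrA divff ?mul1r// gt_eqF// gauss_mass_gt0.
Qed.

Lemma integrable_gauss s : 0 < s -> leb.-integrable setT (EFin \o gauss s).
Proof.
move=> s0; rewrite gaussE// (_ : _ \o _ = fun x => ((gauss_mass s)%:E *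
  (EFin \o normal_pdf 0 s) x)%E)//.
by apply: integrableZl => //; exact: integrable_normal_pdf.
Qed.

Lemma integral_gauss s : 0 < s -> \int[leb]_x gauss s x = gauss_mass s.
Proof.
move=> s0; rewrite gaussE// RintegralZl//; last exact: integrable_normal_pdf.
by rewrite /Rintegral integral_normal_pdf mulr1.
Qed.

(** With y = x^2 / (4 s^2) the Gaussian is (e^-y)^2, and 1 + x^2 <= (1 + 4 s^2) (1 + y) <= (1 + 4
    s^2) e^y. *)
Lemma gauss_decay s x : 0 < s ->
  gauss s x * (1 + x ^+ 2) ^+ 2 <= (1 + 4 * s ^+ 2) ^+ 2.
Proof.
move=> s0; set y := x ^+ 2 / (4 * s ^+ 2).
have s20 : 0 < 4 * s ^+ 2 by rewrite mulr_gt0// exprn_gt0.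
have y0 : 0 <= y by rewrite divr_ge0 ?sqr_ge0// ltW.
have xy : x ^+ 2 = y * (4 * s ^+ 2) by rewrite /y divfK// gt_eqF.
have -> : gauss s x = ((expR y)^-1) ^+ 2.
  rewrite /gauss -expRN -expRM_natl; congr expR; rewrite xy.
  by field; rewrite gt_eqF.
rewrite -exprMn ler_pXn2r// ?nnegrE ?mulr_ge0 ?invr_ge0 ?expR_ge0 ?addr_ge0 ?sqr_ge0//; last exact: ltW.
rewrite mulrC ler_pdivrMr ?expR_gt0// xy.
apply: (@le_trans _ _ ((1 + 4 * s ^+ 2) * (1 + y))); last first.
  by rewrite ler_wpM2l ?expR_ge1Dx// addr_ge0// ltW.
have : 0 <= y * (4 * s ^+ 2) by rewrite mulr_ge0// ltW.
set z := 4 * s ^+ 2 in s20 *; nra.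
Qed.

Lemma gauss_le s x : 0 < s ->
  (1 + x ^+ 2) * gauss s x <= (1 + 4 * s ^+ 2) ^+ 2 * (1 + x ^+ 2)^-1.
Proof.
move=> s0; have x0 : 0 < 1 + x ^+ 2 by rewrite ltr_wpDr// sqr_ge0.
rewrite ler_pdivlMr// mulrC mulrA -expr2 mulrC; exact: gauss_decay.
Qed.

Lemma is_derive_gauss (s x : R) : 0 < s ->
  is_derive x 1 (gauss s) (- (x / s ^+ 2) * gauss s x).
Proof.
move=> s0.
have h1 : is_derive x 1 (fun x : R => - (x ^+ 2 / (2 * s ^+ 2))) (- (x / s ^+ 2)).
  have h2 := is_deriveZ (- (2 * s ^+ 2)^-1) (is_deriveM (is_derive_id x (1 : R)) (is_derive_id x (1 : R))).
  rewrite (_ : (fun x : R => _) = (- (2 * s ^+ 2)^-1) \*: (id * id)).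
    by apply: (is_derive_eq h2); rewrite /GRing.scale /=; field; rewrite gt_eqF.
  apply/funext => y; rewrite -[RHS]/(- (2 * s ^+ 2)^-1 * (y * y)).
  by rewrite mulNr mulrC expr2.
have := is_derive_compR h1 (is_derive_expR _).
by move=> h; apply: (is_derive_eq h); rewrite mulrC.
Qed.

Lemma measurable_gauss s : measurable_fun setT (gauss s).
Proof.
apply: measurableT_comp => //; apply: measurableT_comp => //.
by apply: measurable_funM => //; exact: measurable_funX.
Qed.

Definition gaussw s (x p : R) : R[i] := (gauss s p)%:C * expi (- (x * p)).

Lemma cmeas_gaussw s x : cmeas (gaussw s x).
Proof.
apply: cmeasM; first by apply: cmeasC; exact: measurable_gauss.
by apply: cmeas_expi; apply: measurableT_comp => //; exact: measurable_funM.
Qed.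

Lemma normc_gaussw s x p : normc (gaussw s x p) = gauss s p.
Proof. by rewrite /gaussw normcM normc_expi mulr1 normc_real ger0_norm// gauss_ge0. Qed.

Lemma cintegrable_gaussw s x : 0 < s -> cintegrable leb setT (gaussw s x).
Proof.
move=> s0; apply: (cintegrable_le _ (integrable_gauss s0)) => [|p].
  exact: cmeas_gaussw.
by rewrite normc_gaussw.
Qed.

Lemma integrable_oneDsqrVZ (C : R) :
  leb.-integrable setT (EFin \o (fun x : R => C * (1 + x ^+ 2)^-1)).
Proof.
rewrite (_ : _ \o _ = fun x => (C%:E * ((1 + x ^+ 2)^-1)%:E)%E)//.
by apply: integrableZl => //; exact: integrable_oneDsqrV.
Qed.

Lemma normc_id_gaussw s x p : 0 < s ->
  normc (p%:C * gaussw s x p) <= (1 + 4 * s ^+ 2) ^+ 2 * (1 + p ^+ 2)^-1.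
Proof.
move=> s0; apply: le_trans (gauss_le p s0).
rewrite normcM normc_real normc_gaussw ler_wpM2r ?gauss_ge0//.
by rewrite -[p ^+ 2]real_normK ?num_real//; nra.
Qed.

Lemma cintegrable_id_gaussw s x : 0 < s ->
  cintegrable leb setT (fun p => p%:C * gaussw s x p).
Proof.
move=> s0; apply: (cintegrable_le _ (integrable_oneDsqrVZ ((1 + 4 * s ^+ 2) ^+ 2))).
  by apply: cmeasM; [exact: cmeasC|exact: cmeas_gaussw].
by move=> p; exact: normc_id_gaussw.
Qed.

Lemma is_cderive_gaussw s x (p : R) : 0 < s ->
  is_cderive p 1 (gaussw s x)
   ((- (p / s ^+ 2))%:C * gaussw s x p + (0 +i* (- x)) * gaussw s x p).
Proof.
move=> s0; have h1 := is_cderiveC (is_derive_gauss p s0).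
have h2 : is_derive p 1 (fun p : R => - (x * p)) (- x).
  have h := is_deriveZ (- x) (is_derive_id p (1 : R)).
  rewrite (_ : (fun p : R => _) = (- x) \*: id).
    by apply: (is_derive_eq h); rewrite /GRing.scale /= mulr1.
  by apply/funext => y; rewrite -[RHS]/(- x * y) mulNr.
apply: is_cderive_eq (is_cderiveM h1 (is_cderive_expi h2)) _.
by rewrite /gaussw rmorphM /=; ring.
Qed.

(* Integrating [(gauss e^{-ixp})'] over the line. *)
Lemma cintegral_id_gaussw s x : 0 < s ->
  cintegral leb setT (fun p => p%:C * gaussw s x p) =
  (0 +i* (- (x * s ^+ 2))) * cintegral leb setT (gaussw s x).
Proof.
move=> s0.
pose a : R[i] := (- (s ^+ 2)^-1)%:C; pose b : R[i] := 0 +i* (- x).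
pose v p := a * (p%:C * gaussw s x p) + b * gaussw s x p.
have iv1 := cintegrable_id_gaussw x s0; have iv2 := cintegrable_gaussw x s0.
have iv : cintegrable leb setT v by apply: cintegrableD; exact: cintegrableZ.
have du (p : R) : is_cderive p 1 (gaussw s x) (v p).
  apply: is_cderive_eq (is_cderive_gaussw x p s0) _.
  rewrite /v /a mulrA; congr (_ * _ + _).
  by rewrite -rmorphM /= mulNr mulrC.
have dv (p : R) : is_cderive p 1 v (a * (p%:C * v p + 1%:C * gaussw s x p) + b * v p).
  apply: is_cderiveD; apply: is_cderiveZ; last exact: du.
  by apply: is_cderiveM; [apply: is_cderiveC; exact: is_derive_id|exact: du].
have [c1 c2] := cderive_continuous dv.
have bu t : `|t| * normc (gaussw s x t) <= (1 + 4 * s ^+ 2) ^+ 2.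
  rewrite -normc_real -normcM (le_trans (normc_id_gaussw x t s0))//.
  by rewrite ler_piMr ?sqr_ge0// invf_le1 ?lerDl ?sqr_ge0// ltr_wpDr// sqr_ge0.
have : cintegral leb setT v = 0.
  apply: complexP => /=.
    apply: (@integral_derive0_R _ (fun p => Re (gaussw s x p))) => //.
    - by case: iv.
    - by move=> p; case: (du p).
    - by eexists => t; apply: le_trans (bu t); rewrite ler_wpM2l// Re_le_normc.
  apply: (@integral_derive0_R _ (fun p => Im (gaussw s x p))) => //.
  - by case: iv.
  - by move=> p; case: (du p).
  - by eexists => t; apply: le_trans (bu t); rewrite ler_wpM2l// Im_le_normc.
rewrite cintegralD ?cintegralZ//; try exact: cintegrableZ.
move/eqP; rewrite addr_eq0 => /eqP e.
have a0 : a * (- (s ^+ 2))%:C = 1.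
  by rewrite /a -rmorphM /= mulrNN mulVf// gt_eqF// exprn_gt0.
rewrite -[LHS]mul1r -a0 mulrAC e mulNr mulrAC -mulNr; congr (_ * _).
by apply: complexP; rewrite /b !(ReM, ImM, ReN, ImN) /=; ring.
Qed.

Lemma is_cderive_gauss_transform s (x : R) : 0 < s ->
  is_cderive x 1 (fun x => cintegral leb setT (gaussw s x))
    ((- (x * s ^+ 2))%:C * cintegral leb setT (gaussw s x)).
Proof.
move=> s0.
have D : is_cderive (0 : R) 1 (fun t => cintegral leb setT (gaussw s (x + t)))
    (cintegral leb setT (fun p => (0 +i* (- p)) * gaussw s (x + 0) p)).
  apply: (@is_cderive_under_integral R _ _ leb (fun t => gaussw s (x + t))
    (fun t p => (0 +i* (- p)) * gaussw s (x + t) p)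
    (fun p => (1 + 4 * s ^+ 2) ^+ 2 * (1 + p ^+ 2)^-1)).
  - by move=> t; exact: cintegrable_gaussw.
  - move=> t p; have h2 : is_derive t 1 (fun t : R => - ((x + t) * p)) (- p).
      have h := is_deriveD (is_derive_cst (- (x * p)) t (1 : R)) (is_deriveZ (- p) (is_derive_id t (1 : R))).
      rewrite (_ : (fun p : R => _) = cst (- (x * p)) + (- p) \*: id).
        by apply: (is_derive_eq h); rewrite add0r /GRing.scale /= mulr1.
      by apply/funext => y; rewrite -[RHS]/(- (x * p) + - p * y); ring.
    apply: is_cderive_eq (is_cderiveZ (gauss s p)%:C (is_cderive_expi h2)) _.
    by rewrite mulrCA.
  - exact: integrable_oneDsqrVZ.
  - move=> t p; apply: le_trans (normc_id_gaussw (x + t) p s0).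
    by rewrite normcM [leRHS]normcM normc_imag normc_real normrN lexx.
have -> : (- (x * s ^+ 2))%:C * cintegral leb setT (gaussw s x) =
    cintegral leb setT (fun p => (0 +i* (- p)) * gaussw s (x + 0) p).
  transitivity ((0 +i* (-1)) * cintegral leb setT (fun p => p%:C * gaussw s x p)).
    rewrite cintegral_id_gaussw// mulrA; congr (_ * _).
    by apply: complexP; rewrite !(ReM, ImM) /=; ring.
  rewrite -cintegralZ; last exact: cintegrable_id_gaussw.
  apply: eq_cintegral => p; rewrite addr0 mulrA; congr (_ * _).
  by apply: complexP; rewrite !(ReM, ImM) /=; ring.
by apply: is_cderive_line D => h; rewrite addr0 [h *: 1]mulr1 [x + _]addrC.
Qed.

(** The transform G satisfies G' = -s^2 x G: its derivative is a first moment, which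
    [cintegral_id_gaussw] expresses through G again. Hence G times e^(s^2 x^2 / 2) is constant, and
    its value at 0 is the mass of the Gaussian. *)
Lemma gauss_transform s x : 0 < s ->
  cintegral leb setT (gaussw s x) = (gauss_mass s * gauss s^-1 x)%:C.
Proof.
move=> s0; pose G x := cintegral leb setT (gaussw s x).
pose E (x : R) := expR (x ^+ 2 / (2 * s^-1 ^+ 2)).
have dE (y : R) : is_derive y 1 E (y * s ^+ 2 * E y).
  have h1 : is_derive y 1 (fun x : R => x ^+ 2 / (2 * s^-1 ^+ 2)) (y * s ^+ 2).
    have h2 := is_deriveZ ((2 * s^-1 ^+ 2)^-1) (is_deriveM (is_derive_id y (1 : R)) (is_derive_id y (1 : R))).
    rewrite (_ : (fun x : R => _) = ((2 * s^-1 ^+ 2)^-1) \*: (id * id)).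
      by apply: (is_derive_eq h2); rewrite /GRing.scale /= exprVn; field; rewrite gt_eqF.
    by apply/funext => z; rewrite -[RHS]/((2 * s^-1 ^+ 2)^-1 * (z * z)) mulrC expr2.
  by apply: (is_derive_eq (is_derive_compR h1 (is_derive_expR _))); rewrite mulrC.
have dGE (y : R) : is_cderive y 1 (fun y => G y * (E y)%:C) 0.
  apply: is_cderive_eq (is_cderiveM (is_cderive_gauss_transform y s0) (is_cderiveC (dE y))) _.
  by rewrite -/(G y) !rmorphM rmorphN /= rmorphM /=; ring.
have cst y : G y * (E y)%:C = G 0 * (E 0)%:C.
  apply: complexP.
    by apply: (@is_derive_0_is_cst _ (fun y => Re (G y * (E y)%:C))) => z; case: (dGE z).
  by apply: (@is_derive_0_is_cst _ (fun y => Im (G y * (E y)%:C))) => z; case: (dGE z).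
have G0 : G 0 = (gauss_mass s)%:C.
  have gE p : gaussw s 0 p = (gauss s p)%:C.
    by rewrite /gaussw mul0r oppr0 expi0 mulr1.
  rewrite /G (funext gE) -integral_gauss//; apply: complexP => //=.
  by rewrite /Rintegral integral0.
have := cst x; rewrite {2}/E expr0n /= mul0r expR0 mulr1 G0 => e.
rewrite -/(G x) rmorphM /= -e -mulrA -rmorphM /= /E /gauss -expRD subrr expR0.
by rewrite mulr1.
Qed.

End gaussian.

(** * Fourier inversion at the origin *)

Section inversion.
Context {R : realType}.
Local Notation leb := (@lebesgue_measure R).

Lemma cintegralC d (T : measurableType d) (mu : {measure set T -> \bar R}) (h : T -> R) :
  cintegral mu setT (fun x => (h x)%:C) = (\int[mu]_x h x)%:C.
Proof. by apply: complexP => //=; rewrite /Rintegral integral0. Qed.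

Lemma cintegrableC d (T : measurableType d) (mu : {measure set T -> \bar R}) (h : T -> R) :
  mu.-integrable setT (EFin \o h) -> cintegrable mu setT (fun x => (h x)%:C).
Proof. by move=> ih; split => //=; exact: integrable0. Qed.

Lemma Rintegral_prod d (g : 'I_d -> R -> R) :
  (forall i, leb.-integrable setT (EFin \o g i)) ->
  \int[lebesgue_rV d]_x (\prod_(i < d) g i (x 0 i)) = \prod_(i < d) \int[leb]_x g i x.
Proof.
move=> ig.
have [_] := @cintegral_prod R d (fun i x => (g i x)%:C) (fun i => cintegrableC (ig i)).
under eq_cintegral do rewrite -rmorph_prod /=.
under eq_bigr do rewrite cintegralC.
by rewrite cintegralC -rmorph_prod /= => -[].
Qed.

Lemma expi_sum I (r : seq I) (h : I -> R) :
  expi (\sum_(i <- r) h i) = \prod_(i <- r) expi (h i).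
Proof.
elim: r => [|i r IH]; first by rewrite !big_nil expi0.
by rewrite !big_cons expiD IH.
Qed.

(** The Fourier integral of the Gaussian of width s: a Gaussian of width 1/s and mass 2 pi, hence an
    approximate identity as s grows. *)
Definition gauss_kernel (s x : R) : R := gauss_mass s * gauss s^-1 x.

Lemma gauss_kernel_ge0 s x : 0 <= gauss_kernel s x.
Proof. by rewrite mulr_ge0 ?sqrtr_ge0 ?gauss_ge0. Qed.

Lemma integrable_gauss_kernel s : 0 < s -> leb.-integrable setT (EFin \o gauss_kernel s).
Proof.
move=> s0; rewrite (_ : _ \o _ = fun x => ((gauss_mass s)%:E * (gauss s^-1 x)%:E)%E)//.
by apply: integrableZl => //; apply: integrable_gauss; rewrite invr_gt0.
Qed.

Lemma integral_gauss_kernel s : 0 < s -> \int[leb]_x gauss_kernel s x = 2 * pi.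
Proof.
move=> s0; have s0' : 0 < s^-1 by rewrite invr_gt0.
rewrite RintegralZl//; last exact: integrable_gauss.
by rewrite integral_gauss// gauss_massM.
Qed.

Lemma integrable_sqr_gauss s : 0 < s ->
  leb.-integrable setT (EFin \o (fun x => x ^+ 2 * gauss s x)).
Proof.
move=> s0; apply: (le_integrable _ _ _ (integrable_oneDsqrVZ ((1 + 4 * s ^+ 2) ^+ 2))) => //.
  by apply/measurable_EFinP; apply: measurable_funM; [exact: measurable_funX|exact: measurable_gauss].
move=> x _; rewrite /= lee_fin ger0_norm; last by apply: mulr_ge0; [exact: sqr_ge0|exact: gauss_ge0].
rewrite (le_trans _ (ler_norm _))// (le_trans _ (gauss_le x s0))//.
by rewrite ler_wpM2r ?gauss_ge0// lerDr.
Qed.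

(** The derivative of x times the Gaussian is the Gaussian minus s^-2 x^2 times it, and this
    derivative integrates to 0. *)
Lemma integral_sqr_gauss s : 0 < s ->
  \int[leb]_x (x ^+ 2 * gauss s x) = s ^+ 2 * gauss_mass s.
Proof.
move=> s0; have s20 : 0 < s ^+ 2 by rewrite exprn_gt0.
have i1 := integrable_gauss s0; have i2 := integrable_sqr_gauss s0.
pose v x := gauss s x - (s ^+ 2)^-1 * (x ^+ 2 * gauss s x).
have i3 : leb.-integrable setT (EFin \o (fun x => (s ^+ 2)^-1 * (x ^+ 2 * gauss s x))).
  rewrite (_ : _ \o _ = fun x => (((s ^+ 2)^-1)%:E * (x ^+ 2 * gauss s x)%:E)%E)//.
  exact: integrableZl.
have iv : leb.-integrable setT (EFin \o v).
  rewrite (_ : _ \o _ = fun x => ((gauss s x)%:E - ((s ^+ 2)^-1 * (x ^+ 2 * gauss s x))%:E)%E)//.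
  exact: integrableB.
have dg (x : R) := is_derive_gauss x s0.
have du (x : R) : is_derive x 1 (fun x => x * gauss s x) (v x).
  apply: (is_derive_eq (is_deriveM (is_derive_id x (1 : R)) (dg x))).
  by rewrite /GRing.scale /= /v; field; rewrite gt_eqF.
have cg : continuous (gauss s).
  move=> x; apply: differentiable_continuous; apply/derivable1_diffP.
  by case: (dg x).
have cv : continuous v.
  have c2 : continuous (fun x : R => x ^+ 2) by exact: exprn_continuous.
  move=> x; apply: cvgB; first exact: cg.
  by apply: cvgMl_tmp; apply: cvgM; [exact: c2|exact: cg].
have := integral_derive0_R iv du cv.
have bu : exists C, forall t : R, `|t| * `|t * gauss s t| <= C.
  exists ((1 + 4 * s ^+ 2) ^+ 2) => t.
  rewrite normrM mulrA -normrM -expr2 ger0_norm ?sqr_ge0// ger0_norm ?gauss_ge0//.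
  apply: (@le_trans _ _ ((1 + t ^+ 2) * gauss s t)).
    by rewrite ler_wpM2r ?gauss_ge0// lerDr.
  rewrite (le_trans (gauss_le t s0))// ler_piMr ?sqr_ge0// invf_le1 ?lerDl ?sqr_ge0//.
  by rewrite ltr_wpDr// sqr_ge0.
move=> /(_ bu).
rewrite /v RintegralB// RintegralZl// integral_gauss// => /eqP.
by rewrite subr_eq0 => /eqP ->; rewrite mulrA divff ?mul1r// gt_eqF.
Qed.

Lemma integrable_sqr_gauss_kernel s : 0 < s ->
  leb.-integrable setT (EFin \o (fun x => x ^+ 2 * gauss_kernel s x)).
Proof.
move=> s0.
rewrite (_ : _ \o _ = fun x => ((gauss_mass s)%:E * (x ^+ 2 * gauss s^-1 x)%:E)%E).
  by apply: integrableZl => //; apply: integrable_sqr_gauss; rewrite invr_gt0.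
by apply/funext => x; rewrite /= /gauss_kernel mulrCA.
Qed.

Lemma integral_sqr_gauss_kernel s : 0 < s ->
  \int[leb]_x (x ^+ 2 * gauss_kernel s x) = s ^- 2 * (2 * pi).
Proof.
move=> s0; have s0' : 0 < s^-1 by rewrite invr_gt0.
under eq_Rintegral do rewrite /gauss_kernel mulrCA.
rewrite RintegralZl//; last exact: integrable_sqr_gauss.
by rewrite integral_sqr_gauss// mulrCA gauss_massM// exprVn.
Qed.

Context {d : nat}.
Local Notation lebd := (@lebesgue_rV R d).
Local Notation wave x p := (expi (- dotv x p)).
Implicit Types (x p : 'rV[R]_d).

Definition gaussd s p : R := \prod_(i < d) gauss s (p 0 i).
Definition kerneld s x : R := \prod_(i < d) gauss_kernel s (x 0 i).

Lemma gaussd_ge0 s p : 0 <= gaussd s p.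
Proof. by apply: prodr_ge0 => i _; exact: gauss_ge0. Qed.

Lemma gaussd_le1 s p : gaussd s p <= 1.
Proof.
by apply: prodr_ile1 => i _; rewrite gauss_ge0 gauss_le1.
Qed.

Lemma kerneld_ge0 s x : 0 <= kerneld s x.
Proof. by apply: prodr_ge0 => i _; exact: gauss_kernel_ge0. Qed.

Lemma integrable_gaussd s : 0 < s -> lebd.-integrable setT (EFin \o gaussd s).
Proof. by move=> s0; apply: (@integrable_prod R d (fun=> gauss s)) => i; exact: integrable_gauss. Qed.

Lemma integrable_kerneld s : 0 < s -> lebd.-integrable setT (EFin \o kerneld s).
Proof.
by move=> s0; apply: (@integrable_prod R d (fun=> gauss_kernel s)) => i;
  exact: integrable_gauss_kernel.
Qed.

Lemma gaussd_transform s x : 0 < s ->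
  cintegral lebd setT (fun p => (gaussd s p)%:C * wave x p) = (kerneld s x)%:C.
Proof.
move=> s0; have [_] := @cintegral_prod R d (fun i => gaussw s (x 0 i))
  (fun i => cintegrable_gaussw (x 0 i) s0).
under eq_bigr do rewrite gauss_transform// -/(gauss_kernel s _).
rewrite -rmorph_prod /= => <-; apply: eq_cintegral => p.
rewrite /gaussw big_split /= -expi_sum -rmorph_prod /= /gaussd; congr (_ * expi _).
by rewrite /dotv sumrN.
Qed.

Lemma integral_kerneld s : 0 < s -> \int[lebd]_x kerneld s x = (2 * pi) ^+ d.
Proof.
move=> s0; rewrite (@Rintegral_prod d (fun=> gauss_kernel s)) => [|i]; last first.
  exact: integrable_gauss_kernel.
by under eq_bigr do rewrite integral_gauss_kernel//; rewrite prodr_const card_ord.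
Qed.

Let kj s (j i : 'I_d) (x : R) := if i == j then x ^+ 2 * gauss_kernel s x else gauss_kernel s x.

Let kjE s j x : x 0 j ^+ 2 * kerneld s x = \prod_(i < d) kj s j i (x 0 i).
Proof.
rewrite /kerneld (bigD1 j) //= [RHS](bigD1 j) //= {1}/kj eqxx mulrA; congr (_ * _).
by apply: eq_bigr => i ij; rewrite /kj (negbTE ij).
Qed.

Let ikj s (j i : 'I_d) : 0 < s -> leb.-integrable setT (EFin \o kj s j i).
Proof.
move=> s0; rewrite /kj; have [ij|ij] := eqVneq i j.
  exact: integrable_sqr_gauss_kernel.
exact: integrable_gauss_kernel.
Qed.

Lemma integrable_sqr_kerneld s j : 0 < s ->
  lebd.-integrable setT (EFin \o (fun x => x 0 j ^+ 2 * kerneld s x)).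
Proof.
move=> s0; rewrite (funext (kjE s j)); apply: integrable_prod => i; exact: ikj.
Qed.

Lemma integral_sqr_kerneld s j : 0 < s ->
  \int[lebd]_x (x 0 j ^+ 2 * kerneld s x) = s ^- 2 * (2 * pi) ^+ d.
Proof.
move=> s0; rewrite (funext (kjE s j)) Rintegral_prod => [|i]; last exact: ikj.
rewrite (bigD1 j) //= /kj eqxx integral_sqr_gauss_kernel// -mulrA; congr (_ * _).
rewrite (eq_bigr (fun=> 2 * pi)) => [|i ij]; last first.
  by rewrite (negbTE ij) integral_gauss_kernel.
by rewrite -[in RHS](card_ord d) -[in RHS]prodr_const [RHS](bigD1 j).
Qed.

(** Continuity near 0 and boundedness away from 0 combine into |f(x) - f(0)| <= eta + M |x|^2 for
    all x. The domain need not be split: the mass of the kernel is fixed, and its second moments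
    decay like s^-2. *)
Lemma cvg_approx_identity (f : 'rV[R]_d -> R[i]) (B : R) : ccontinuous f ->
  cmeas f -> (forall x, normc (f x) <= B) -> forall e, 0 < e ->
  \forall k \near \oo, normc (cintegral lebd setT
    (fun x => f x * (kerneld k.+1%:R x)%:C) - f 0 * ((2 * pi) ^+ d)%:C) <= e.
Proof.
move=> [cf1 cf2] mf fB e e0; pose P : R := (2 * pi) ^+ d.
have P0 : 0 < P by rewrite exprn_gt0// mulr_gt0// pi_gt0.
have B0 : 0 <= B by rewrite (le_trans _ (fB 0))// normc_ge0.
(* So that eta times the mass P, doubled by [normc_cintegral_le], is e/2. *)
pose eta := e / (4 * P).
have eta0 : 0 < eta by rewrite divr_gt0// mulr_gt0.
have [M [M0 fM]] : exists M, 0 <= M /\ forall x,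
    normc (f x - f 0) <= eta + M * \sum_j x 0 j ^+ 2.
  have e20 : 0 < eta / 2 by rewrite divr_gt0.
  have /cvgrPdist_lt/(_ _ e20)/nbhs_ballP[d1 /= d10 h1] := cf1 0.
  have /cvgrPdist_lt/(_ _ e20)/nbhs_ballP[d2 /= d20 h2] := cf2 0.
  pose dl := Num.min d1 d2; have dl0 : 0 < dl by rewrite lt_min d10.
  (* If some |x_j| >= dl, then |f(x) - f(0)| <= 2 B <= (2 B / dl^2) x_j^2. *)
  exists (2 * B / dl ^+ 2); split.
    by rewrite divr_ge0 ?sqr_ge0// mulr_ge0.
  move=> x; have s0 : 0 <= \sum_j x 0 j ^+ 2 by apply: sumr_ge0 => j _; exact: sqr_ge0.
  have [/forallP xd|/forallPn[j xj]] := boolP [forall j : 'I_d, `|x 0 j| < dl].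
    have b (r : R) : (forall j : 'I_d, `|x 0 j| < r) -> 0 < r -> ball (0 : 'rV[R]_d) r x.
      move=> xr r0; split => // i j; rewrite ord1 /ball /= mxE sub0r normrN; exact: xr.
    apply: (@le_trans _ _ eta); last by rewrite lerDl mulr_ge0// divr_ge0 ?sqr_ge0// mulr_ge0.
    rewrite (le_trans (normc_le_ReIm _))// ReD ImD ReN ImN.
    have k1 : `|Re (f 0) - Re (f x)| < eta / 2.
      by apply: h1; apply: b => // j; rewrite (lt_le_trans (xd j))// ge_min lexx.
    have k2 : `|Im (f 0) - Im (f x)| < eta / 2.
      by apply: h2; apply: b => // j; rewrite (lt_le_trans (xd j))// ge_min lexx orbT.
    rewrite [leRHS](splitr eta) -normrN -[X in _ + X]normrN !opprB.
    exact: lerD (ltW k1) (ltW k2).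
  rewrite -leNgt in xj.
  apply: (@le_trans _ _ (2 * B)).
    by rewrite (le_trans (normcD _ _))// normcN mulr_natl mulr2n lerD.
  rewrite -[leLHS]add0r; apply: lerD; first exact: ltW.
  rewrite mulrAC ler_pdivlMr ?exprn_gt0//; apply: ler_wpM2l; first exact: mulr_ge0.
  rewrite (bigD1 j) //= -[x 0 j ^+ 2]real_normK ?num_real//.
  rewrite -[leLHS]addr0 lerD ?sumr_ge0//; last by move=> *; exact: sqr_ge0.
  by rewrite ler_pXn2r// nnegrE ltW.
have key (s : R) : 0 < s -> normc (cintegral lebd setT
    (fun x => f x * (kerneld s x)%:C) - f 0 * P%:C) <=
    2 * (eta * P + M * (d%:R * (s ^- 2 * P))).
  move=> s0; have ik := integrable_kerneld s0.
  have mk : cmeas (fun x => (kerneld s x)%:C) by apply: cmeasC; exact: integrable_measurable ik.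
  have ifk : cintegrable lebd setT (fun x => f x * (kerneld s x)%:C).
    apply: (@cintegrable_le _ _ _ _ _ (fun x => B * kerneld s x)).
    - exact: cmeasM.
    - rewrite (_ : _ \o _ = fun x => (B%:E * (kerneld s x)%:E)%E)//.
      exact: integrableZl.
    - by move=> x; rewrite normcM normc_real ger0_norm ?kerneld_ge0// ler_wpM2r// kerneld_ge0.
  have i0 := cintegrableZ (f 0) (cintegrableC ik).
  have -> : cintegral lebd setT (fun x => f x * (kerneld s x)%:C) - f 0 * P%:C =
      cintegral lebd setT (fun x => (f x - f 0) * (kerneld s x)%:C).
    rewrite /P -(integral_kerneld s0) -cintegralC -cintegralZ; last exact: cintegrableC.
    rewrite -[in LHS]mulN1r -cintegralZ// -cintegralD//; last exact: cintegrableZ.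
    by apply: eq_cintegral => x; rewrite mulN1r mulrBl.
  have iS : lebd.-integrable setT (EFin \o (fun x => \sum_j (x 0 j ^+ 2 * kerneld s x))).
    rewrite (_ : _ \o _ = fun x => (\sum_j (x 0 j ^+ 2 * kerneld s x)%:E)%E).
      by apply: integrable_sum => // j _; exact: integrable_sqr_kerneld.
    by apply/funext => x; rewrite /= sumEFin.
  have iZ (h : 'rV[R]_d -> R) c : lebd.-integrable setT (EFin \o h) ->
      lebd.-integrable setT (EFin \o (fun x => c * h x)).
    move=> ih; rewrite (_ : _ \o _ = fun x => (c%:E * (h x)%:E)%E)//.
    exact: integrableZl.
  have iD : lebd.-integrable setT (EFin \o (fun x => eta * kerneld s x +
      M * \sum_j (x 0 j ^+ 2 * kerneld s x))).
    rewrite (_ : _ \o _ = fun x => ((eta * kerneld s x)%:E +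
      (M * \sum_j (x 0 j ^+ 2 * kerneld s x))%:E)%E)//.
    by apply: integrableD => //; exact: iZ.
  have -> : eta * P + M * (d%:R * (s ^- 2 * P)) =
      \int[lebd]_x (eta * kerneld s x + M * \sum_j (x 0 j ^+ 2 * kerneld s x)).
    rewrite RintegralD//; [|exact: iZ|exact: iZ].
    rewrite !RintegralZl// integral_kerneld//; congr (_ + _ * _).
    transitivity (\sum_(j < d) \int[lebd]_x (x 0 j ^+ 2 * kerneld s x)).
      by under eq_bigr do rewrite integral_sqr_kerneld//; rewrite sumr_const card_ord mulr_natl.
    have h : cintegral lebd setT (fun x => \sum_j (x 0 j ^+ 2 * kerneld s x)%:C) =
        \sum_j cintegral lebd setT (fun x => (x 0 j ^+ 2 * kerneld s x)%:C).
      by apply: cintegral_sum => j; apply: cintegrableC; exact: integrable_sqr_kerneld.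
    move: h; under eq_cintegral do rewrite -rmorph_sum /=.
    by under eq_bigr do rewrite cintegralC; rewrite cintegralC -rmorph_sum /= => -[].
  apply: normc_cintegral_le => //.
    apply: cintegrable_le iD _; first by apply: cmeasM => //; apply: cmeasD => //; exact: cmeas_cst.
    move=> x; rewrite normcM normc_real ger0_norm ?kerneld_ge0//.
    rewrite -big_distrl /= mulrA -mulrDl; apply: ler_wpM2r => //; exact: kerneld_ge0.
  move=> x; rewrite normcM normc_real ger0_norm ?kerneld_ge0//.
  rewrite -big_distrl /= mulrA -mulrDl; apply: ler_wpM2r => //; exact: kerneld_ge0.
have eP : 2 * (eta * P) = e / 2 by rewrite /eta; field; rewrite gt_eqF.
(* The second-moment term is Q / (2 (k+1)^2), which is at most e/2 once Q <= e (k+1). *)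
pose Q := 4 * (M * (d%:R * P)); have Q0 : 0 <= Q by rewrite !mulr_ge0// ltW.
near=> k; apply: le_trans (key _ (ltr0Sn _ k)) _; rewrite mulrDr eP.
rewrite [leRHS](splitr e) lerD2l.
have -> : 2 * (M * (d%:R * (k.+1%:R ^- 2 * P))) = Q / 2 / k.+1%:R ^+ 2.
  by rewrite /Q; field.
have k1 : Q <= e * k.+1%:R.
  rewrite mulrC -ler_pdivrMr//; apply: (@le_trans _ _ k%:R); last by rewrite ler_nat.
  by near: k; exact: nbhs_infty_ger.
have k2 : 1 <= k.+1%:R :> R by rewrite ler1n.
rewrite ler_pdivrMr; last by rewrite exprn_gt0// ltr0Sn.
set N := k.+1%:R in k1 k2 *.
have : e * N <= e * N ^+ 2 by apply: ler_wpM2l; [exact: ltW|rewrite expr2 ler_peMl// (le_trans ler01)].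
lra.
Unshelve. all: end_near. Qed.

Lemma cvg_scale (c l l' : R) (u v : nat -> R) : (forall k, v k = c * u k) ->
  l' = c * l -> u @ \oo --> l -> v @ \oo --> l'.
Proof. by move=> /funext -> -> ul; exact: cvgMl_tmp. Qed.

(** A wide Gaussian inserted in the frequency integral makes Fubini applicable and turns the
    integral into an average of [f] against an approximate identity. Letting the width grow gives
    the integral of the transform on one side and the value of [f] at the origin on the other. *)
Theorem fourier_inversion0 (f : 'rV[R]_d -> R[i]) : schwartz f ->
  ((2 * pi) `^ (- (d%:R / 2)))%:C * cintegral lebd setT (fourier f) = f 0.
Proof.
move=> sf; set K := (2 * pi) `^ (- (d%:R / 2)).
pose P : R := (2 * pi) ^+ d.
(* The two normalising factors, one of the transform and one of the inversion, cancel the mass (2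
   pi)^d of the kernel. *)
have KP : K * (K * P) = 1.
  have tp : 0 <= 2 * pi :> R by rewrite mulr_ge0// pi_ge0.
  have tp0 : 0 < 2 * pi :> R by rewrite mulr_gt0// pi_gt0.
  rewrite /P -powR_mulrn// /K -!powRD; last 2 first.
  - by rewrite (gt_eqF tp0) implybT.
  - by rewrite (gt_eqF tp0) implybT.
  by rewrite (_ : _ + _ = 0) ?powRr0//; field.
have [CF hF] : exists C, forall p, normc (fourier f p) <= C * weight p.
  by eexists => p; exact: fourier_weight.
have mF := cmeas_fourier sf.
pose g (k : nat) p := fourier f p * (gaussd k.+1%:R p)%:C.
have mg k : cmeas (fun p => (gaussd k.+1%:R p)%:C).
  by apply: cmeasC; apply: integrable_measurable (integrable_gaussd _); exact: ltr0Sn.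
have gc p : (fun k : nat => gaussd k.+1%:R p) @ \oo --> (1 : R).
  have g1 i : gauss k.+1%:R (p 0 i) @[k --> \oo] --> (1 : R).
    rewrite (_ : (fun k : nat => gauss k.+1%:R (p 0 i)) =
        expR \o (fun k : nat => - (p 0 i ^+ 2 / 2 * (k.+1%:R^-1 * k.+1%:R^-1)))).
      have : expR (- (p 0 i ^+ 2 / 2 * (k.+1%:R^-1 * k.+1%:R^-1))) @[k --> \oo] -->
          expR (- (p 0 i ^+ 2 / 2 * (0 * 0))).
        apply: continuous_cvg; first exact: continuous_expR.
        by apply: cvgN; apply: cvgMl_tmp; apply: cvgM; exact: cvg_harmonic.
      by rewrite mul0r mulr0 oppr0 expR0.
    by apply/funext => k; rewrite /gauss /= invfM mulrA expr2 invfM.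
  rewrite /gaussd; elim: (index_enum _) => [|i r IH].
    by under eq_fun do rewrite big_nil; exact: cvg_cst.
  rewrite (_ : (fun k : nat => _) =
      fun k : nat => gauss k.+1%:R (p 0 i) * \prod_(j <- r) gauss k.+1%:R (p 0 j)).
    have : gauss k.+1%:R (p 0 i) * \prod_(j <- r) gauss k.+1%:R (p 0 j)
        @[k --> \oo] --> (1 * 1 : R) by apply: cvgM; [exact: g1|exact: IH].
    by rewrite mulr1.
  by apply/funext => k; rewrite big_cons.
have [c1 c2] : ((fun k => Re (cintegral lebd setT (g k))) @ \oo --> Re (cintegral lebd setT (fourier f))) /\
    ((fun k => Im (cintegral lebd setT (g k))) @ \oo --> Im (cintegral lebd setT (fourier f))).
  apply: (@dominated_cintegral _ _ _ _ g _ (fun p => CF * weight p)) => //.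
  - by move=> k; exact: cmeasM.
  - exact: integrable_weightZ.
  - move=> k p; rewrite normcM normc_real ger0_norm ?gaussd_ge0//.
    rewrite (le_trans _ (hF p))// ler_piMr ?normc_ge0//; exact: gaussd_le1.
  - move=> p; apply: (@cvg_scale (Re (fourier f p)) 1) (gc p); last by rewrite mulr1.
    by move=> k; rewrite /g ReM [Im _%:C]/= mulr0 subr0.
  - move=> p; apply: (@cvg_scale (Im (fourier f p)) 1) (gc p); last by rewrite mulr1.
    by move=> k; rewrite /g ImM [Im _%:C]/= mulr0 add0r.
pose h (k : nat) := cintegral lebd setT (fun x => f x * (kerneld k.+1%:R x)%:C).
(* Fubini moves the transform from [f] to the Gaussian. *)
have gh k : cintegral lebd setT (g k) = K%:C * h k.
  have k0 : 0 < k.+1%:R :> R by exact: ltr0Sn.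
  pose H (z : 'rV[R]_d * 'rV[R]_d) := f z.1 * wave z.1 z.2 * (gaussd k.+1%:R z.2)%:C.
  have ih : cintegrable (lebd \x lebd)%E setT H.
    apply: (cintegrable_le _ (integrable_prodM
      (cintegrable_normc (schwartz_cintegrable sf)) (integrable_gaussd k0))).
      apply: cmeasM; first apply: cmeasM.
      - exact: (cmeas_comp (csmooth_cmeas sf.1) measurable_fst).
      - by apply: cmeas_expi; apply: measurableT_comp => //; exact: measurable_dotv2.
      - exact: (cmeas_comp (mg k) measurable_snd).
    by move=> z; rewrite /H normcM normc_wave normc_real ger0_norm// gaussd_ge0.
  have := cFubini ih.
  have -> : cintegral lebd setT (fun x => cintegral lebd setT (fun p => H (x, p))) = h k.
    apply: eq_cintegral => x; rewrite -gaussd_transform// -cintegralZ; last first.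
      apply: cintegrable_le (integrable_gaussd k0) _.
        by apply: cmeasM => //; under eq_fun do rewrite dotvC; exact: cmeas_wave.
      by move=> p; rewrite normc_wave normc_real ger0_norm// gaussd_ge0.
    by apply: eq_cintegral => p; rewrite /H /= -mulrA [expi _ * _]mulrC.
  move=> ->; rewrite -cintegralZ; last first.
    exact: cintegrable_cintegral2 ih.
  apply: eq_cintegral => p; rewrite /g /fourier -/K -mulrA; congr (_ * _).
  by rewrite -cintegralZr//; exact: cintegrable_wave.
have [B hB] : exists B, forall x, normc (f x) <= B.
  have [_ /(_ [::] [::])[B hB]] := sf; exists B => x.
  by have := hB x; rewrite /monomial big_nil normr1 mul1r.
have H := cvg_approx_identity (sf.1 [::]).1 (csmooth_cmeas sf.1) hB.
have hRe : (fun k => Re (h k)) @ \oo --> Re (f 0 * P%:C).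
  apply/cvgrPdist_le => e e0; apply: filterS (H e e0) => k; apply: le_trans.
  by rewrite distrC -ReN -ReD; exact: Re_le_normc.
have hIm : (fun k => Im (h k)) @ \oo --> Im (f 0 * P%:C).
  apply/cvgrPdist_le => e e0; apply: filterS (H e e0) => k; apply: le_trans.
  by rewrite distrC -ImN -ImD; exact: Im_le_normc.
have -> : cintegral lebd setT (fourier f) = K%:C * (f 0 * P%:C).
  apply: complexP.
    have := @cvg_scale K (Re (f 0 * P%:C)) (Re (K%:C * (f 0 * P%:C)))
      (fun k => Re (h k)) (fun k => Re (cintegral lebd setT (g k))).
    move=> H1; apply: (cvg_unique _ c1); [exact: norm_hausdorff|apply: H1 => // [k|]].
      by rewrite gh ReM /= mul0r subr0.
    by rewrite ReM [Im _%:C]/= mul0r subr0.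
  have := @cvg_scale K (Im (f 0 * P%:C)) (Im (K%:C * (f 0 * P%:C)))
    (fun k => Im (h k)) (fun k => Im (cintegral lebd setT (g k))).
  move=> H1; apply: (cvg_unique _ c2); [exact: norm_hausdorff|apply: H1 => // [k|]].
    by rewrite gh ImM /= mul0r addr0.
  by rewrite ImM [Im K%:C]/= mul0r addr0.
rewrite [f 0 * _]mulrC !mulrA -!rmorphM /= -mulrA KP.
by rewrite mul1r.
Qed.

End inversion.
(** * Integrability of the inverse norm *)

Section inverse_norm.
Context {R : realType}.
Local Notation leb := (@lebesgue_measure R).

Definition invsqrt (x : R) : R := (Num.sqrt `|x|)^-1.

Lemma invsqrt_ge0 x : 0 <= invsqrt x. Proof. by rewrite invr_ge0 sqrtr_ge0. Qed.

(** Inversion is continuous off 0, and the remaining point is a measurable singleton. *)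
Lemma measurable_invr : measurable_fun setT (@GRing.inv R).
Proof.
have -> : [set: R] = [set x | x != 0] `|` [set 0].
  by apply/seteqP; split => // x _; have [->|x0] := eqVneq x 0; [right|left].
have oN : open [set x : R | x != 0].
  exact: open_neq.
apply/measurable_funU => //; first exact: open_measurable.
split; last exact: measurable_fun_set1.
apply: open_continuous_measurable_fun => // x /set_mem /= x0.
by apply: cvgV => //; exact: cvg_id.
Qed.

(** The function 2 atan (sqrt x) is a primitive, with values between 0 and pi. *)
Lemma integral_invsqrt_le (a b : R) : 0 < a -> a < b ->
  (\int[leb]_(x in `[a, b]) ((Num.sqrt x * (1 + x))^-1)%:E <= pi%:E)%E.
Proof.
move=> a0 ab; pose U (x : R) := 2 * atan (Num.sqrt x).
have dU (x : R) : 0 < x -> is_derive x 1 U (Num.sqrt x * (1 + x))^-1.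
  move=> x0; have h1 := is_derive_compR (is_derive1_sqrt x0) (is_derive1_atan (Num.sqrt x)).
  have h := is_deriveZ 2 h1.
  apply: (is_derive_eq h); rewrite /GRing.scale /= sqr_sqrtr ?ltW//.
  have n1 : Num.sqrt x != 0 by rewrite gt_eqF ?sqrtr_gt0.
  have n2 : 1 + x != 0 by rewrite gt_eqF// addr_gt0.
  by field; rewrite n1 n2.
rewrite (@continuous_FTC2 _ _ U)//.
- rewrite -EFinB lee_fin /U lerBlDr.
  have := @atan_ltpi2 _ (Num.sqrt b).
  have : 0 <= atan (Num.sqrt a) by rewrite -[leLHS]atan0; apply: le_atan; exact: sqrtr_ge0.
  lra.
- apply: continuous_in_subspaceT => x; rewrite inE /= in_itv /= => /andP[ax xb].
  have x0 : 0 < x by exact: lt_le_trans ax.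
  apply: cvgV; first by rewrite mulf_neq0// gt_eqF ?sqrtr_gt0// addr_gt0.
  by apply: cvgM; [exact: sqrt_continuous|apply: cvgD => //; exact: cvg_cst].
- have cU (x : R) : 0 < x -> {for x, continuous U}.
    move=> x0; apply: differentiable_continuous; apply/derivable1_diffP.
    by case: (dU _ x0).
  split => [x|| ].
  + rewrite in_itv /= => /andP[ax _]; by case: (dU x (lt_trans a0 ax)).
  + by apply: cvg_at_right_filter; exact: cU.
  + by apply: cvg_at_left_filter; apply: cU; exact: lt_trans ab.
- move=> x; rewrite in_itv /= => /andP[ax _]; rewrite derive1E.
  by case: (dU x (lt_trans a0 ax)).
Qed.

(** The one-dimensional majorant in each of the two coordinates of theta among which the singularity
    of |theta|^-1 is divided. *)
Definition singular (x : R) : R := invsqrt x * (1 + x ^+ 2)^-1.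

Lemma singular_ge0 x : 0 <= singular x.
Proof. by rewrite mulr_ge0 ?invsqrt_ge0// invr_ge0 addr_ge0// sqr_ge0. Qed.

Lemma measurable_invsqrt : measurable_fun setT invsqrt.
Proof.
apply: (measurableT_comp measurable_invr); apply: measurableT_comp => //.
by apply: continuous_measurable_fun; exact: sqrt_continuous.
Qed.

Lemma measurable_singular : measurable_fun setT singular.
Proof.
apply: measurable_funM; first exact: measurable_invsqrt.
exact: integrable_measurable integrable_oneDsqrV.
Qed.

(** Monotone convergence over compact intervals away from 0, on each of which [integral_invsqrt_le]
    gives the same bound. *)
Lemma integral_singular_pos :
  (\int[leb]_(x in `]0%R, +oo[) (singular x)%:E <= (2 * pi)%:E)%E.
Proof.
(* With k+2 the end points are distinct already for k = 0. *)
pose F (k : nat) : set R := `[k.+2%:R^-1, k.+2%:R]%classic.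
have -> : `]0%R, +oo[%classic = \bigcup_k F k.
  apply/seteqP; split => x /=; rewrite in_itv /= andbT.
    move=> x0; have [k kx] : exists k : nat, Num.max x x^-1 <= k.+2%:R.
      exists (Num.bound (Num.max x x^-1)); apply: ltW.
      rewrite (lt_le_trans (archi_boundP _)) ?ler_nat//.
        by rewrite le_max ltW.
      by rewrite -addn2 leq_addr.
    exists k => //; rewrite /F /= in_itv /=; move: kx; rewrite ge_max => /andP[-> ki].
    by rewrite andbT -[leRHS]invrK lef_pV2// ?posrE ?invr_gt0.
  by move=> [k _]; rewrite /F /= in_itv /= => /andP[+ _]; apply: lt_le_trans; rewrite invr_gt0.
have mE (A : set R) : measurable_fun A (fun x => (singular x)%:E).
  by apply: measurable_funTS; apply/measurable_EFinP; exact: measurable_singular.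
have mF k : measurable (F k) by exact: measurable_itv.
have ndF : nondecreasing_seq F.
  move=> m k mk; apply/subsetPset => x; rewrite /F /= !in_itv /= => /andP[a b].
  apply/andP; split; last by rewrite (le_trans b)// ler_nat.
  by rewrite (le_trans _ a)// lef_pV2 ?posrE// ler_nat.
have cv : (\int[leb]_(x in F i) (singular x)%:E)%E @[i --> \oo] -->
    (\int[leb]_(x in \bigcup_i F i) (singular x)%:E)%E.
  apply: ge0_nondecreasing_set_cvg_integral => // [i|i x _].
  - exact: mE.
  - by rewrite lee_fin singular_ge0.
rewrite -(cvg_lim _ cv)//; apply: lime_le; first by apply/cvg_ex; eexists; exact: cv.
apply: nearW => k.
have k0 : 0 < k.+2%:R^-1 :> R by rewrite invr_gt0.
have k1 : k.+2%:R^-1 < k.+2%:R :> R.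
  by rewrite (@lt_le_trans _ _ 1)// ?invf_lt1 ?ltr1n// ler1n.
(* The factor 2 comes from 1 + x <= 2 (1 + x^2). *)
apply: (@le_trans _ _ (\int[leb]_(x in F k) (2%:E * ((Num.sqrt x * (1 + x))^-1)%:E)))%E.
  apply: ge0_le_integral => //.
  - exact: mF.
  - by move=> x _; rewrite lee_fin singular_ge0.
  - exact: mE.
  - apply: measurable_funTS; apply/measurable_EFinP; apply: measurable_funM => //.
    apply: (measurableT_comp measurable_invr); apply: measurable_funM.
      by apply: continuous_measurable_fun; exact: sqrt_continuous.
    exact: measurable_funD.
  - move=> x; rewrite /F /= in_itv /= => /andP[kx _]; have x0 := lt_le_trans k0 kx.
    rewrite -EFinM lee_fin /singular /invsqrt gtr0_norm// invfM mulrCA ler_wpM2l ?invr_ge0 ?sqrtr_ge0//.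
    have a1 : 0 < 1 + x ^+ 2 by rewrite addr_gt0// exprn_gt0.
    have a2 : 0 < 1 + x by rewrite addr_gt0.
    rewrite ler_pdivlMr// mulrC ler_pdivrMr//; nra.
rewrite ge0_integralZl//; last 3 first.
- exact: mF.
- apply: measurable_funTS; apply/measurable_EFinP.
  apply: (measurableT_comp measurable_invr); apply: measurable_funM.
    by apply: continuous_measurable_fun; exact: sqrt_continuous.
  exact: measurable_funD.
- move=> x; rewrite /F /= in_itv /= => /andP[kx _]; have x0 := lt_le_trans k0 kx.
  by rewrite lee_fin invr_ge0 mulr_ge0 ?sqrtr_ge0// addr_ge0// ltW.
- by rewrite EFinM lee_wpmul2l//; exact: integral_invsqrt_le.
Qed.

Lemma integrable_singular : leb.-integrable setT (EFin \o singular).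
Proof.
have mE (A : set R) : measurable_fun A (fun x => (singular x)%:E).
  by apply: measurable_funTS; apply/measurable_EFinP; exact: measurable_singular.
have s0 (x : R) : (0 <= (singular x)%:E)%E by rewrite lee_fin singular_ge0.
have sN (x : R) : singular (- x) = singular x by rewrite /singular /invsqrt normrN sqrrN.
apply/integrableP; split; first exact: mE.
have -> : (\int[leb]_x `|(EFin \o singular) x| = \int[leb]_x (singular x)%:E)%E.
  by apply: eq_integral => x _; exact: (gee0_abs (s0 x)).
have -> : [set: R] = `]-oo, 0%R] `|` `]0%R, +oo[.
  apply/seteqP; split => // x _; case: (lerP x 0) => x0; [left|right].
    by rewrite /= in_itv.
  by rewrite /= in_itv /= x0.
have pos := integral_singular_pos.
rewrite ge0_integral_setU//; last first.
  rewrite disj_set2E; apply/eqP/seteqP; split => // x [] /=; rewrite !in_itv /= andbT.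
  by move=> /le_lt_trans h /h; rewrite ltxx.
  exact: mE.
apply: lte_add_pinfty; last by rewrite (le_lt_trans pos)// ltry.
have := @ge0_integration_by_substitution0 R (fun x => (singular x)%:E) (mE _) s0.
under [in RHS]eq_integral do rewrite sN.
move=> <-; rewrite -integral_itv_obnd_cbnd//.
by rewrite (le_lt_trans pos)// ltry.
Qed.

Section enorm_weight.
Context {m s : nat}.
Hypothesis s_gt1 : (1 < s)%N.
Implicit Types (p : 'rV[R]_(m + s)).

(** Equal to 0 at theta = 0, by the convention for the inverse of 0; [oscillation] then vanishes
    there, and bounds by [invr_norm] can be stated at every point. *)
Definition invr_norm p : R := (enorm (rsubmx p))^-1.

Lemma dotv_ge0 d (x : 'rV[R]_d) : 0 <= dotv x x.
Proof. by apply: sumr_ge0 => i _; rewrite -expr2 sqr_ge0. Qed.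

Lemma enorm_ge0 d (x : 'rV[R]_d) : 0 <= enorm x.
Proof. exact: sqrtr_ge0. Qed.

Lemma enorm_sqr d (x : 'rV[R]_d) : enorm x ^+ 2 = dotv x x.
Proof. by rewrite sqr_sqrtr// dotv_ge0. Qed.

Lemma coord_le_enorm d (x : 'rV[R]_d) k : `|x 0 k| <= enorm x.
Proof.
rewrite -sqrtr_sqr ler_wsqrtr// /dotv (bigD1 k) //= -expr2.
by rewrite lerDl; apply: sumr_ge0 => l _; rewrite -expr2 sqr_ge0.
Qed.

Lemma invr_norm_ge0 p : 0 <= invr_norm p.
Proof. by rewrite invr_ge0 enorm_ge0. Qed.

Lemma measurable_invr_norm : measurable_fun setT invr_norm.
Proof.
apply: (measurableT_comp measurable_invr).
have ms : measurable_fun setT (@Num.sqrt R).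
  by apply: continuous_measurable_fun; exact: sqrt_continuous.
apply: (measurableT_comp ms); apply: measurable_sum => k.
rewrite (_ : (fun p : 'rV[R]_(m + s) => _) =
    (fun p => p 0 (rshift m k) * p 0 (rshift m k))).
  by apply: measurable_funM; exact: measurable_coord.
by apply/funext => p; rewrite !mxE.
Qed.

Let k1 : 'I_s := Ordinal (ltnW s_gt1).
Let k2 : 'I_s := Ordinal s_gt1.

Let c (i : 'I_(m + s)) (x : R) : R :=
  if (i == rshift m k1) || (i == rshift m k2) then invsqrt x else 1.

Let prod_c p : \prod_(i < m + s) c i (p 0 i) =
  invsqrt (p 0 (rshift m k1)) * invsqrt (p 0 (rshift m k2)).
Proof.
have k12 : rshift m k2 != rshift m k1 by rewrite (inj_eq (@rshift_inj m s)).
rewrite (bigD1 (rshift m k1)) //= (bigD1 (rshift m k2)) //=.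
rewrite {1}/c eqxx {1}/c eqxx orbT big1 ?mulr1// => i /andP[i1 i2].
by rewrite /c (negbTE i1) (negbTE i2).
Qed.

(* AM-GM: |theta|^2 >= theta_1^2 + theta_2^2 >= |theta_1| |theta_2|. *)
Let invr_norm_le p : p 0 (rshift m k1) != 0 -> p 0 (rshift m k2) != 0 ->
  invr_norm p <= invsqrt (p 0 (rshift m k1)) * invsqrt (p 0 (rshift m k2)).
Proof.
move=> p1 p2; rewrite /invsqrt -invfM -sqrtrM//.
set a := p 0 (rshift m k1) in p1 *; set b := p 0 (rshift m k2) in p2 *.
have ab : 0 < `|a| * `|b| by rewrite mulr_gt0// normr_gt0.
have le : `|a| * `|b| <= dotv (rsubmx p) (rsubmx p).
  rewrite /dotv (bigD1 k1) //= (bigD1 k2) //= !mxE addrA -/a -/b.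
  apply: (@le_trans _ _ (a * a + b * b)); last first.
    by rewrite lerDl; apply: sumr_ge0 => i _; rewrite -expr2 sqr_ge0.
  rewrite -!expr2 -[a ^+ 2]real_normK ?num_real// -[b ^+ 2]real_normK ?num_real//.
  have := sqr_ge0 (`|a| - `|b|); have := normr_ge0 a; have := normr_ge0 b.
  by nra.
rewrite /invr_norm /enorm lef_pV2 ?posrE ?sqrtr_gt0//; last exact: lt_le_trans le.
by rewrite ler_wsqrtr.
Qed.

(** Here s > 1 enters: two coordinates of theta share the singularity, each receiving the locally
    integrable |x|^(-1/2), so the majorant is a product of integrable functions of one variable. *)
Lemma integrable_invr_norm_weight :
  (lebesgue_rV (m + s)).-integrable setT (EFin \o (fun p => invr_norm p * weight p)).
Proof.
have mf : measurable_fun setT (fun p => invr_norm p * weight p).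
  by apply: measurable_funM; [exact: measurable_invr_norm|exact: measurable_weight].
pose g i (x : R) := c i x * (1 + x ^+ 2)^-1.
have ig i : leb.-integrable setT (EFin \o g i).
  rewrite /g /c; case: ((i == _) || _); first exact: integrable_singular.
  rewrite (_ : _ \o _ = EFin \o (fun x : R => (1 + x ^+ 2)^-1)).
    exact: integrable_oneDsqrV.
  by apply/funext => x /=; rewrite mul1r.
have := integrable_prod ig; move=> /integrableP[mg hg].
apply/integrableP; split; first exact/measurable_EFinP.
apply: le_lt_trans hg; apply: ae_ge0_le_integral => //.
- by apply: measurableT_comp => //; exact/measurable_EFinP.
- exact: measurableT_comp.
(* On these two hyperplanes [invsqrt] takes the value 0 and the bound may fail, so it is claimed
   almost everywhere only. *)
have h1 := hyperplane_null (R := R) (rshift m k1).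
have h2 := hyperplane_null (R := R) (rshift m k2).
apply: filterS2 h1 h2 => p p1 p2 _ /=; rewrite lee_fin.
rewrite ger0_norm; last by rewrite mulr_ge0 ?invr_norm_ge0 ?weight_ge0.
apply: le_trans (ler_norm _); rewrite /g big_split /= prod_c -/(weight p).
by rewrite ler_wpM2r ?weight_ge0// invr_norm_le.
Qed.

End enorm_weight.

End inverse_norm.

(** * The structure constants *)

Section structure_constants.
Context {R : realType} {n s : nat} {V : vectType R}.
Variables (B : {symmetric V}) (J : {linear 'rV[R]_s -> 'End(V)}).
Hypothesis BJ_admissible : admissible B J.
Variable br : V -> V -> 'rV[R]_s.
Hypothesis br_bracket : is_bracket B J br.
Variable X : (n + n).-tuple V.
Hypothesis X_basis : neutral_basis B X.
Variable a : 'I_(n + n) -> 'I_(n + n) -> 'I_s -> R.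
Hypothesis a_constants : structure_constants br X a.
Local Notation Xi i := (tnth X i).

Definition neutral_sign m (i : 'I_(m + m)) : R :=
  match fintype.split i with inl _ => 1 | inr _ => - 1 end.

Definition structure_mx (th : 'rV[R]_s) (i j : 'I_(n + n)) : R :=
  \sum_(k < s) a i j k * th 0 k.

Lemma formBC x y : B x y = B y x.
Proof. by rewrite hermC /= expr0 mul1r. Qed.

Lemma neutral_signL m (i : 'I_m) : neutral_sign (lshift m i) = 1.
Proof. by rewrite /neutral_sign (unsplitK (inl i)). Qed.

Lemma neutral_signR m (i : 'I_m) : neutral_sign (rshift m i) = - 1.
Proof. by rewrite /neutral_sign (unsplitK (inr i)). Qed.

Lemma neutral_sign_sqr m (i : 'I_(m + m)) : neutral_sign i * neutral_sign i = 1.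
Proof. by rewrite /neutral_sign; case: fintype.split => _; rewrite ?mulr1 ?mulrNN ?mulr1. Qed.

Lemma formZ c x y : B (c *: x) y = c * B x y.
Proof. exact: linearZl_LR. Qed.

Lemma form_Xi i j : B (Xi i) (Xi j) = neutral_sign i * (i == j)%:R.
Proof.
have [_ h1 h2 h3] := X_basis.
case: (split_ordP i) => i' ->; case: (split_ordP j) => j' ->.
- by rewrite neutral_signL mul1r h1 (inj_eq (@lshift_inj n n)).
- by rewrite h3 eq_lrshift mulr0.
- by rewrite formBC h3 eq_rlshift mulr0.
- by rewrite neutral_signR mulN1r h2 (inj_eq (@rshift_inj n n)).
Qed.

(** The 2 is that of the structure constants, and the sign is that of the negative definite
    [form0]. *)
Lemma form_J th i j : B (J th (Xi i)) (Xi j) = - 2 * structure_mx th i j.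
Proof.
rewrite br_bracket a_constants /form0 /dotv /structure_mx mulNr; congr (- _).
rewrite mulr_sumr; apply: eq_bigr => k _.
rewrite !mxE summxE (bigD1 k) //= big1 ?addr0 => [|l lk]; last first.
  by rewrite !mxE eqxx /= eq_sym (negbTE lk) mulr0.
by rewrite !mxE !eqxx mulr1; ring.
Qed.

Lemma structure_mx_antisym th i j : structure_mx th i j = - structure_mx th j i.
Proof.
have [_ _ skew] := BJ_admissible.
have e : - 2 * structure_mx th i j = - (- 2 * structure_mx th j i).
  by rewrite -!form_J skew formBC.
lra.
Qed.

Lemma JX_expand th i : J th (Xi i) =
  \sum_m (- 2 * neutral_sign m * structure_mx th i m) *: Xi m.
Proof.
have [bX _ _ _] := X_basis.
have e := coord_basis bX (memvf (J th (Xi i))).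
rewrite [LHS]e; apply: eq_bigr => m _; rewrite -tnth_nth; congr (_ *: _).
have := form_J th i m; rewrite [in X in X -> _]e linear_sumlz.
rewrite (bigD1 m) //= big1 ?addr0 => [|l lm]; last first.
  by rewrite formZ -tnth_nth form_Xi (negbTE lm) !mulr0.
rewrite formZ -tnth_nth form_Xi eqxx mulr1 => h.
move: h (neutral_sign_sqr m).
move: (coord _ _ _) (neutral_sign m) => c e1 h ee.
transitivity (c * (e1 * e1)); first by rewrite ee mulr1.
by rewrite mulrA h; ring.
Qed.

(** Pair J_theta^2 X_i = |theta|^2 X_i with X_j in two ways. The sign is positive because [form0] is
    negative definite, and 1/4 undoes the factor -2 of [form_J], which enters twice. *)
Lemma structure_mx_sqr th i j :
  \sum_m neutral_sign m * structure_mx th i m * structure_mx th m j =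
  dotv th th / 4 * neutral_sign i * (i == j)%:R.
Proof.
have [_ J2 _] := BJ_admissible.
have : B (J th (J th (Xi i))) (Xi j) = dotv th th * (neutral_sign i * (i == j)%:R).
  by rewrite J2 formZ form_Xi /form0 opprK.
rewrite JX_expand linear_sum.
under eq_bigr do rewrite linearZ /=.
rewrite linear_sumlz => e.
have {}e : 4 * (\sum_m neutral_sign m * structure_mx th i m * structure_mx th m j) =
    dotv th th * (neutral_sign i * (i == j)%:R).
  rewrite -e mulr_sumr; apply: eq_bigr => m _.
  symmetry; etransitivity; first exact: formZ.
  by rewrite form_J; ring.
by apply: (mulfI (x := 4)); [rewrite pnatr_eq0|rewrite e; field].
Qed.

(** The transpose of A applied to E xi. As 2 E xi is the gradient of P, this is half the derivative
    of P along the vector field attached to [j]. *)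
Definition twisted th (xi : 'I_(n + n) -> R) (j : 'I_(n + n)) : R :=
  \sum_m structure_mx th m j * (neutral_sign m * xi m).

(** The sum is the quadratic form of the skew matrix A at the vector E xi. *)
Lemma sum_twisted th (xi : 'I_(n + n) -> R) :
  \sum_j neutral_sign j * (xi j * twisted th xi j) = 0.
Proof.
pose F i j := structure_mx th i j * (neutral_sign i * xi i) * (neutral_sign j * xi j).
have e : \sum_j neutral_sign j * (xi j * twisted th xi j) = \sum_j \sum_m F m j.
  apply: eq_bigr => j _; rewrite /twisted !mulr_sumr; apply: eq_bigr => m _.
  by rewrite /F; ring.
have e2 : \sum_j \sum_m F m j = - (\sum_j \sum_m F m j).
  rewrite -[RHS]mulN1r mulr_sumr exchange_big /=; apply: eq_bigr => j _.
  rewrite mulr_sumr; apply: eq_bigr => m _.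
  by rewrite /F (structure_mx_antisym th m j); ring.
by rewrite e; lra.
Qed.

(** By skewness A E A^T = - A E A, which is -(|theta|^2 / 4) E; evaluate it at E xi on both
    sides. *)
Lemma sum_twisted_sqr th (xi : 'I_(n + n) -> R) :
  \sum_j neutral_sign j * twisted th xi j ^+ 2 =
  - (dotv th th / 4) * \sum_j neutral_sign j * xi j ^+ 2.
Proof.
have -> : \sum_j neutral_sign j * twisted th xi j ^+ 2 =
    - \sum_m \sum_l (neutral_sign m * xi m) * (neutral_sign l * xi l) *
      (\sum_j neutral_sign j * structure_mx th m j * structure_mx th j l).
  rewrite -[RHS]mulN1r mulr_sumr.
  transitivity (\sum_j \sum_m \sum_l - 1 * ((neutral_sign m * xi m) * (neutral_sign l * xi l) *
      (neutral_sign j * structure_mx th m j * structure_mx th j l))).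
    apply: eq_bigr => j _; rewrite expr2 /twisted big_distrlr /= mulr_sumr.
    apply: eq_bigr => m _; rewrite mulr_sumr; apply: eq_bigr => l _.
    by rewrite (structure_mx_antisym th l j); ring.
  rewrite exchange_big /=; apply: eq_bigr => m _; rewrite mulr_sumr exchange_big /=.
  by apply: eq_bigr => l _; rewrite -!mulr_sumr.
rewrite mulNr mulr_sumr; congr (- _); apply: eq_bigr => m _.
under eq_bigr do rewrite structure_mx_sqr.
rewrite (bigD1 m) //= big1 ?addr0 => [|l lm]; last first.
  by rewrite [_ == l]eq_sym (negbTE lm) !mulr0.
rewrite eqxx mulr1; have := neutral_sign_sqr m.
set e := neutral_sign m => ee.
transitivity (dotv th th / 4 * (e * e) * e * xi m ^+ 2); first by ring.
by rewrite ee; ring.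
Qed.

(** The trace of E A^T E A, that is -|theta|^2 / 4 times the trace of the identity of size 2n. This
    is the origin of the exponent of cosh. *)
Lemma sum_structure_mx_sqr th :
  \sum_j neutral_sign j * \sum_m structure_mx th m j * (structure_mx th m j * neutral_sign m) =
  - (dotv th th / 4) * (n + n)%:R.
Proof.
transitivity (\sum_(j < n + n) - (dotv th th / 4)); last by rewrite sumr_const card_ord mulr_natr.
apply: eq_bigr => j _.
have -> : \sum_m structure_mx th m j * (structure_mx th m j * neutral_sign m) =
    - \sum_m neutral_sign m * structure_mx th j m * structure_mx th m j.
  rewrite -mulN1r mulr_sumr; apply: eq_bigr => m _.
  by rewrite (structure_mx_antisym th j m); ring.
rewrite structure_mx_sqr eqxx mulr1 mulrN mulrCA neutral_sign_sqr mulr1.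
by [].
Qed.

Lemma structure_mx_bound th i j :
  `|structure_mx th i j| <= (\sum_k `|a i j k|) * enorm th.
Proof.
rewrite mulr_suml (le_trans (ler_norm_sum _ _ _))//; apply: ler_sum => k _.
by rewrite normrM ler_wpM2l// coord_le_enorm.
Qed.

(** Positivity of [n] makes cosh^-n t integrable and removes the boundary term at infinity. *)
Lemma neutral_n_gt0 : fullv != 0%VS :> {vspace V} -> (0 < n)%N.
Proof.
move=> V0; have [bX _ _ _] := X_basis; case: (posnP n) => // n0.
move: V0; rewrite -dimv_eq0; have := size_basis bX.
by rewrite n0 => ->; rewrite eqxx.
Qed.

Lemma structure_mx_diag th i : structure_mx th i i = 0.
Proof. by have := structure_mx_antisym th i i; lra. Qed.

End structure_constants.

(** * The operator on the Fourier side *)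

Section moderate_growth.
Context {R : realType} {d : nat}.
Implicit Types (g : 'rV[R]_d -> R) (f : 'rV[R]_d -> R[i]).

(** Growth at most [g] times a polynomial, with powers of the inverse weight in the role of
    polynomials. In use [g] is 1 or [invr_norm]; times a rapidly decreasing transform, the latter
    kind becomes integrable. *)
Definition moderate g f := cmeas f /\
  exists K C, forall p, normc (f p) <= C * (g p * (weight p)^-1 ^+ K).

Lemma weight_le1 (p : 'rV[R]_d) : weight p <= 1.
Proof.
suff /andP[] : 0 <= weight p <= 1 by [].
rewrite /weight; elim/big_ind: _ => [|x y /andP[x0 x1] /andP[y0 y1]|i _].
- by rewrite ler01 lexx.
- by rewrite mulr_ge0//= -[leRHS]mulr1 ler_pM.
rewrite invr_ge0 addr_ge0 ?sqr_ge0//=.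
by rewrite invf_le1 ?lerDl ?sqr_ge0// ltr_pwDl// sqr_ge0.
Qed.

Lemma weightV_ge1 (p : 'rV[R]_d) : 1 <= (weight p)^-1.
Proof. by rewrite invf_ge1 ?weight_gt0// weight_le1. Qed.

Lemma moderate_ge0 g f : (forall p, 0 <= g p) -> moderate g f ->
  exists K C, 0 <= C /\ forall p, normc (f p) <= C * (g p * (weight p)^-1 ^+ K).
Proof.
move=> g0 [_ [K [C fC]]]; exists K, `|C|; split => // p.
apply: le_trans (fC p) _; rewrite ler_wpM2r ?ler_norm// mulr_ge0//.
by rewrite exprn_ge0// invr_ge0 weight_ge0.
Qed.

Lemma moderateD g f1 f2 : (forall p, 0 <= g p) ->
  moderate g f1 -> moderate g f2 -> moderate g (fun p => f1 p + f2 p).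
Proof.
move=> g0 m1 m2; split; first by apply: cmeasD; [exact: m1.1|exact: m2.1].
have [K1 [C1 [C10 h1]]] := moderate_ge0 g0 m1.
have [K2 [C2 [C20 h2]]] := moderate_ge0 g0 m2.
exists (K1 + K2)%N, (C1 + C2) => p.
have h := weightV_ge1 p; have h0 : 0 <= (weight p)^-1 by rewrite invr_ge0 weight_ge0.
apply: le_trans (normcD _ _) _; rewrite mulrDl lerD//.
  apply: le_trans (h1 p) _; rewrite ler_wpM2l// ler_wpM2l//.
  by rewrite ler_weXn2l// leq_addr.
apply: le_trans (h2 p) _; rewrite ler_wpM2l// ler_wpM2l//.
by rewrite ler_weXn2l// leq_addl.
Qed.

Lemma moderateM g f1 f2 : (forall p, 0 <= g p) ->
  moderate (fun=> 1) f1 -> moderate g f2 -> moderate g (fun p => f1 p * f2 p).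
Proof.
move=> g0 m1 m2; split; first by apply: cmeasM; [exact: m1.1|exact: m2.1].
have [K1 [C1 [C10 h1]]] := moderate_ge0 (fun=> ler01) m1.
have [K2 [C2 [C20 h2]]] := moderate_ge0 g0 m2.
exists (K1 + K2)%N, (C1 * C2) => p; rewrite normcM.
apply: le_trans (ler_pM (normc_ge0 _) (normc_ge0 _) (h1 p) (h2 p)) _.
by rewrite mul1r exprD le_eqVlt; apply/orP; left; apply/eqP; ring.
Qed.

Lemma moderate0 g : moderate g (fun=> 0).
Proof.
split; first exact: cmeas_cst.
by exists 0%N, 0 => p; rewrite normc0 mul0r.
Qed.

Lemma moderate_sum g I (r : seq I) (F : I -> 'rV[R]_d -> R[i]) :
  (forall p, 0 <= g p) -> (forall i, moderate g (F i)) ->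
  moderate g (fun p => \sum_(i <- r) F i p).
Proof.
move=> g0 mF; elim: r => [|i r IH].
  by under eq_fun do rewrite big_nil; exact: moderate0.
by under eq_fun do rewrite big_cons; apply: moderateD.
Qed.

Lemma moderate_bounded g f (C : R) : cmeas f ->
  (forall p, normc (f p) <= C * g p) -> moderate g f.
Proof. by move=> mf h; split => //; exists 0%N, C => p; rewrite expr0 mulr1. Qed.

Lemma moderate_cst c : moderate (fun=> 1) (fun=> c).
Proof. by apply: (@moderate_bounded _ _ (normc c)); [exact: cmeas_cst|move=> p; rewrite mulr1]. Qed.

Lemma moderateI g (h : 'rV[R]_d -> R) :
  moderate g (fun p => (h p)%:C) -> moderate g (fun p => 0 +i* h p).
Proof.
move=> [[mh _] [K [C hC]]]; split; first exact: cmeasI.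
by exists K, C => p; have := hC p; rewrite normc_imag normc_real.
Qed.

Lemma coord_le_weightV (p : 'rV[R]_d) i : `|p 0 i| <= (weight p)^-1.
Proof.
have h0 j : 1 <= 1 + p 0 j ^+ 2 by rewrite lerDl sqr_ge0.
have h1 : `|p 0 i| <= 1 + p 0 i ^+ 2.
  rewrite -[p 0 i ^+ 2]real_normK ?num_real//; have := sqr_ge0 (`|p 0 i| - 1).
  have := normr_ge0 (p 0 i); nra.
apply: le_trans h1 _; rewrite weightV big_enum /= (bigD1 i) //= ler_peMr//.
  by rewrite addr_ge0// sqr_ge0.
elim/big_ind: _ => // x y x1 y1.
by rewrite -[leLHS]mulr1 ler_pM.
Qed.

Lemma moderate_coord i : moderate (fun=> 1) (fun p => (p 0 i)%:C).
Proof.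
split; first by apply: cmeasC; exact: measurable_coord.
by exists 1%N, 1 => p; rewrite !mul1r expr1 normc_real coord_le_weightV.
Qed.

(** Derivatives of [f] of any order have transforms bounded by Schwartz norms of [f], and these
    transforms are monomials times that of [f]; so any power of the inverse weight can be
    absorbed. *)
Lemma fourier_rapid K f : schwartz f ->
  exists C, forall p, normc (fourier f p) * (weight p)^-1 ^+ K <= C * weight p.
Proof.
move=> sf; set M := (d * K.+1).*2.
have fM al p : (size al <= M)%N ->
    `|monomial al p| * normc (fourier f p) <= @fourier_cst R d * schwartz_norm (d.*2 + M) f.
  move=> sal; rewrite -normc_fourier_cpartials//.
  have sfa := schwartz_partials al sf.
  have n0 : 0 <= schwartz_norm d.*2 (cpartials al f) by exact: schwartz_norm_ge0.
  apply: le_trans (fourier_weight p sfa) _.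
  apply: (@le_trans _ _ (@fourier_cst R d * schwartz_norm d.*2 (cpartials al f))).
    by rewrite ler_piMr ?weight_le1// mulr_ge0// fourier_cst_ge0.
  rewrite ler_wpM2l ?fourier_cst_ge0//; apply: ge_sup.
    by exists (`|monomial [::] (0 : 'rV[R]_d)| * normc (cpartials [::] (cpartials al f) 0)), [::], [::], 0.
  move=> _ [b [e [x [sb se ->]]]]; rewrite /cpartials -foldr_cat -/(cpartials (e ++ al) f).
  apply: schwartz_norm_ge => //; first by rewrite (leq_trans sb)// leq_addr.
  by rewrite size_cat leq_add.
(* Each coordinate K+1 times: K powers of the inverse weight appear on the left, and the last one is
   moved to the right as the factor [weight p]. *)
pose l := flatten (nseq K.+1 (enum 'I_d)).
have sl : size l = (d * K.+1)%N.
  by rewrite size_flatten /shape map_nseq sumn_nseq size_enum_ord mulnC.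
have Wl (p : 'rV[R]_d) : \prod_(i <- l) (1 + p 0 i ^+ 2) = (weight p)^-1 ^+ K.+1.
  rewrite weightV /l; elim: K.+1 => [|k IH]; first by rewrite big_nil.
  by rewrite exprS -IH /= big_cat.
exists (2 ^+ size l * (@fourier_cst R d * schwartz_norm (d.*2 + M) f)) => p.
rewrite -ler_pdivrMr ?weight_gt0// -mulrA -exprSr -Wl mulrC.
have := @monomial_bound_prod R d p (normc (fourier f p)) _ M l (fun al => fM al p) [::].
by rewrite /= /monomial big_nil normr1 mul1r; apply; rewrite sl.
Qed.

End moderate_growth.

Section symbols.
Context {R : realType} {m s : nat}.
Hypothesis s_gt1 : (1 < s)%N.
Local Notation lebd := (lebesgue_rV (m + s)).
Local Notation rho := (@invr_norm R m s).
Implicit Types (Psi : 'rV[R]_(m + s) -> R[i]) (f : 'rV[R]_(m + s) -> R[i]).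

Lemma moderate_fourier Psi f : moderate rho Psi -> schwartz f ->
  exists C, 0 <= C /\ forall p, normc (Psi p * fourier f p) <= C * (rho p * weight p).
Proof.
move=> mP sf; have [K [C [C0 h]]] := moderate_ge0 (@invr_norm_ge0 R m s) mP.
have [D hD] := fourier_rapid K sf; exists (C * `|D|); split; first by rewrite mulr_ge0.
move=> p; rewrite normcM; have r0 := invr_norm_ge0 p.
apply: (le_trans (ler_wpM2r (normc_ge0 _) (h p))).
have e : C * (rho p * (weight p)^-1 ^+ K) * normc (fourier f p) =
    C * (rho p * (normc (fourier f p) * (weight p)^-1 ^+ K)) by ring.
rewrite e -[leRHS]mulrA ler_wpM2l// [leRHS]mulrCA ler_wpM2l//.
by apply: (le_trans (hD p)); rewrite ler_wpM2r ?weight_ge0// ler_norm.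
Qed.

Lemma integrable_invr_norm_weightZ (C : R) :
  lebd.-integrable setT (EFin \o (fun p => C * (rho p * weight p))).
Proof.
rewrite (_ : _ \o _ = fun p => (C%:E * (rho p * weight p)%:E)%E)//.
by apply: integrableZl => //; exact: integrable_invr_norm_weight.
Qed.

Lemma cintegrable_moderate Psi f : moderate rho Psi -> schwartz f ->
  cintegrable lebd setT (fun p => Psi p * fourier f p).
Proof.
move=> mP sf; have [C [_ h]] := moderate_fourier mP sf.
apply: cintegrable_le (integrable_invr_norm_weightZ C) h.
by apply: cmeasM; [exact: mP.1|exact: cmeas_fourier].
Qed.

Lemma invr_norm_shift (p : 'rV[R]_(m + s)) t i :
  rsubmx (p + t *: 'e_(lshift s i)) = rsubmx p.
Proof.
apply/rowP => k; rewrite !mxE eq_rlshift andbF mulr0 addr0//.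
Qed.

(* The singular factor [invr_norm] does not depend on the first [m] variables,
   so that there is no boundary term. *)
Lemma cintegral_symbol_by_parts i Psi Psi' f : moderate rho Psi ->
  cintegrable lebd setT (fun p => Psi' p * fourier f p) ->
  (forall p : 'rV[R]_(m + s), is_cderive p 'e_(lshift s i) Psi (Psi' p)) ->
  (forall p : 'rV[R]_(m + s), cderivable (lshift s i) Psi' p) ->
  schwartz f ->
  cintegral lebd setT (fun p => Psi p * fourier (fun x => (x 0 (lshift s i))%:C * f x) p) =
  (0 +i* (- 1)) * cintegral lebd setT (fun p => Psi' p * fourier f p).
Proof.
move=> mP iP dP dP' sf; set k := lshift s i.
have sxf := schwartz_coordM k sf.
have i1 := cintegrable_moderate mP sxf.
set h := fun x => _ in sxf i1 *.
have i2 : cintegrable lebd setT (fun p => (0 +i* (- 1)) * (Psi p * fourier h p)).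
  exact: cintegrableZ.
have : cintegral lebd setT
    (fun p => (0 +i* (- 1)) * (Psi p * fourier h p) + Psi' p * fourier f p) = 0.
  apply: (@cintegral_derive0 _ _ k (fun p => Psi p * fourier f p) _
    (fun p => (0 +i* (- 1)) * (Psi p * ((0 +i* (-1)) * fourier (fun x => (x 0 k)%:C * h x) p) +
      Psi' p * fourier h p) + (Psi' p * ((0 +i* (-1)) * fourier h p) + cpartial k Psi' p * fourier f p))).
  - exact: cintegrableD.
  - move=> p; apply: is_cderive_eq (is_cderiveM (dP p) (is_cderive_fourier k p sf)) _.
    by rewrite mulrCA.
  - move=> p; apply: is_cderiveD.
      by apply: is_cderiveZ; apply: is_cderiveM (dP p) (is_cderive_fourier k p sxf).
    exact: is_cderiveM (cderivableP (dP' p)) (is_cderive_fourier k p sf).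
  - move=> p; have [C1 [C10 h1]] := moderate_fourier mP sf.
    have mkP : moderate rho (fun p => (p 0 k)%:C * Psi p).
      by apply: moderateM mP; [exact: invr_norm_ge0|exact: moderate_coord].
    have [C2 [C20 h2]] := moderate_fourier mkP sf.
    exists ((C1 + C2) * rho p) => t; have := h2 (p + t *: 'e_k); have := h1 (p + t *: 'e_k).
    rewrite -mulrA [X in _ -> X <= _ -> _]normcM normc_real => h1' h2'.
    rewrite mulrDl mul1r; apply: (le_trans (lerD h1' h2')); rewrite -mulrDl.
    rewrite ler_wpM2l ?addr_ge0// /invr_norm invr_norm_shift.
    by rewrite ler_piMr ?weight_le1// invr_ge0 enorm_ge0.
rewrite cintegralD// cintegralZ// => e.
have -> : cintegral lebd setT (fun p => Psi' p * fourier f p) =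
    - ((0 +i* (- 1)) * cintegral lebd setT (fun p => Psi p * fourier h p)).
  by apply/eqP; rewrite -addr_eq0 addrC e.
rewrite mulrN mulrA; apply: complexP; rewrite !(ReN, ImN, ReM, ImM)/=; ring.
Qed.

End symbols.

(** * The left-invariant fields transposed to symbols *)

Section left_invariant_fields.
Context {R : realType} {n s : nat}.
Variable a : 'I_(n + n) -> 'I_(n + n) -> 'I_s -> R.
Implicit Types (f : 'rV[R]_(n + n + s) -> R[i]).

Definition central_derivative m j f : 'rV[R]_(n + n + s) -> R[i] := fun p =>
  \sum_(k < s) (a m j k)%:C * cpartial (rshift (n + n) k) f p.

Lemma left_fieldE j f : left_field a j f = fun p => cpartial (lshift s j) f p +
  \sum_m (p 0 (lshift s m))%:C * central_derivative m j f p.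
Proof.
apply/funext => p; rewrite /left_field; congr (_ + _); apply: eq_bigr => m _.
rewrite /central_derivative mulr_sumr; apply: eq_bigr => k _.
by rewrite rmorphM /= mulrCA mulrA.
Qed.

Lemma schwartz_central_derivative m j f : schwartz f ->
  schwartz (central_derivative m j f).
Proof.
by move=> sf; apply: schwartz_sum => k; apply: schwartzZ; exact: schwartz_cpartial.
Qed.

Lemma schwartz_left_field j f : schwartz f -> schwartz (left_field a j f).
Proof.
move=> sf; rewrite left_fieldE.
apply: schwartzD; first exact: schwartz_cpartial.
by apply: schwartz_sum => m; apply: schwartz_coordM; exact: schwartz_central_derivative.
Qed.

Lemma fourier_central_derivative m j f p : schwartz f ->
  fourier (central_derivative m j f) p =
  (0 +i* structure_mx a (rsubmx p) m j) * fourier f p.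
Proof.
move=> sf; rewrite fourier_sum => [|k]; last by apply: schwartzZ; exact: schwartz_cpartial.
transitivity (\sum_(k < s) ((a m j k)%:C * (0 +i* p 0 (rshift (n + n) k))) * fourier f p).
  apply: eq_bigr => k _; rewrite fourierZ; last exact: schwartz_cpartial.
  by rewrite fourier_cpartial// mulrA.
rewrite -mulr_suml; congr (_ * _); rewrite /structure_mx.
elim/big_ind2: _ => [//|? x ? y -> ->|k _]; apply: complexP => /=;
  rewrite ?ReD ?ImD ?ReM ?ImM//= ?addr0 ?mulr0 ?mul0r ?subr0 ?addr0//.
by rewrite !mxE.
Qed.

Lemma fourier_left_field j f p : schwartz f ->
  fourier (left_field a j f) p = (0 +i* p 0 (lshift s j)) * fourier f p +
  \sum_m fourier (fun x => (x 0 (lshift s m))%:C * central_derivative m j f x) p.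
Proof.
move=> sf; have sc m := schwartz_coordM (lshift s m) (schwartz_central_derivative m j sf).
rewrite left_fieldE.
rewrite fourierD; [|exact: schwartz_cpartial|exact: schwartz_sum].
by rewrite fourier_cpartial// fourier_sum.
Qed.

Hypothesis s_gt1 : (1 < s)%N.
Local Notation lebd := (lebesgue_rV (n + n + s)).
Local Notation rho := (@invr_norm R (n + n) s).

(** What becomes of the symbol [Psi] when X_j is moved off the Fourier transform it is paired with.
    The partial derivatives [dPsi] are an argument, so that they can be explicit formulas. *)
Definition field_symbol j (Psi : 'rV[R]_(n + n + s) -> R[i])
    (dPsi : 'I_(n + n) -> 'rV[R]_(n + n + s) -> R[i]) (p : 'rV[R]_(n + n + s)) : R[i] :=
  (0 +i* p 0 (lshift s j)) * Psi p +
  \sum_m (structure_mx a (rsubmx p) m j)%:C * dPsi m p.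

Lemma cintegral_left_field j Psi dPsi f : schwartz f -> moderate rho Psi ->
  (forall m, moderate rho (fun p => (structure_mx a (rsubmx p) m j)%:C * dPsi m p)) ->
  (forall m (p : 'rV[R]_(n + n + s)), is_cderive p 'e_(lshift s m) Psi (dPsi m p)) ->
  (forall m (p : 'rV[R]_(n + n + s)), cderivable (lshift s m) (dPsi m) p) ->
  cintegral lebd setT (fun p => Psi p * fourier (left_field a j f) p) =
  cintegral lebd setT (fun p => field_symbol j Psi dPsi p * fourier f p).
Proof.
move=> sf mP mdP dP ddP.
have sc m := schwartz_central_derivative m j sf.
have sxc m := schwartz_coordM (lshift s m) (sc m).
have m1 : moderate rho (fun p => (0 +i* p 0 (lshift s j)) * Psi p).
  apply: moderateM mP; first exact: invr_norm_ge0.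
  by apply: moderateI; exact: moderate_coord.
have i1 := cintegrable_moderate s_gt1 m1 sf.
have i2 m := cintegrable_moderate s_gt1 mP (sxc m).
have i3 m := cintegrable_moderate s_gt1 (mdP m) sf.
transitivity (cintegral lebd setT (fun p => (0 +i* p 0 (lshift s j)) * Psi p * fourier f p) +
  \sum_m cintegral lebd setT (fun p => Psi p *
     fourier (fun x => (x 0 (lshift s m))%:C * central_derivative m j f x) p)).
  rewrite -cintegral_sum// -cintegralD//; last exact: cintegrable_sum.
  apply: eq_cintegral => p; rewrite fourier_left_field// mulrDr mulr_sumr; congr (_ + _).
  by rewrite mulrCA mulrA.
transitivity (cintegral lebd setT (fun p => (0 +i* p 0 (lshift s j)) * Psi p * fourier f p) +
  \sum_m cintegral lebd setT (fun p =>
     (structure_mx a (rsubmx p) m j)%:C * dPsi m p * fourier f p)); last first.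
  rewrite -cintegral_sum// -cintegralD//; last exact: cintegrable_sum.
  by apply: eq_cintegral => p; rewrite mulrDl mulr_suml.
apply: (congr1 (+%R _)); apply: eq_bigr => m _.
(* The transform of [central_derivative] supplies the factor A_mj that tames the derivative of the
   symbol, together with an i which cancels the -i of the integration by parts. *)
have e p : dPsi m p * fourier (central_derivative m j f) p =
    (0 +i* 1) * ((structure_mx a (rsubmx p) m j)%:C * dPsi m p * fourier f p).
  rewrite fourier_central_derivative//; set A := structure_mx _ _ _ _.
  have -> : 0 +i* A = (0 +i* 1) * A%:C by apply: complexP; rewrite ?ReM ?ImM/=; ring.
  by ring.
have i4 : cintegrable lebd setT (fun p => dPsi m p * fourier (central_derivative m j f) p).
  by under eq_fun do rewrite e; exact: cintegrableZ.
rewrite (cintegral_symbol_by_parts s_gt1 mP i4 (dP m) (ddP m) (sc m)).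
rewrite (eq_cintegral _ e) cintegralZ// mulrA.
rewrite (_ : (0 +i* (-1)) * (0 +i* 1) = 1 :> R[i]) ?mul1r//.
by apply: complexP; rewrite ?ReM ?ImM/=; ring.
Qed.

Lemma ultra_hyperbolicE f : ultra_hyperbolic a f =
  fun p => \sum_j (neutral_sign j : R)%:C * left_field a j (left_field a j f) p.
Proof.
apply/funext => p; rewrite big_split_ord /= /ultra_hyperbolic; congr (_ + _).
  by apply: eq_bigr => j _; rewrite neutral_signL mul1r.
by rewrite -sumrN; apply: eq_bigr => j _; rewrite neutral_signR rmorphN mulN1r.
Qed.

Lemma schwartz_ultra_hyperbolic f : schwartz f -> schwartz (ultra_hyperbolic a f).
Proof.
move=> sf; rewrite ultra_hyperbolicE; apply: schwartz_sum => j; apply: schwartzZ.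
by do 2 apply: schwartz_left_field.
Qed.

End left_invariant_fields.

Section real_moderate.
Context {R : realType} {d : nat}.
Implicit Types (h : 'rV[R]_d -> R).

Definition real_moderate h := moderate (fun=> 1) (fun p => (h p)%:C).

Lemma real_moderateD h1 h2 : real_moderate h1 -> real_moderate h2 ->
  real_moderate (fun p => h1 p + h2 p).
Proof.
move=> m1 m2; rewrite /real_moderate.
rewrite (_ : (fun p => _%:C) = fun p => (h1 p)%:C + (h2 p)%:C); first exact: moderateD.
by apply/funext => p; rewrite rmorphD.
Qed.

Lemma real_moderateM h1 h2 : real_moderate h1 -> real_moderate h2 ->
  real_moderate (fun p => h1 p * h2 p).
Proof.
move=> m1 m2; rewrite /real_moderate.
rewrite (_ : (fun p => _%:C) = fun p => (h1 p)%:C * (h2 p)%:C); first exact: moderateM.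
by apply/funext => p; rewrite rmorphM.
Qed.

Lemma real_moderate_cst c : real_moderate (fun=> c).
Proof. exact: moderate_cst. Qed.

Lemma real_moderate_sum I (r : seq I) (F : I -> 'rV[R]_d -> R) :
  (forall i, real_moderate (F i)) -> real_moderate (fun p => \sum_(i <- r) F i p).
Proof.
move=> m; rewrite /real_moderate.
rewrite (_ : (fun p => _%:C) = fun p => \sum_(i <- r) (F i p)%:C); first exact: moderate_sum.
by apply/funext => p; rewrite rmorph_sum.
Qed.

End real_moderate.

(** * The operator applied to the oscillating exponential *)

Section phase_symbols.
Context {R : realType} {n s : nat}.
Hypothesis s_gt1 : (1 < s)%N.
Variable a : 'I_(n + n) -> 'I_(n + n) -> 'I_s -> R.
Local Notation rV := 'rV[R]_(n + n + s).
Local Notation lebd := (lebesgue_rV (n + n + s)).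
Local Notation rho := (@invr_norm R (n + n) s).
Local Notation A p m j := (structure_mx a (rsubmx p) m j).
Local Notation eps := (@neutral_sign R n).
Implicit Types (p : 'rV[R]_(n + n + s)) (c : R).

Definition xi p (j : 'I_(n + n)) : R := p 0 (lshift s j).

Definition phase c p : R := c * rho p * quadP (lsubmx p).

(* With [c = tanh t] this is the integrand of [q0s] up to the factor
   [cosh^-n t]. On the Fourier side, [symbol1] is its image under one field and
   [symbol2] its image under the ultra-hyperbolic operator. *)
Definition oscillation c p : R[i] := (rho p)%:C * expi (phase c p).

Lemma quadPE p : quadP (lsubmx p) = \sum_j eps j * xi p j ^+ 2.
Proof.
rewrite big_split_ord /= /quadP big_split /= sumrN; congr (_ + _).
  by apply: eq_bigr => j _; rewrite neutral_signL mul1r !mxE.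
by rewrite -sumrN; apply: eq_bigr => j _; rewrite neutral_signR mulN1r !mxE.
Qed.

Lemma is_cderive_rsubmx (F : 'rV[R]_s -> R[i]) p i :
  is_cderive p 'e_(lshift s i) (fun y : rV => F (rsubmx y)) 0.
Proof.
apply: (@is_cderive_line _ R _ (fun=> F (rsubmx p)) _ 0 p 1); last exact: is_cderive_cst.
by move=> h; rewrite addrC invr_norm_shift.
Qed.

Lemma is_cderive_xi p i j :
  is_cderive p 'e_(lshift s i) (fun y : rV => (xi y j)%:C) ((j == i)%:R)%:C.
Proof.
apply: is_cderiveC; rewrite -(inj_eq (@lshift_inj (n + n) s) j i).
exact: is_derive_coord.
Qed.

Lemma is_derive_phase c p i : is_derive p 'e_(lshift s i) (phase c)
  (2 * (c * rho p) * (eps i * xi p i)).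
Proof.
have dq : is_cderive p 'e_(lshift s i) (fun y : rV => (phase c y)%:C)
    (2 * (c * rho p) * (eps i * xi p i))%:C.
  rewrite (_ : (fun y => _) = fun y : rV => (c * rho y)%:C *
      \sum_j (eps j)%:C * ((xi y j)%:C * (xi y j)%:C)); last first.
    apply/funext => y; rewrite /phase quadPE rmorphM rmorph_sum; congr (_ * _).
    by apply: eq_bigr => j _; rewrite !rmorphM.
  apply: is_cderive_eq.
    apply: is_cderiveM; first exact: (is_cderive_rsubmx (fun z => (c * (enorm z)^-1)%:C)).
    apply: is_cderive_sum => j; apply: is_cderiveZ.
    exact: is_cderiveM (is_cderive_xi _ _ _) (is_cderive_xi _ _ _).
  rewrite mul0r addr0 (bigD1 i) //= big1 ?addr0 => [|j ji]; last first.
    by rewrite (negbTE ji) !(mul0r, mulr0, addr0).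
  by rewrite eqxx; apply: complexP; rewrite !(ReM, ImM, ReD, ImD)/=; ring.
exact: dq.1.
Qed.

Definition doscillation c m p : R[i] :=
  (0 +i* (2 * (c * rho p) * (eps m * xi p m))) * oscillation c p.

Lemma is_cderive_oscillation c m p :
  is_cderive p 'e_(lshift s m) (oscillation c) (doscillation c m p).
Proof.
apply: is_cderive_eq.
  apply: is_cderiveM; first exact: (is_cderive_rsubmx (fun z => ((enorm z)^-1)%:C)).
  by apply: is_cderive_expi; exact: is_derive_phase.
by rewrite mul0r addr0 mulrCA.
Qed.

Lemma cderivable_doscillation c m p :
  cderivable (lshift s m) (doscillation c m) p.
Proof.
refine (is_cderive_cpartial (is_cderiveM _ (is_cderive_oscillation c m p))).1.
rewrite (_ : (fun y => _) = fun y : rV =>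
    (0 +i* (2 * (c * rho y) * eps m)) * (xi y m)%:C); last first.
  by apply/funext => y; apply: complexP; rewrite ?ReM ?ImM/=; ring.
apply: is_cderiveM (is_cderive_xi p m m).
exact: (is_cderive_rsubmx (fun z => 0 +i* (2 * (c * (enorm z)^-1) * eps m))).
Qed.

(** Homogeneous of degree 0 in theta, hence bounded: A is linear in theta and compensates the
    inverse norm. *)
Definition scaled_mx c p m j : R := c * rho p * A p m j.

(** The frequency xi_j shifted by the derivative of the phase along the field: times i, it is the
    factor by which the field acts on [oscillation]. *)
Definition linear_symbol c j p : R :=
  xi p j + 2 * \sum_m scaled_mx c p m j * (eps m * xi p m).

Definition dlinear_symbol c j m p : R := (m == j)%:R + 2 * (scaled_mx c p m j * eps m).

Lemma is_cderive_linear_symbol c j m p :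
  is_cderive p 'e_(lshift s m) (fun y => 0 +i* linear_symbol c j y)
    (0 +i* dlinear_symbol c j m p).
Proof.
have e (x : R) : 0 +i* x = (0 +i* 1) * x%:C by apply: complexP; rewrite ?ReM ?ImM/=; ring.
rewrite (_ : (fun y => _) = fun y : rV => (0 +i* 1) * ((xi y j)%:C + 2%:C *
    \sum_l (scaled_mx c y l j * eps l)%:C * (xi y l)%:C)); last first.
  apply/funext => y; rewrite e /linear_symbol rmorphD rmorphM rmorph_sum.
  congr (_ * (_ + _ * _)); apply: eq_bigr => l _.
  by rewrite mulrA rmorphM.
apply: is_cderive_eq.
  apply: is_cderiveZ; apply: is_cderiveD; first exact: is_cderive_xi.
  apply: is_cderiveZ; apply: is_cderive_sum => l.
  apply: is_cderiveM; last exact: is_cderive_xi.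
  exact: (is_cderive_rsubmx (fun z => (c * (enorm z)^-1 * structure_mx a z l j * eps l)%:C)).
rewrite (bigD1 m) //= big1 ?addr0 => [|l lm]; last first.
  by rewrite (negbTE lm) !(mul0r, mulr0, addr0).
rewrite eqxx /dlinear_symbol [j == m]eq_sym mul0r addr0.
by apply: complexP; rewrite !(ReD, ReM, ImD, ImM)/=; ring.
Qed.

Definition symbol1 c j p : R[i] := (0 +i* linear_symbol c j p) * oscillation c p.

Definition dsymbol1 c j m p : R[i] :=
  (0 +i* linear_symbol c j p) * doscillation c m p +
  (0 +i* dlinear_symbol c j m p) * oscillation c p.

Lemma is_cderive_symbol1 c j m p :
  is_cderive p 'e_(lshift s m) (symbol1 c j) (dsymbol1 c j m p).
Proof.
exact: is_cderiveM (is_cderive_linear_symbol c j m p) (is_cderive_oscillation c m p).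
Qed.

Lemma cderivable_dsymbol1 c j m p : cderivable (lshift s m) (dsymbol1 c j m) p.
Proof.
refine (is_cderive_cpartial (is_cderiveD
  (is_cderiveM (is_cderive_linear_symbol c j m p) (cderivableP (cderivable_doscillation c m p)))
  (is_cderiveM _ (is_cderive_oscillation c m p)))).1.
exact: (is_cderive_rsubmx (fun z => 0 +i* ((m == j)%:R +
  2 * (c * (enorm z)^-1 * structure_mx a z m j * eps m)))).
Qed.

Lemma field_symbol_oscillation c j p :
  field_symbol a j (oscillation c) (doscillation c) p = symbol1 c j p.
Proof.
rewrite /field_symbol /symbol1 /doscillation.
under eq_bigr do rewrite mulrA.
rewrite -mulr_suml -mulrDl; congr (_ * _).
rewrite -/(xi p j) /linear_symbol; apply: complexP.
  rewrite ReD raddf_sum /= big1 ?addr0// => m _; ring.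
rewrite ImD raddf_sum /= mulr_sumr; congr (_ + _); apply: eq_bigr => m _.
by rewrite /scaled_mx; ring.
Qed.

(** The second application multiplies once more by i times the linear symbol, which gives the real
    part, and also differentiates the linear symbol, which gives the imaginary part. *)
Lemma field_symbol_symbol1 c j p :
  field_symbol a j (symbol1 c j) (dsymbol1 c j) p = oscillation c p *
  ((- linear_symbol c j p ^+ 2) +i* \sum_m A p m j * dlinear_symbol c j m p).
Proof.
rewrite /field_symbol /symbol1 /dsymbol1 /doscillation.
transitivity (oscillation c p * ((0 +i* xi p j) * (0 +i* linear_symbol c j p) +
    \sum_m (A p m j)%:C * ((0 +i* linear_symbol c j p) *
      (0 +i* (2 * (c * rho p) * (eps m * xi p m))) + (0 +i* dlinear_symbol c j m p)))).
  rewrite mulrDr mulr_sumr; congr (_ + _); first by rewrite /xi; ring.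
  by apply: eq_bigr => m _; ring.
congr (_ * _); apply: complexP.
  rewrite ReD raddf_sum /= !(mul0r, mulr0, add0r).
  rewrite -[X in _ = - X ^+ 2]/(linear_symbol c j p) expr2.
  have -> : linear_symbol c j p * linear_symbol c j p = xi p j * linear_symbol c j p +
      2 * (\sum_m scaled_mx c p m j * (eps m * xi p m)) * linear_symbol c j p.
    by rewrite -mulrDl.
  rewrite opprD; congr (_ + _).
  rewrite mulr_sumr mulr_suml -sumrN; apply: eq_bigr => m _.
  by rewrite /scaled_mx; ring.
rewrite ImD raddf_sum /= !(mul0r, mulr0, add0r, addr0); apply: eq_bigr => m _.
by rewrite !(mul0r, mulr0, add0r, addr0).
Qed.

Hypothesis twisted_orthogonal : forall th (x : 'I_(n + n) -> R),
  \sum_j eps j * (x j * twisted a th x j) = 0.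
Hypothesis twisted_square : forall th (x : 'I_(n + n) -> R),
  \sum_j eps j * twisted a th x j ^+ 2 = - (dotv th th / 4) * \sum_j eps j * x j ^+ 2.
Hypothesis structure_square : forall th,
  \sum_j eps j * \sum_m structure_mx a th m j * (structure_mx a th m j * eps m) =
  - (dotv th th / 4) * (n + n)%:R.
Hypothesis structure_diag : forall th j, structure_mx a th j j = 0.

Lemma linear_symbolE c j p :
  linear_symbol c j p = xi p j + 2 * (c * rho p) * twisted a (rsubmx p) (xi p) j.
Proof.
rewrite /linear_symbol /twisted !mulr_sumr; congr (_ + _); apply: eq_bigr => m _.
by rewrite /scaled_mx; ring.
Qed.

(** Expand the square: the cross term vanishes by skewness, and the last term is (4 c^2 / |theta|^2)
    times -(|theta|^2 / 4) P. With c = tanh t the factor 1 - c^2 is the derivative of c. *)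
Lemma sum_linear_symbol_sqr c p : rho p != 0 ->
  \sum_j eps j * linear_symbol c j p ^+ 2 = (1 - c ^+ 2) * quadP (lsubmx p).
Proof.
move=> r0; set k := 2 * (c * rho p).
transitivity (\sum_j eps j * xi p j ^+ 2 +
  2 * k * (\sum_j eps j * (xi p j * twisted a (rsubmx p) (xi p) j)) +
  k ^+ 2 * (\sum_j eps j * twisted a (rsubmx p) (xi p) j ^+ 2)).
  rewrite 2!mulr_sumr -!big_split /=; apply: eq_bigr => j _.
  by rewrite linear_symbolE -/k; ring.
rewrite twisted_orthogonal twisted_square -quadPE -enorm_sqr /k /invr_norm.
have : enorm (rsubmx p) != 0 by move: r0; rewrite invr_eq0.
by move=> r1; field.
Qed.

(** The Kronecker part selects the diagonal of A, which is zero; the rest is 2 c / |theta| times the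
    trace -(|theta|^2 / 4) 2n. *)
Lemma sum_dlinear_symbol c p : rho p != 0 ->
  \sum_j eps j * \sum_m A p m j * dlinear_symbol c j m p =
  - (n%:R * c * enorm (rsubmx p)).
Proof.
move=> r0; set k := 2 * (c * rho p).
transitivity (k * \sum_j eps j * \sum_m A p m j * (A p m j * eps m)).
  rewrite mulr_sumr; apply: eq_bigr => j _; rewrite mulrCA; congr (_ * _).
  rewrite mulr_sumr; transitivity (A p j j + \sum_m k * (A p m j * (A p m j * eps m))).
    transitivity (\sum_m A p m j * (m == j)%:R + \sum_m k * (A p m j * (A p m j * eps m))).
      rewrite -big_split; apply: eq_bigr => m _.
      by rewrite /dlinear_symbol /scaled_mx /k /=; ring.
    congr (_ + _); rewrite (bigD1 j) //= eqxx mulr1 big1 ?addr0// => m mj.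
    by rewrite (negbTE mj) mulr0.
  by rewrite structure_diag add0r.
rewrite structure_square -enorm_sqr /k /invr_norm natrD.
have : enorm (rsubmx p) != 0 by move: r0; rewrite invr_eq0.
by move=> r1; field.
Qed.

Definition symbol2 c p : R[i] := oscillation c p *
  ((- ((1 - c ^+ 2) * quadP (lsubmx p))) +i* (- (n%:R * c * enorm (rsubmx p)))).

Lemma sum_field_symbol c p :
  \sum_j (eps j)%:C * field_symbol a j (symbol1 c j) (dsymbol1 c j) p = symbol2 c p.
Proof.
under eq_bigr do rewrite field_symbol_symbol1 mulrCA.
(* At theta = 0 both sides vanish with [oscillation]; the two sums below are evaluated with |theta|
   invertible. *)
rewrite -mulr_sumr /symbol2; have [r0|r0] := eqVneq (rho p) 0.
  by rewrite /oscillation r0 !mul0r.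
congr (_ * _); apply: complexP.
  rewrite raddf_sum /= -sum_linear_symbol_sqr// -sumrN; apply: eq_bigr => j _; ring.
rewrite raddf_sum /= -sum_dlinear_symbol//; apply: eq_bigr => j _; ring.
Qed.

Lemma real_moderate_scaled_mx c m j : real_moderate (fun p => scaled_mx c p m j).
Proof.
apply: (@moderate_bounded _ _ _ _ (`|c| * \sum_k `|a m j k|)).
  apply: cmeasC; apply: measurable_funM.
    by apply: measurable_funM; [exact: measurable_cst|exact: measurable_invr_norm].
  apply: measurable_sum => k; apply: measurable_funM; first exact: measurable_cst.
  by under eq_fun do rewrite mxE; exact: measurable_coord.
move=> p; rewrite normc_real mulr1 /scaled_mx !normrM -mulrA ler_wpM2l//.
rewrite (ger0_norm (invr_norm_ge0 p)) mulrC.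
apply: (le_trans (ler_wpM2r (invr_norm_ge0 p) (structure_mx_bound a (rsubmx p) m j))).
rewrite -mulrA ler_piMr ?sumr_ge0// /invr_norm.
by have [->|r0] := eqVneq (enorm (rsubmx p)) 0; rewrite ?mul0r// divff.
Qed.

Lemma real_moderate_xi j : real_moderate (fun p => xi p j).
Proof. exact: moderate_coord. Qed.

Lemma real_moderate_linear_symbol c j : real_moderate (linear_symbol c j).
Proof.
apply: real_moderateD; first exact: real_moderate_xi.
apply: real_moderateM; first exact: real_moderate_cst.
apply: real_moderate_sum => m; apply: real_moderateM; first exact: real_moderate_scaled_mx.
by apply: real_moderateM; [exact: real_moderate_cst|exact: real_moderate_xi].
Qed.

Lemma measurable_phase c : measurable_fun setT (phase c).
Proof.
apply: measurable_funM.
  by apply: measurable_funM; [exact: measurable_cst|exact: measurable_invr_norm].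
apply: measurable_sum => j; under eq_fun do rewrite !mxE.
by apply: measurable_funB; apply: measurable_funX; exact: measurable_coord.
Qed.

Lemma normc_oscillation c p : normc (oscillation c p) = rho p.
Proof. by rewrite normcM normc_expi mulr1 normc_real ger0_norm// invr_norm_ge0. Qed.

Lemma moderate_oscillation c : moderate rho (oscillation c).
Proof.
apply: (@moderate_bounded _ _ _ _ 1); last by move=> p; rewrite normc_oscillation mul1r.
apply: cmeasM; first by apply: cmeasC; exact: measurable_invr_norm.
by apply: cmeas_expi; exact: measurable_phase.
Qed.

Lemma moderate_symbol1 c j : moderate rho (symbol1 c j).
Proof.
apply: moderateM; [exact: invr_norm_ge0| |exact: moderate_oscillation].
by apply: moderateI; exact: real_moderate_linear_symbol.
Qed.

Lemma moderate_doscillation c m j :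
  moderate rho (fun p => (A p m j)%:C * doscillation c m p).
Proof.
rewrite (_ : (fun p => _) = fun p =>
    (0 +i* (2 * (scaled_mx c p m j * (eps m * xi p m)))) * oscillation c p); last first.
  apply/funext => p; rewrite /doscillation mulrA; congr (_ * _).
  by apply: complexP; rewrite ?ReM ?ImM/= /scaled_mx; ring.
apply: moderateM; [exact: invr_norm_ge0| |exact: moderate_oscillation].
apply: moderateI; apply: real_moderateM; first exact: real_moderate_cst.
apply: real_moderateM; first exact: real_moderate_scaled_mx.
by apply: real_moderateM; [exact: real_moderate_cst|exact: real_moderate_xi].
Qed.

Lemma moderate_dsymbol1 c m j :
  moderate rho (fun p => (A p m j)%:C * dsymbol1 c j m p).
Proof.
rewrite (_ : (fun p => _) = fun p =>
    (0 +i* linear_symbol c j p) * ((A p m j)%:C * doscillation c m p) +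
    (0 +i* (A p m j * dlinear_symbol c j m p)) * oscillation c p); last first.
  apply/funext => p; rewrite /dsymbol1 mulrDr mulrCA; congr (_ + _).
  by rewrite mulrA; congr (_ * _); apply: complexP; rewrite ?ReM ?ImM/=; ring.
apply: moderateD; first exact: invr_norm_ge0.
  apply: moderateM; [exact: invr_norm_ge0| |exact: moderate_doscillation].
  by apply: moderateI; exact: real_moderate_linear_symbol.
apply: moderateM; [exact: invr_norm_ge0| |exact: moderate_oscillation].
apply: moderateI; apply: real_moderateM.
  apply: real_moderate_sum => k; apply: real_moderateM; first exact: real_moderate_cst.
  by under eq_fun do rewrite mxE; exact: moderate_coord.
apply: real_moderateD; first exact: real_moderate_cst.
apply: real_moderateM; first exact: real_moderate_cst.
by apply: real_moderateM; [exact: real_moderate_scaled_mx|exact: real_moderate_cst].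
Qed.

Lemma real_moderate_quadP : real_moderate (fun p => quadP (lsubmx p)).
Proof.
under eq_fun do rewrite quadPE.
apply: real_moderate_sum => j; apply: real_moderateM; first exact: real_moderate_cst.
by apply: real_moderateM; exact: real_moderate_xi.
Qed.

(** Each square is transposed in two moves: the outer field turns [oscillation] into [symbol1], and
    the inner one then acts on [symbol1]. The signed sum is [symbol2]. *)
Lemma cintegral_oscillation_ultra_hyperbolic c f : schwartz f ->
  cintegral lebd setT (fun p => oscillation c p * fourier (ultra_hyperbolic a f) p) =
  cintegral lebd setT (fun p => symbol2 c p * fourier f p).
Proof.
move=> sf; have sW j := schwartz_left_field a j sf.
have sWW j := schwartz_left_field a j (sW j).
have mS2 j : moderate rho (field_symbol a j (symbol1 c j) (dsymbol1 c j)).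
  apply: moderateD; first exact: invr_norm_ge0.
    apply: moderateM; [exact: invr_norm_ge0| |exact: moderate_symbol1].
    by apply: moderateI; exact: real_moderate_xi.
  by apply: moderate_sum; [exact: invr_norm_ge0|move=> m; exact: moderate_dsymbol1].
have i2 j := cintegrable_moderate s_gt1 (mS2 j) sf.
have i0 j := cintegrable_moderate s_gt1 (moderate_oscillation c) (sWW j).
transitivity (\sum_j (eps j)%:C * cintegral lebd setT
    (fun p => oscillation c p * fourier (left_field a j (left_field a j f)) p)).
  rewrite (eq_cintegral _ (g := fun p => \sum_j (eps j)%:C *
      (oscillation c p * fourier (left_field a j (left_field a j f)) p))).
    rewrite cintegral_sum; last by move=> j; exact: cintegrableZ.
    by apply: eq_bigr => j _; rewrite cintegralZ.
  move=> p; rewrite ultra_hyperbolicE fourier_sum; last by move=> j; exact: schwartzZ.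
  rewrite mulr_sumr; apply: eq_bigr => j _.
  by rewrite fourierZ// mulrCA.
transitivity (\sum_j (eps j)%:C * cintegral lebd setT
    (fun p => field_symbol a j (symbol1 c j) (dsymbol1 c j) p * fourier f p)).
  apply: eq_bigr => j _; apply: (congr1 ( *%R _)).
  rewrite (cintegral_left_field s_gt1 (sW j) (moderate_oscillation c)
    (fun m => moderate_doscillation c m j) (is_cderive_oscillation c)
    (cderivable_doscillation c)).
  rewrite (eq_cintegral _ (g := fun p => symbol1 c j p * fourier (left_field a j f) p)).
    apply: (cintegral_left_field s_gt1 sf (moderate_symbol1 c j)
      (fun m => moderate_dsymbol1 c m j) (is_cderive_symbol1 c j)
      (cderivable_dsymbol1 c j)).
  by move=> p; rewrite field_symbol_oscillation.
rewrite (eq_cintegral _ (g := fun p => \sum_j (eps j)%:C *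
    (field_symbol a j (symbol1 c j) (dsymbol1 c j) p * fourier f p))).
  rewrite cintegral_sum; last by move=> j; exact: cintegrableZ.
  by apply: eq_bigr => j _; rewrite cintegralZ.
move=> p; rewrite -sum_field_symbol mulr_suml; apply: eq_bigr => j _.
by rewrite mulrA.
Qed.

End phase_symbols.

(** * The integral over t and the fundamental solution *)

Section real_scaling.
Context {R : realType}.

Lemma Re_realM (x : R) (z : R[i]) : Re (x%:C * z) = x * Re z.
Proof. by rewrite ReM mul0r subr0. Qed.

Lemma Im_realM (x : R) (z : R[i]) : Im (x%:C * z) = x * Im z.
Proof. by rewrite ImM mul0r addr0. Qed.

End real_scaling.

(** * Hyperbolic functions and the integral over the half-line *)

Section hyperbolic_functions.
Context {R : realType}.
Local Notation leb := (@lebesgue_measure R).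
Local Notation cosh := Pilot.Defs.cosh.
Local Notation sinh := Pilot.Defs.sinh.
Local Notation tanh := Pilot.Defs.tanh.
Implicit Types t : R.

Lemma cosh_ge1 t : 1 <= cosh t.
Proof.
rewrite /Defs.cosh ler_pdivlMr// mul1r.
have := expR_ge1Dx t; have := expR_ge1Dx (- t); lra.
Qed.

Lemma cosh_gt0 t : 0 < cosh t.
Proof. exact: lt_le_trans (cosh_ge1 t). Qed.

(** From e^x = (e^(x/2))^2 >= (1 + x/2)^2 for x >= 0. A quadratic bound suffices, as it dominates
    the powers of 1/cosh by the integrable 8 / (1 + t^2). *)
Lemma cosh_ge_sqr t : (1 + t ^+ 2) / 8 <= cosh t.
Proof.
have h (x : R) : 0 <= x -> (1 + x ^+ 2) / 4 <= expR x.
  move=> x0; have e : expR x = expR (x / 2) * expR (x / 2).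
    by rewrite -expRD; congr expR; field.
  have := expR_ge1Dx (x / 2); rewrite e; nra.
rewrite /Defs.cosh; case: (leP 0 t) => t0.
  by have := h t t0; have := expR_ge0 (- t); lra.
have nt : 0 <= - t by lra.
by have := h _ nt; rewrite sqrrN; have := expR_ge0 t; lra.
Qed.

Lemma is_derive_cosh t : is_derive t 1 cosh (sinh t).
Proof.
apply: (@is_derive_eq _ _ _ (fun y : R => (expR y + expR (- y)) / 2)).
by rewrite !scaler0 add0r mulrN1 /Defs.sinh [RHS]mulrC.
Qed.

Lemma is_derive_sinh t : is_derive t 1 sinh (cosh t).
Proof.
apply: (@is_derive_eq _ _ _ (fun y : R => (expR y - expR (- y)) / 2)).
by rewrite !scaler0 add0r mulrN1 opprK /Defs.cosh [RHS]mulrC.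
Qed.

Definition sech_pow n t : R := (cosh t ^+ n)^-1.

Lemma is_derive_sech t : is_derive t 1 (sech_pow 1) (- (tanh t * sech_pow 1 t)).
Proof.
have c0 : cosh t != 0 by rewrite gt_eqF// cosh_gt0.
apply: (is_derive_eq (is_deriveV c0 (is_derive_cosh t))).
by rewrite /sech_pow /Defs.tanh expr1 -[LHS]mulrC expr2 invfM mulrN mulrA.
Qed.

Lemma is_cderive_sech_pow n t :
  is_cderive t 1 (fun y => (sech_pow n y)%:C) (- (n%:R * tanh t * sech_pow n t))%:C.
Proof.
elim: n => [|n IH].
  rewrite (_ : (fun y => _) = fun=> 1).
    by apply: is_cderive_eq; [exact: is_cderive_cst|rewrite !mul0r oppr0].
  by apply/funext => y; rewrite /sech_pow expr0 invr1.
rewrite (_ : (fun y => _) = fun y => (sech_pow 1 y)%:C * (sech_pow n y)%:C).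
  apply: is_cderive_eq; first exact: is_cderiveM (is_cderiveC (is_derive_sech t)) IH.
  have -> : sech_pow n.+1 t = sech_pow 1 t * sech_pow n t.
    by rewrite /sech_pow exprS expr1 invfM.
  by rewrite -natr1; apply: complexP; rewrite !(ReD, ReM, ImD, ImM)/=; ring.
by apply/funext => y; rewrite /sech_pow exprS expr1 invfM rmorphM.
Qed.

Lemma tanhE t : tanh t = sinh t * sech_pow 1 t.
Proof. by rewrite /sech_pow expr1. Qed.

Lemma is_cderive_tanh t :
  is_cderive t 1 (fun y => (tanh y)%:C) (1 - tanh t ^+ 2)%:C.
Proof.
rewrite (_ : (fun y => _) = fun y => (sinh y)%:C * (sech_pow 1 y)%:C).
  apply: is_cderive_eq.
    exact: is_cderiveM (is_cderiveC (is_derive_sinh t)) (is_cderiveC (is_derive_sech t)).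
  have e : cosh t * sech_pow 1 t = 1 by rewrite /sech_pow expr1 divff// gt_eqF// cosh_gt0.
  rewrite -!rmorphM -rmorphD; congr (_%:C); rewrite e.
  have -> : sinh t * - (tanh t * sech_pow 1 t) = - (tanh t * (sinh t * sech_pow 1 t)) by ring.
  by rewrite -tanhE; ring.
by apply/funext => y; rewrite tanhE rmorphM.
Qed.

Lemma sech_pow_ge0 n t : 0 <= sech_pow n t.
Proof. by rewrite invr_ge0 exprn_ge0// ltW// cosh_gt0. Qed.

Lemma sech_pow_le n t : (0 < n)%N -> sech_pow n t <= 8 * (1 + t ^+ 2)^-1.
Proof.
move=> n0; have p1 : 0 < 1 + t ^+ 2 by rewrite ltr_pwDl// sqr_ge0.
rewrite -[8]invrK -invfM /sech_pow lef_pV2 ?posrE ?exprn_gt0 ?cosh_gt0//; last first.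
  by rewrite mulr_gt0.
apply: (@le_trans _ _ (cosh t)).
  by rewrite mulrC; exact: cosh_ge_sqr.
by rewrite ler_eXnr// cosh_ge1.
Qed.

Lemma tanh_sqr_le1 t : tanh t ^+ 2 <= 1.
Proof.
have c0 := cosh_gt0 t; have e : cosh t ^+ 2 = sinh t ^+ 2 + 1.
  have : expR t * expR (- t) = 1 by rewrite expRN divff// gt_eqF// expR_gt0.
  by rewrite /Defs.cosh /Defs.sinh => e; field: e.
by rewrite /Defs.tanh expr_div_n ler_pdivrMr ?exprn_gt0// mul1r e lerDl.
Qed.

Lemma normr_tanh_le1 t : `|tanh t| <= 1.
Proof. by rewrite -(@ler_pXn2r _ 2)// ?nnegrE// expr1n real_normK ?num_real// tanh_sqr_le1. Qed.

Lemma measurable_sech_pow n : measurable_fun setT (sech_pow n).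
Proof.
apply: continuous_measurable_fun.
exact: (cderive_continuous (is_cderive_sech_pow n)).1.
Qed.

Lemma measurable_tanh : measurable_fun setT (tanh : R -> R).
Proof.
apply: continuous_measurable_fun; exact: (cderive_continuous is_cderive_tanh).1.
Qed.

(** As a factor of the integrand it turns the t-integral into one over the whole line, the form in
    which Fubini is stated. *)
Definition half_line (t : R) : R := \1_(`[0, +oo[%classic : set R) t.

Lemma half_line_ge0 t : 0 <= half_line t.
Proof. by rewrite /half_line indicE. Qed.

Lemma half_line_le1 t : half_line t <= 1.
Proof. by rewrite /half_line indicE lern1; case: (_ \in _). Qed.

Lemma measurable_half_line : measurable_fun setT half_line.
Proof. exact: measurable_indic. Qed.

Lemma cintegral_half_line (f : R -> R[i]) :
  cintegral leb `[0, +oo[ f = cintegral leb setT (fun t => (half_line t)%:C * f t).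
Proof.
rewrite /cintegral; congr (_ +i* _); rewrite [LHS]Rintegral_mkcond; apply: eq_Rintegral => t _.
  by rewrite Re_realM patchE /half_line indicE; case: ifPn => _; rewrite ?(mul1r, mul0r).
by rewrite Im_realM patchE /half_line indicE; case: ifPn => _; rewrite ?(mul1r, mul0r).
Qed.

(** The fundamental theorem of calculus on [0, k+1]: decay removes the upper boundary term, and the
    lower one remains. *)
Lemma integral_half_line_derive (u v : R -> R) :
  leb.-integrable setT (EFin \o (fun t => half_line t * v t)) ->
  (forall t, is_derive t 1 u (v t)) -> continuous v ->
  (exists C, forall t, `|t| * `|u t| <= C) ->
  \int[leb]_t (half_line t * v t) = - u 0.
Proof.
move=> vi du cv [C uC].
pose F (k : nat) (x : R) := v x * \1_(`[0, k.+1%:R]%classic : set R) x.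
have mv : measurable_fun setT v by exact: continuous_measurable_fun.
have mF k : measurable_fun setT (F k).
  by apply: measurable_funM => //; exact: measurable_indic.
have cF x : (fun k => F k x) @ \oo --> half_line x * v x.
  apply: cvg_near_cst; near=> k.
  rewrite /F mulrC /half_line !indicE; congr (_%:R * _).
  have kx : x <= k.+1%:R.
    apply: (le_trans (ler_norm x)); apply: (@le_trans _ _ k%:R); last by rewrite ler_nat.
    by near: k; exact: nbhs_infty_ger.
  by congr nat_of_bool; apply/idP/idP; rewrite !inE /= !in_itv/= ?kx ?andbT.
have H : (fun k => \int[leb]_x F k x) @ \oo --> \int[leb]_x (half_line x * v x).
  apply: (@dominated_Rintegral _ _ _ leb F _ (fun x => `|half_line x * v x|)) => //.
  - by apply: measurable_funM => //; exact: measurable_half_line.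
  - exact: (integrable_norm vi).
  move=> k x /=; rewrite /F mulrC !normrM ler_wpM2r// /half_line !indicE.
  rewrite !ger0_norm// ler_nat; case: (boolP (_ \in _)) => // h.
  by move: h; rewrite inE/= in_itv/= => /andP[h _]; rewrite mem_set//= in_itv/= h.
have E k : \int[leb]_x F k x = u k.+1%:R - u 0.
  have k0 : 0 < k.+1%:R :> R by [].
  have cu : continuous u.
    move=> x; apply: differentiable_continuous; apply/derivable1_diffP.
    exact: (@ex_derive _ _ _ _ _ _ _ (du x)).
  have : (\int[leb]_(x in `[(0 : R)%R, (k.+1%:R)%R]) (v x)%:E =
      (u k.+1%:R)%:E - (u 0%R)%:E)%E.
    apply: continuous_FTC2 => //.
    - exact: continuous_subspaceT.
    - split => [x _||]; first exact: (@ex_derive _ _ _ _ _ _ _ (du x)).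
      + by apply: cvg_at_right_filter; exact: cu.
      + by apply: cvg_at_left_filter; exact: cu.
    - by move=> x _; rewrite derive1E; exact: (@derive_val _ _ _ _ _ _ _ (du x)).
  rewrite -EFinB integral_mkcond => e; rewrite /Rintegral.
  rewrite -[RHS]/(fine (_%:E)) -e; congr fine; apply: eq_integral => x _.
  by rewrite /F patchE indicE; case: ifPn => _; rewrite ?mulr1 ?mulr0.
suff H0 : (fun k : nat => u k.+1%:R - u 0) @ \oo --> - u 0.
  move: H; under eq_fun do rewrite E.
  by move=> H; apply: (cvg_unique _ H H0).
rewrite -[X in _ --> X]add0r; apply: cvgB; last exact: cvg_cst.
apply: (@squeeze_cvgr _ _ _ _ (fun k : nat => - (C * k.+1%:R^-1))
  (fun k : nat => C * k.+1%:R^-1)).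
- apply: nearW => k; rewrite -ler_norml.
  by rewrite ler_pdivlMr// mulrC; have := uC k.+1%:R; rewrite (ger0_norm (ler0n _ _)).
- rewrite -[0 in X in _ --> X]oppr0 -(mulr0 C).
  by apply: cvgN; apply: cvgMl_tmp; exact: cvg_harmonic.
- by rewrite -(mulr0 C); apply: cvgMl_tmp; exact: cvg_harmonic.
Unshelve. all: end_near. Qed.

(** With b = P(xi) / |theta| this is cosh^-n t times [symbol2] at c = tanh t, divided by i. *)
Definition sech_integrand n (b t : R) : R[i] := (sech_pow n t)%:C *
  expi (tanh t * b) * ((- (n%:R * tanh t)) +i* ((1 - tanh t ^+ 2) * b)).

Lemma cintegrable_sech_integrand n (b : R) : (0 < n)%N ->
  cintegrable leb setT (fun t => (half_line t)%:C * sech_integrand n b t).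
Proof.
move=> n0; have mt := measurable_tanh.
apply: (@cintegrable_le _ _ _ leb _ (fun t : R => (n%:R + `|b|) * 8 * (1 + t ^+ 2)^-1)).
- apply: cmeasM; first by apply: cmeasC; exact: measurable_half_line.
  apply: cmeasM.
    apply: cmeasM; first by apply: cmeasC; exact: measurable_sech_pow.
    by apply: cmeas_expi; exact: measurable_funM.
  split => /=; first by apply: measurableT_comp => //; exact: measurable_funM.
  by apply: measurable_funM => //; apply: measurable_funB => //; exact: measurable_funX.
- rewrite (_ : _ \o _ = fun t => ((n%:R + `|b|) * 8)%:E * ((1 + t ^+ 2)^-1)%:E)%E//.
  by apply: integrableZl => //; exact: integrable_oneDsqrV.
move=> t; rewrite normcM normc_real (ger0_norm (half_line_ge0 t)).
apply: (@le_trans _ _ (normc (sech_integrand n b t))).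
  by rewrite ler_piMl ?normc_ge0// half_line_le1.
rewrite /sech_integrand normcM normcM normc_expi mulr1 normc_real.
rewrite (ger0_norm (sech_pow_ge0 n t)).
rewrite -mulrA mulrC; apply: ler_pM; rewrite ?normc_ge0 ?sech_pow_ge0 ?sech_pow_le//.
apply: (le_trans (normc_le_ReIm _)) => /=; rewrite normrN; apply: lerD; rewrite normrM.
  by rewrite normr_nat ler_piMr// normr_tanh_le1.
rewrite ler_piMl//; have := tanh_sqr_le1 t; have := sqr_ge0 (tanh t).
by rewrite ler_norml; lra.
Qed.

(* The integrand is the derivative of [t |-> cosh^-n t e^{i b tanh t}]. *)
Lemma cintegral_sech_integrand n (b : R) : (0 < n)%N ->
  cintegral leb setT (fun t => (half_line t)%:C * sech_integrand n b t) = - 1.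
Proof.
move=> n0; pose v := sech_integrand n b; have iv := cintegrable_sech_integrand b n0.
rewrite -[LHS]/(cintegral leb setT (fun t => (half_line t)%:C * v t)).
pose u t : R[i] := (sech_pow n t)%:C * expi (tanh t * b).
have dtb t : is_derive t 1 (fun y => tanh y * b) ((1 - tanh t ^+ 2) * b).
  have := is_cderiveM (is_cderive_tanh t) (is_cderive_cst t 1 b%:C).
  move=> -[+ _]; rewrite mulr0 add0r ReM /= mulr0 subr0.
  by under eq_fun do rewrite subr0.
have dexp t := is_cderive_expi (dtb t).
have du t : is_cderive t 1 u (v t).
  apply: (is_cderive_eq (is_cderiveM (is_cderive_sech_pow n t) (dexp t))).
  rewrite /v /sech_integrand; set E := expi _.
  by apply: complexP; rewrite !(ReD, ReM, ImD, ImM)/=; ring.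
have dv t : exists l, is_cderive t 1 v l.
  eexists; apply: is_cderiveM; first exact: du.
  rewrite (_ : (fun y => _) = fun y => (- n%:R : R)%:C * (tanh y)%:C +
     (0 +i* b) * (1 + - 1 * ((tanh y)%:C * (tanh y)%:C))); last first.
    apply/funext => y.
    by apply: complexP; rewrite !(ReD, ReM, ReN, ImD, ImM, ImN)/=; ring.
  have dt := is_cderive_tanh t.
  exact: is_cderiveD (is_cderiveZ _ dt) (is_cderiveZ _ (is_cderiveD (is_cderive_cst _ _ _)
    (is_cderiveZ _ (is_cderiveM dt dt)))).
have [w dw] := choice dv.
have [cv1 cv2] := cderive_continuous dw.
have ub t : `|t| * normc (u t) <= 8.
  rewrite normcM normc_expi mulr1 normc_real (ger0_norm (sech_pow_ge0 n t)).
  apply: (le_trans (ler_wpM2l (normr_ge0 t) (sech_pow_le t n0))).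
  have p1 : 0 < 1 + t ^+ 2 by rewrite ltr_pwDl// sqr_ge0.
  rewrite mulrCA ler_piMr// ler_pdivrMr// mul1r -[t ^+ 2]real_normK ?num_real//.
  have := sqr_ge0 (`|t| - 1); have := normr_ge0 t; nra.
have u0 : u 0 = 1.
  by rewrite /u /sech_pow /Defs.tanh /Defs.sinh /Defs.cosh oppr0 expR0 subrr !mul0r expi0
    divff// expr1n invr1 mulr1.
have iR : leb.-integrable setT (EFin \o (fun t => half_line t * Re (v t))).
  have := iv.1; rewrite (_ : (fun t => Re _) = fun t => half_line t * Re (v t))//.
  by apply/funext => t; rewrite Re_realM.
have iI : leb.-integrable setT (EFin \o (fun t => half_line t * Im (v t))).
  have := iv.2; rewrite (_ : (fun t => Im _) = fun t => half_line t * Im (v t))//.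
  by apply/funext => t; rewrite Im_realM.
apply: complexP.
  transitivity (\int[leb]_t (half_line t * Re (v t))).
    by apply: eq_Rintegral => t _; rewrite Re_realM.
  rewrite (integral_half_line_derive iR (fun t => (du t).1) cv1) ?u0//.
  by exists 8 => t; apply: le_trans (ub t); rewrite ler_wpM2l// Re_le_normc.
transitivity (\int[leb]_t (half_line t * Im (v t))).
  by apply: eq_Rintegral => t _; rewrite Im_realM.
rewrite (integral_half_line_derive iI (fun t => (du t).2) cv2) ?u0//.
by exists 8 => t; apply: le_trans (ub t); rewrite ler_wpM2l// Im_le_normc.
Qed.

End hyperbolic_functions.

(** * The distribution K: convergence, continuity and its image under the operator *)

Section K0s_distribution.
Context {R : realType} {n s : nat}.
Hypothesis s_gt1 : (1 < s)%N.
Hypothesis n_gt0 : (0 < n)%N.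
Local Notation leb := (@lebesgue_measure R).
Local Notation d := (n + n + s)%N.
Local Notation lebd := (@lebesgue_rV R d).
Local Notation rho := (@invr_norm R (n + n) s).
Local Notation tanh := Pilot.Defs.tanh.
Implicit Types (p : 'rV[R]_d) (t : R) (f : 'rV[R]_d -> R[i]).

Definition time_weight t : R := half_line t * sech_pow n t.

Definition time_majorant t : R := 8 * (1 + t ^+ 2)^-1.

Lemma time_weight_ge0 t : 0 <= time_weight t.
Proof. by rewrite mulr_ge0// ?half_line_ge0 ?sech_pow_ge0. Qed.

Lemma time_weight_le t : time_weight t <= time_majorant t.
Proof.
apply: le_trans (sech_pow_le t n_gt0).
by rewrite ler_piMl ?sech_pow_ge0// half_line_le1.
Qed.

Lemma measurable_time_weight : measurable_fun setT time_weight.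
Proof. exact: measurable_funM measurable_half_line (measurable_sech_pow n). Qed.

Lemma integrable_time_majorant : leb.-integrable setT (EFin \o time_majorant).
Proof.
rewrite (_ : _ \o _ = fun t => (8%:E * ((1 + t ^+ 2)^-1)%:E)%E)//.
by apply: integrableZl => //; exact: integrable_oneDsqrV.
Qed.

Lemma measurable_tanh_snd :
  measurable_fun setT (fun z : 'rV[R]_d * measurableTypeR R => tanh z.2).
Proof. exact: (measurableT_comp measurable_tanh measurable_snd). Qed.

Lemma cmeas_oscillation2 :
  cmeas (fun z : 'rV[R]_d * measurableTypeR R => oscillation (tanh z.2) z.1).
Proof.
apply: cmeasM.
  by apply: cmeasC; exact: (measurableT_comp measurable_invr_norm measurable_fst).
apply: cmeas_expi; rewrite (_ : (fun z => _) = fun z : 'rV[R]_d * measurableTypeR R =>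
  tanh z.2 * phase 1 z.1); last by apply/funext => z; rewrite /phase; ring.
apply: measurable_funM; first exact: measurable_tanh_snd.
exact: (measurableT_comp (measurable_phase 1) measurable_fst).
Qed.

Lemma cintegrable_time (Psi : 'rV[R]_d * measurableTypeR R -> R[i]) (C : R) :
  cmeas Psi -> (forall z, normc (Psi z) <= C * (rho z.1 * weight z.1)) ->
  cintegrable (lebd \x leb)%E setT (fun z => (time_weight z.2)%:C * Psi z).
Proof.
move=> mP hP.
apply: (cintegrable_le _ (integrable_prodM (integrable_invr_norm_weightZ s_gt1 C)
    integrable_time_majorant)).
  apply: cmeasM => //; apply: cmeasC.
  exact: (measurableT_comp measurable_time_weight measurable_snd).
move=> z; rewrite normcM normc_real (ger0_norm (time_weight_ge0 _)) mulrC.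
by apply: ler_pM; rewrite ?normc_ge0 ?time_weight_ge0 ?time_weight_le.
Qed.

Definition K0s_kernel f (z : 'rV[R]_d * measurableTypeR R) : R[i] :=
  (time_weight z.2)%:C * (oscillation (tanh z.2) z.1 * fourier f z.1).

Lemma cintegrable_K0s_kernel f : schwartz f ->
  cintegrable (lebd \x leb)%E setT (K0s_kernel f).
Proof.
move=> sf; have sm c := moderate_fourier (moderate_oscillation c) sf.
(* The modulus of [oscillation c] does not depend on [c], so the bound at c = 1 serves every t. *)
have [C [_ hC]] := moderate_fourier (moderate_oscillation 1) sf.
apply: (@cintegrable_time _ C).
  apply: cmeasM; first exact: cmeas_oscillation2.
  exact: (cmeas_comp (cmeas_fourier sf) measurable_fst).
move=> z; apply: le_trans (hC z.1).
by rewrite normcM [leRHS]normcM !normc_oscillation.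
Qed.

Definition K0s_cst : R := ((2 * pi) `^ (n%:R + s%:R / 2))^-1.

Lemma normc_time_oscillation t p :
  normc ((time_weight t)%:C * oscillation (tanh t) p) <= rho p * time_majorant t.
Proof.
rewrite normcM normc_real (ger0_norm (time_weight_ge0 _)) normc_oscillation mulrC.
by rewrite ler_wpM2l ?invr_norm_ge0// time_weight_le.
Qed.

Lemma integrable_time_majorantZ (C : R) :
  leb.-integrable setT (EFin \o (fun t => C * time_majorant t)).
Proof.
rewrite (_ : _ \o _ = fun t => (C%:E * (time_majorant t)%:E)%E)//.
by apply: integrableZl => //; exact: integrable_time_majorant.
Qed.

Lemma cintegrable_time_oscillation p :
  cintegrable leb setT (fun t => (time_weight t)%:C * oscillation (tanh t) p).
Proof.
apply: (@cintegrable_le _ _ _ leb _ (fun t : R => rho p * time_majorant t)).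
- apply: cmeasM; first by apply: cmeasC; exact: measurable_time_weight.
  exact: (cmeas_comp cmeas_oscillation2 (pair1_measurable _ : measurable_fun _ (pair p))).
- exact: integrable_time_majorantZ.
- by move=> t; exact: normc_time_oscillation.
Qed.

Lemma q0sE p : q0s (lsubmx p) (rsubmx p) = (0 +i* K0s_cst) *
  cintegral leb setT (fun t => (time_weight t)%:C * oscillation (tanh t) p).
Proof.
rewrite /q0s cintegral_half_line; congr (_ * _); apply: eq_cintegral => t.
have -> : (enorm (rsubmx p) * Defs.cosh t ^+ n)^-1 = rho p * sech_pow n t by rewrite invfM.
by rewrite /oscillation /phase /time_weight !rmorphM; ring.
Qed.

Lemma K0s_integrandE f p :
  K0s_integrand f p = (0 +i* K0s_cst) * cintegral leb setT (fun t => K0s_kernel f (p, t)).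
Proof.
rewrite /K0s_integrand q0sE -mulrA; congr (_ * _).
rewrite -cintegralZr; last exact: cintegrable_time_oscillation.
by apply: eq_cintegral => t; rewrite /K0s_kernel mulrA.
Qed.

Lemma cintegrable_K0s_integrand f : schwartz f ->
  cintegrable lebd setT (K0s_integrand f).
Proof.
move=> sf; rewrite (_ : K0s_integrand f = fun p =>
  (0 +i* K0s_cst) * cintegral leb setT (fun t => K0s_kernel f (p, t))).
  by apply: cintegrableZ; apply: cintegrable_cintegral1; exact: cintegrable_K0s_kernel.
by apply/funext => p; exact: K0s_integrandE.
Qed.

Lemma K0sE f : schwartz f -> K0s f = (0 +i* K0s_cst) *
  cintegral leb setT (fun t => (time_weight t)%:C *
    cintegral lebd setT (fun p => oscillation (tanh t) p * fourier f p)).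
Proof.
move=> sf; have ik := cintegrable_K0s_kernel sf.
rewrite /K0s (eq_cintegral _ (K0s_integrandE f)) cintegralZ; last exact: cintegrable_cintegral1.
congr (_ * _); rewrite (cFubini ik); apply: eq_cintegral => t.
rewrite -cintegralZ//; apply: cintegrable_moderate => //; exact: moderate_oscillation.
Qed.

(** Taking the modulus inside the t-integral loses the oscillation but leaves a multiple of
    |theta|^-1, which is integrable against the weight. *)
Lemma normc_q0s p : normc (q0s (lsubmx p) (rsubmx p)) <=
  `|K0s_cst| * (2 * (rho p * \int[leb]_t time_majorant t)).
Proof.
rewrite q0sE normcM normc_imag ler_wpM2l//.
rewrite -RintegralZl//; last exact: integrable_time_majorant.
apply: normc_cintegral_le; first exact: cintegrable_time_oscillation.
- exact: integrable_time_majorantZ.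
- by move=> t; exact: normc_time_oscillation.
Qed.

Lemma K0s_tempered : tempered_distribution (@K0s R n s).
Proof.
split=> [c f g sf sg|].
  rewrite /K0s -cintegralZ; last exact: cintegrable_K0s_integrand.
  rewrite -cintegralD; first last.
  - exact: cintegrable_K0s_integrand.
  - by apply: cintegrableZ; exact: cintegrable_K0s_integrand.
  apply: eq_cintegral => p; rewrite /K0s_integrand fourier_lin//; ring.
set I := \int[leb]_t time_majorant t; set Wn := \int[lebd]_p (rho p * weight p).
have I0 : 0 <= I.
  apply: Rintegral_ge0 => t _; rewrite /time_majorant mulr_ge0// invr_ge0 addr_ge0//.
  exact: sqr_ge0.
(* The order and [fourier_cst] come from [fourier_weight], the factor with [I] from [normc_q0s], and
   the outer 2 from [normc_cintegral_le]. *)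
exists d.*2, (2 * (`|K0s_cst| * (2 * I) * (@fourier_cst R d) * Wn)) => f sf.
set S := schwartz_norm _ f.
have -> : 2 * (`|K0s_cst| * (2 * I) * @fourier_cst R d * Wn) * S =
    2 * (`|K0s_cst| * (2 * I) * @fourier_cst R d * S * Wn) by ring.
rewrite /Wn -RintegralZl//; last exact: integrable_invr_norm_weight.
apply: normc_cintegral_le; first exact: cintegrable_K0s_integrand.
  exact: integrable_invr_norm_weightZ.
move=> p; rewrite /K0s_integrand normcM.
apply: (le_trans (ler_pM (normc_ge0 _) (normc_ge0 _) (normc_q0s p) (fourier_weight p sf))).
by rewrite -/I -/S le_eqVlt; apply/orP; left; apply/eqP; ring.
Qed.

Lemma ae_invr_norm_neq0 : {ae lebd, forall p, rho p != 0}.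
Proof.
have k : 'I_s by exists 0%N; exact: ltn_trans s_gt1.
apply: filterS (hyperplane_null (R := R) (rshift (n + n) k)) => p.
apply: contraNneq => /eqP; rewrite invr_eq0 => /eqP r0.
by have := coord_le_enorm (rsubmx p) k; rewrite r0 normr_le0 mxE.
Qed.

Lemma cmeas_symbol2 :
  cmeas (fun z : 'rV[R]_d * measurableTypeR R => symbol2 (tanh z.2) z.1).
Proof.
have m1 := measurable_tanh_snd.
apply: cmeasM; first exact: cmeas_oscillation2.
split => /=.
  apply: measurableT_comp => //; apply: measurable_funM.
    by apply: measurable_funB => //; exact: measurable_funX.
  exact: (measurableT_comp (real_moderate_quadP (R := R) (n := n) (s := s)).1.1 measurable_fst).
apply: measurableT_comp => //; apply: measurable_funM.
  by apply: measurable_funM.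
rewrite (_ : (fun z => _) = (fun p => (rho p)^-1) \o fst); last first.
  by apply/funext => z; rewrite /= /invr_norm invrK.
apply: measurableT_comp measurable_fst.
exact: measurableT_comp measurable_invr measurable_invr_norm.
Qed.

(** The bound is uniform in t because |tanh t| <= 1: the polynomial part of the symbol is at most
    |P| + n |theta|. *)
Lemma symbol2_fourier f : schwartz f -> exists C, forall t p,
  normc (symbol2 (tanh t) p * fourier f p) <= C * (rho p * weight p).
Proof.
move=> sf.
(* A polynomial majorant, by |P| <= 1 + P^2 and |theta| <= 1 + |theta|^2. It is multiplied by
   [oscillation 0] below for the sake of the modulus [rho] of the latter. *)
pose M p := 1 + quadP (lsubmx p) * quadP (lsubmx p) +
  n%:R * (1 + \sum_k p 0 (rshift (n + n) k) * p 0 (rshift (n + n) k)).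
have mM : moderate rho (fun p => (M p)%:C * oscillation 0 p).
  apply: moderateM; [exact: invr_norm_ge0| |exact: moderate_oscillation].
  apply: real_moderateD.
    apply: real_moderateD; first exact: real_moderate_cst.
    by apply: real_moderateM; exact: real_moderate_quadP.
  apply: real_moderateM; first exact: real_moderate_cst.
  apply: real_moderateD; first exact: real_moderate_cst.
  by apply: real_moderate_sum => k; apply: real_moderateM; exact: moderate_coord.
have [C [_ hC]] := moderate_fourier mM sf; exists C => t p.
apply: le_trans (hC p); rewrite normcM [leRHS]normcM ler_wpM2r ?normc_ge0//.
rewrite [leLHS]normcM [leRHS]normcM !normc_oscillation mulrC.
rewrite ler_wpM2r ?invr_norm_ge0// normc_real; apply: le_trans (ler_norm _).
apply: (le_trans (normc_le_ReIm _)) => /=; rewrite !normrN; apply: lerD.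
  rewrite normrM; apply: (@le_trans _ _ `|quadP (lsubmx p)|).
    rewrite ler_piMl//; have := tanh_sqr_le1 t; have := sqr_ge0 (tanh t).
    by rewrite ler_norml; lra.
  rewrite -expr2 -[_ ^+ 2]real_normK ?num_real//.
  have := sqr_ge0 (`|quadP (lsubmx p)| - 1); nra.
rewrite -mulrA normrM normr_nat ler_wpM2l// normrM.
rewrite (ger0_norm (enorm_ge0 _)).
apply: (@le_trans _ _ (enorm (rsubmx p))); first by rewrite ler_piMl ?enorm_ge0// normr_tanh_le1.
have := enorm_sqr (rsubmx p); rewrite /dotv.
under eq_bigr do rewrite !mxE.
move=> <-; have := sqr_ge0 (enorm (rsubmx p) - 1); have := enorm_ge0 (rsubmx p); nra.
Qed.

Lemma time_symbol2E p t : rho p != 0 -> (time_weight t)%:C * symbol2 (tanh t) p =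
  (0 +i* 1) * ((half_line t)%:C * sech_integrand n (rho p * quadP (lsubmx p)) t).
Proof.
move=> r0; have r1 : enorm (rsubmx p) != 0 by move: r0; rewrite invr_eq0.
have rr : rho p * enorm (rsubmx p) = 1 by rewrite /invr_norm mulVf.
rewrite /symbol2 /oscillation /phase /sech_integrand /time_weight rmorphM.
rewrite -[tanh t * rho p * _]mulrA; set E := expi _.
move: rr; set r := enorm _; set q := rho p; set T := tanh t; set P := quadP _ => rr.
have -> : (half_line t)%:C * (sech_pow n t)%:C *
    (q%:C * E * (- ((1 - T ^+ 2) * P) +i* - (n%:R * T * r))) =
  (half_line t)%:C * (sech_pow n t)%:C * E * (q%:C * (- ((1 - T ^+ 2) * P) +i* - (n%:R * T * r))).
  by ring.
have -> : q%:C * (- ((1 - T ^+ 2) * P) +i* - (n%:R * T * r)) =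
   (0 +i* 1) * ((- (n%:R * T)) +i* ((1 - T ^+ 2) * (q * P))).
  move: q r T P rr => q r T P rr.
  by apply: complexP; rewrite ?(Re_realM, Im_realM, ReM, ImM)/=; ring: rr.
by ring.
Qed.

Lemma cintegrable_time_symbol2 p : rho p != 0 ->
  cintegrable leb setT (fun t => (time_weight t)%:C * symbol2 (tanh t) p).
Proof.
move=> r0; rewrite (_ : (fun t => _) = fun t => (0 +i* 1) * ((half_line t)%:C *
    sech_integrand n (rho p * quadP (lsubmx p)) t)).
  by apply: cintegrableZ; exact: cintegrable_sech_integrand.
by apply/funext => t; exact: time_symbol2E.
Qed.

Lemma cintegral_time_symbol2 p : rho p != 0 ->
  cintegral leb setT (fun t => (time_weight t)%:C * symbol2 (tanh t) p) = 0 +i* (- 1).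
Proof.
move=> r0; transitivity (cintegral leb setT (fun t => (0 +i* 1) * ((half_line t)%:C *
    sech_integrand n (rho p * quadP (lsubmx p)) t))).
  by apply: eq_cintegral => t; exact: time_symbol2E.
rewrite cintegralZ; last exact: cintegrable_sech_integrand.
rewrite cintegral_sech_integrand//.
by apply: complexP; rewrite ?(ReM, ImM, ReN, ImN)/=; ring.
Qed.

Variable a : 'I_(n + n) -> 'I_(n + n) -> 'I_s -> R.
Hypothesis symbol_identity : forall t f, schwartz f ->
  cintegral lebd setT (fun p => oscillation t p * fourier (ultra_hyperbolic a f) p) =
  cintegral lebd setT (fun p => symbol2 t p * fourier f p).

Lemma K0s_ultra_hyperbolic f : schwartz f -> K0s (ultra_hyperbolic a f) = f 0.
Proof.
move=> sf; have sD := schwartz_ultra_hyperbolic a sf.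
pose G (z : 'rV[R]_d * measurableTypeR R) :=
  (time_weight z.2)%:C * (symbol2 (tanh z.2) z.1 * fourier f z.1).
have [C hC] := symbol2_fourier sf.
have iG : cintegrable (lebd \x leb)%E setT G.
  apply: (@cintegrable_time _ C); last by move=> z; exact: hC.
  apply: cmeasM; first exact: cmeas_symbol2.
  exact: (cmeas_comp (cmeas_fourier sf) measurable_fst).
have mf := cmeas_fourier sf.
have if_ : cintegrable lebd setT (fourier f).
  apply: (cintegrable_le mf (integrable_weightZ _)) => p; exact: fourier_weight.
have mS t : cmeas (symbol2 (tanh t) : 'rV[R]_d -> R[i]).
  exact: (cmeas_comp cmeas_symbol2 (pair2_measurable t)).
have iS t : cintegrable lebd setT (fun p => symbol2 (tanh t) p * fourier f p).
  apply: (cintegrable_le (cmeasM (mS t) mf) (integrable_invr_norm_weightZ s_gt1 C)).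
  by move=> p; exact: hC.
rewrite K0sE//.
transitivity ((0 +i* K0s_cst) *
    cintegral leb setT (fun t => cintegral lebd setT (fun p => G (p, t)))).
  congr (_ * _); apply: eq_cintegral => t.
  by rewrite symbol_identity// -cintegralZ.
rewrite -(cFubini iG).
(* The t-integral of the symbol is -i off the null set theta = 0; on that set the symbol vanishes,
   so equality holds almost everywhere only. *)
rewrite (@ae_eq_cintegral _ _ _ lebd _ (fun p => (0 +i* (- 1)) * fourier f p)); first last.
- apply: filterS ae_invr_norm_neq0 => p r0.
  rewrite -(cintegral_time_symbol2 r0) -cintegralZr; last exact: cintegrable_time_symbol2.
  by apply: eq_cintegral => t; rewrite /G mulrA.
- by apply: cmeasM => //; exact: cmeas_cst.
- exact: cintegrable_cmeas (cintegrable_cintegral1 iG).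
rewrite cintegralZ// mulrA -(fourier_inversion0 sf); congr (_ * _).
(* The exponent n + s/2 is half of 2n + s, so the normalisation of K is that of Fourier inversion;
   the prefactor i cancels -i. *)
have -> : K0s_cst = (2 * pi) `^ (- (d%:R / 2)).
  rewrite /K0s_cst -powRN; congr (_ `^ - _); by rewrite !natrD; field.
by apply: complexP; rewrite ?(ReM, ImM)/=; ring.
Qed.

End K0s_distribution.

Theorem theorem5p1 (R : realType) (n s : nat) (s_gt1 : (1 < s)%N)
    (V : vectType R) (V_neq0 : fullv != 0%VS :> {vspace V})
    (B : {symmetric V}) (J : {linear 'rV[R]_s -> 'End(V)})
    (BJ_admissible : admissible B J)
    (br : V -> V -> 'rV[R]_s) (br_bracket : is_bracket B J br)
    (X : (n + n).-tuple V) (X_basis : neutral_basis B X)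
    (a : 'I_(n + n) -> 'I_(n + n) -> 'I_s -> R)
    (a_constants : structure_constants br X a) :
  (forall f : 'rV[R]_(n + n + s) -> R[i], schwartz f ->
     cintegrable (lebesgue_rV (n + n + s)) setT (K0s_integrand f)) /\
  fundamental_solution (ultra_hyperbolic a) K0s.
Proof.
have n_gt0 := neutral_n_gt0 X_basis V_neq0.
split=> [f sf|]; first exact: cintegrable_K0s_integrand.
split; first exact: K0s_tempered.
apply: (K0s_ultra_hyperbolic s_gt1 n_gt0) => c g sg.
apply: (cintegral_oscillation_ultra_hyperbolic s_gt1) sg.
- exact: (sum_twisted BJ_admissible br_bracket a_constants).
- exact: (sum_twisted_sqr BJ_admissible br_bracket X_basis a_constants).
- exact: (sum_structure_mx_sqr BJ_admissible br_bracket X_basis a_constants).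
- exact: (structure_mx_diag BJ_admissible br_bracket a_constants).
Qed.
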